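(* Let $\mathfrak M$ be a Hilbert space. All inner families in the Stieltjes and inverse Stieltjes classes are described as follows: (1) The inner families from the class $\widetilde{\mathcal S}(\mathfrak M)$ are of the form $$\mathcal Q(\lambda)=-\lambda^{-1}\,\mathcal B,\qquad\lambda\in\mathbb C\setminus\mathbb R_+,$$ where $\mathcal B$ runs through the set of all nonnegative selfadjoint relations in $\mathfrak M$. (2) The inner families from the class $\widetilde{\mathcal S}^{(-1)}(\mathfrak M)$ are of the form $$\mathcal R(\lambda)=\lambda\,\mathcal C,\qquad\lambda\in\mathbb C\setminus\mathbb R_+,$$ where $\mathcal C$ runs through the set of all nonnegative selfadjoint relations in $\mathfrak M$.
   Context: All Hilbert spaces are complex and separable; $\mathbb R_+=[0,+\infty)$, $\mathbb C_\pm$ are the open upper/lower half-planes; $\mathbf B(\mathfrak M)$ is the algebra of bounded everywhere defined operators. A linear relation in $\mathfrak M$ is a linear subspace $H$ of $\mathfrak M\times\mathfrak M$, with elements $\{f,f'\}$; operators are identified with graphs. $H^{-1}=\{\{f',f\}:\{f,f'\}\in H\}$, $cH=\{\{f,cf'\}\}$, $H+cI=\{\{f,f'+cf\}\}$. Adjoint: $H^*=\{\{k,k'\}:(h',k)=(h,k')\ \forall\{h,h'\}\in H\}$; $H$ is selfadjoint if $H=H^*$; $H\ge0$ (nonnegative) if $(f',f)\ge0$ on $H$; $H\le0$ if $-H\ge0$; $H$ is dissipative (accumulative) if $\operatorname{Im}(f',f)\ge0$ ($\le0$) on $H$; maximal means having no proper extension with the same property. A family of linear relations $\mathcal M(\lambda)$,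 $\lambda\in\mathbb C\setminus\mathbb R$, in $\mathfrak M$ is a Nevanlinna family if: (i) $\mathcal M(\lambda)$ is maximal dissipative for $\lambda\in\mathbb C_+$ (resp. maximal accumulative for $\lambda\in\mathbb C_-$); (ii) $\mathcal M(\lambda)^*=\mathcal M(\bar\lambda)$; (iii) for some (hence all) $\mu\in\mathbb C_+$ ($\mathbb C_-$) the family $(\mathcal M(\lambda)+\mu)^{-1}\in\mathbf B(\mathfrak M)$ is holomorphic for $\lambda\in\mathbb C_+$ ($\mathbb C_-$). A family $\mathcal M(\lambda)$, $\lambda\in\mathbb C\setminus\mathbb R_+$, is a Stieltjes family, class $\widetilde{\mathcal S}(\mathfrak M)$ (respectively inverse Stieltjes family, class $\widetilde{\mathcal S}^{(-1)}(\mathfrak M)$) if it is a Nevanlinna family and, moreover, (i) $\mathcal M(x)\ge0$ for all $x<0$ (respectively $\mathcal M(x)\le0$ for all $x<0$), (ii) for some (hence all) $\mu\in\mathbb C_+$ ($\mathbb C_-$) the operator family $(\mathcal M(\lambda)+\mu)^{-1}\in\mathbf B(\mathfrak M)$, $\lambda\in\mathbb C_+$ ($\mathbb C_-$), admits an analytic continuation to $(-\infty,0)$. A family $S$ from the class $\widetilde{\mathcal S}(\mathfrak M)$ or $\widetilde{\mathcal S}^{(-1)}(\mathfrak M)$ is said to be inner if $\operatorname{Re}(S(iy)f,f)=0$, $f\in\operatorname{dom}S(iy)$, holds for all $y\in\mathbb R\setminus\{0\}$ (that is, $\operatorname{Re}(f',f)=0$ for all $\{f,f'\}\in S(iy)$).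 *)

(* Defs.v *)
From HB Require Import structures.
From mathcomp Require Import all_boot all_order all_algebra.
From mathcomp Require Import complex.
From mathcomp Require Import all_classical all_reals all_analysis.

Set Implicit Arguments.
Unset Strict Implicit.
Unset Printing Implicit Defensive.

Import Order.TTheory GRing.Theory Num.Theory.
Import numFieldNormedType.Exports.

Local Open Scope classical_set_scope.
Local Open Scope complex_scope.
Local Open Scope ring_scope.

(* The inner product is linear in its first argument and conjugate-linear in
   its second one, and it induces the given complete norm. *)
HB.mixin Record isHilbert (R : realType) M & CompleteNormedModule R[i] M := {
  inner : {dot M for Num.conj} ;
  inner_norm : forall f : M, inner f f = `|f| ^+ 2 }.

#[short(type="hilbertType")]
HB.structure Definition Hilbert (R : realType) :=
  {M of isHilbert R M & CompleteNormedModule R[i] M}.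

Definition separable (T : topologicalType) : Prop :=
  exists2 D : set T, countable D & dense D.

Section LinearRelations.
Context {R : realType} {M : hilbertType R}.
Implicit Types (H K : set (M * M)) (c : R[i]) (T : {linear M -> M}).

Definition linear_relation H : Prop :=
  H 0 /\ forall c p q, H p -> H q -> H (c *: p + q).

Definition graph (T : M -> M) : set (M * M) := [set (f, T f) | f in setT].

Definition inv_rel H : set (M * M) := [set (p.2, p.1) | p in H].

Definition scale_rel c H : set (M * M) := [set (p.1, c *: p.2) | p in H].

Definition shift_rel H c : set (M * M) := [set (p.1, p.2 + c *: p.1) | p in H].

Definition adjoint H : set (M * M) :=
  [set k | forall h, H h -> inner h.2 k.1 = inner h.1 k.2].

Definition selfadjoint H : Prop := linear_relation H /\ H = adjoint H.

(* In the order of [R[i]], [0 <= z] means that [z] is real and nonnegative. *)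
Definition nonnegative H : Prop := forall p, H p -> 0 <= inner p.2 p.1.

Definition nonpositive H : Prop := nonnegative (scale_rel (-1) H).

Definition dissipative H : Prop := forall p, H p -> 0 <= complex.Im (inner p.2 p.1).

Definition accumulative H : Prop := forall p, H p -> complex.Im (inner p.2 p.1) <= 0.

Definition maximal (P : set (M * M) -> Prop) H : Prop :=
  [/\ linear_relation H, P H &
      forall K, linear_relation K -> P K -> H `<=` K -> K = H].

Definition bounded_operator T : Prop := bounded_near T (nbhs (0 : M)).

(* [(H + mu)^-1] is the graph of the everywhere defined operator [T]. *)
Definition is_resolvent H mu T : Prop := graph T = inv_rel (shift_rel H mu).

End LinearRelations.

Section Families.
Context {R : realType} {M : hilbertType R}.
Implicit Types (U : set R[i]^o) (mu : R[i]) (S : R[i] -> set (M * M)).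

Definition upper_half_plane : set R[i]^o := [set z : R[i] | 0 < complex.Im z].

Definition lower_half_plane : set R[i]^o := [set z : R[i] | complex.Im z < 0].

Definition negative_axis : set R[i]^o := [set x%:C | x in [set x : R | x < 0]].

Definition off_Rplus : set R[i]^o := ~` [set x%:C | x in [set x : R | 0 <= x]].

(* Complex differentiability of a [B(M)]-valued function at every point of [U]:
   the last condition spells out that the difference quotients converge to [D]
   in operator norm. *)
Definition holomorphic_on U (G : R[i]^o -> {linear M -> M}) : Prop :=
  (forall z, U z -> bounded_operator (G z)) /\
  (forall z, U z -> exists2 D : {linear M -> M}, bounded_operator D &
     forall eps : R[i], 0 < eps -> \forall w \near z^',
       forall f : M, `|(w - z)^-1 *: (G w f - G z f) - D f| <= eps * `|f|).

Definition holomorphic_resolvent S mu U : Prop :=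
  exists2 G : R[i]^o -> {linear M -> M}, holomorphic_on U G &
    forall z, U z -> is_resolvent (S z) mu (G z).

(* The family of resolvents on the half-plane [U] extends holomorphically to an
   open set [V] that contains the negative axis; on that axis the extension is
   the resolvent of the members [S x], x < 0, of the family. *)
Definition continued_resolvent S mu U : Prop :=
  exists V : set R[i]^o, [/\ open V, U `|` negative_axis `<=` V &
    exists2 G : R[i]^o -> {linear M -> M}, holomorphic_on V G &
      forall z, (U `|` negative_axis) z -> is_resolvent (S z) mu (G z)].

(* Families are total functions; their values outside the domain, C \ R for
   Nevanlinna families and C \ R_+ for the Stieltjes classes, are irrelevant. *)
Definition nevanlinna S : Prop :=
  [/\ (forall z, upper_half_plane z -> maximal dissipative (S z)) /\
      (forall z, lower_half_plane z -> maximal accumulative (S z)),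
      (forall z : R[i], complex.Im z != 0 -> adjoint (S z) = S z^*%C) &
      (exists2 mu, upper_half_plane mu &
         holomorphic_resolvent S mu upper_half_plane) /\
      (exists2 mu, lower_half_plane mu &
         holomorphic_resolvent S mu lower_half_plane)].

Definition continued S : Prop :=
  (exists2 mu, upper_half_plane mu &
     continued_resolvent S mu upper_half_plane) /\
  (exists2 mu, lower_half_plane mu &
     continued_resolvent S mu lower_half_plane).

Definition stieltjes S : Prop :=
  [/\ forall z, off_Rplus z -> linear_relation (S z), nevanlinna S,
      forall x : R, x < 0 -> nonnegative (S x%:C) & continued S].

Definition inverse_stieltjes S : Prop :=
  [/\ forall z, off_Rplus z -> linear_relation (S z), nevanlinna S,
      forall x : R, x < 0 -> nonpositive (S x%:C) & continued S].

Definition inner_family S : Prop :=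
  forall y : R, y != 0 -> forall p, S (y *i) p -> complex.Re (inner p.2 p.1) = 0.

End Families.

(* Main.v *)
Require Import Defs.
From HB Require Import structures.
From mathcomp Require Import all_boot all_order all_algebra.
From mathcomp Require Import complex.
From mathcomp Require Import all_classical all_reals all_analysis.
From mathcomp Require Import ring lra.

(* Let [Q] be an inner Stieltjes family and [N z = - z Q(z)]. For [Im z > 0] the relation
   [Q z] is dissipative, it is nonnegative for [z < 0], and on the positive imaginary axis
   the inner property makes [(f', f)] purely imaginary; hence [N z] is nonnegative on both
   sides of the second quadrant. For [mu] in the open first quadrant the resolvent of
   [N z] at [- mu] is bounded on the second quadrant, since there [z] rotates the upper
   half-plane away from [- mu], and it is bounded by [1 / |mu|] on the sides. By
   Phragmen-Lindelof it is bounded by [1 / |mu|] everywhere, which forces the numerical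
   range of [N z] into the closed first quadrant. So [(N z + 1)^-1] exists, is bounded,
   and its quadratic form is real on the sides; by Phragmen-Lindelof again it is real in
   the quadrant, and a real holomorphic function is constant. Thus [Q z = - z^-1 B] with
   [B = Q(-1)] on the second quadrant, then on the upper half-plane by the identity
   theorem, and on the lower one by taking adjoints. The inverse Stieltjes case follows
   through [S |-> - S^-1].

   Holomorphy means complex differentiability at every point, without continuity of the
   derivative. Goursat's bisection argument is applied to the second difference over
   rectangles of one-variable primitives of [u] and [v]; it shows that the means of
   [u] over short horizontal segments are twice differentiable and harmonic, so that the
   second derivative test yields the maximum principle. *)

Set Implicit Arguments.
Unset Strict Implicit.
Unset Printing Implicit Defensive.

Import Order.TTheory GRing.Theory Num.Theory.
Import numFieldNormedType.Exports.

Local Open Scope classical_set_scope.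
Local Open Scope complex_scope.
Local Open Scope ring_scope.


(** * Goursat's lemma for the Cauchy-Riemann equations *)

Section RealAnalysis.
Context {R : realType}.
Implicit Types (u v P S f F : R -> R) .

(** Why [mu] is taken in the open first quadrant: as [z] runs over the second quadrant, the
    half-planes [- z C_+] turn between the upper and the right one, and the open third quadrant
    consists of the points [- mu] that keep a positive distance from all of them. The point [-1]
    lies on the edge of the half-plane reached at [z < 0], so no uniform bound is available there
    beforehand. Yet the reality argument needs [-1]: for nonreal [mu] the form of the resolvent is
    not real on the sides.

    The relations may be multivalued, and only the resolvent of [Q z] at one fixed point [mu0] is
    known to be holomorphic. Differentiability of the resolvents of [N z] is drawn from an algebraic
    identity between increments together with uniform bounds. Complex analysis is applied to scalar
    functions [(H z k, h)] only; equality of operators is recovered by polarization. On the rest of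
    the upper half-plane no resolvent of [N z] is used: the identity theorem gives an inclusion of
    [- z^-1 B] in [Q z], and maximality turns it into equality. *)

Lemma antiderivative f (a b a' b' : R) : a < a' -> b' < b ->
  (forall x, a < x < b -> {for x, continuous f}) ->
  exists F : R -> R, forall x, a' < x < b' -> is_derive x 1 F (f x).
Proof.
move=> aa' bb' cf.
exists (fun x => \int[lebesgue_measure]_(t in `[a', x]) f t) => x /andP[ax xb].
have fi : lebesgue_measure.-integrable `[a', b'] (EFin \o f).
  apply: continuous_compact_integrable; first exact: segment_compact.
  apply: continuous_in_subspaceT => t; rewrite inE/= in_itv/= => /andP[? ?].
  by apply: cf; lra.
have [|d e] := @continuous_FTC1_closed R f a' x b' xb fi ax.
  by apply: cf; lra.
by rewrite -e derive1E; exact/derivableP.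
Qed.

Lemma derive_continuous f (x l : R) : is_derive x 1 f l -> {for x, continuous f}.
Proof. by move=> h; apply/differentiable_continuous/derivable1_diffP. Qed.

Lemma mean_value f g (a b : R) : a <= b ->
  (forall x, a <= x <= b -> is_derive x 1 f (g x)) ->
  exists2 c, a <= c <= b & f b - f a = g c * (b - a).
Proof.
move=> ab df.
have [x|x|c] := @MVT_segment R f g a b ab; last by rewrite in_itv /= => ? ?; exists c.
- by rewrite in_itv/= => /andP[? ?]; apply: df; lra.
- apply: continuous_in_subspaceT => t; rewrite inE/= in_itv/= => tab.
  exact: derive_continuous (df t tab).
Qed.

Lemma nested_intervals_meet (a b : nat -> R) :
  (forall n, a n <= a n.+1) -> (forall n, b n.+1 <= b n) ->
  (forall n, a n <= b n) -> exists p, forall n, a n <= p <= b n.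
Proof.
move=> na nb ab.
have ma m n : (m <= n)%N -> a m <= a n.
  by apply: (@homo_leq _ a (fun x y => x <= y)) => // ? ? ?; exact: le_trans.
have mb m n : (m <= n)%N -> b n <= b m.
  by apply: (@homo_leq _ b (fun x y => y <= x)) => // x ? ? ? /le_trans; apply.
have abmn m n : a m <= b n.
  apply: (@le_trans _ _ (a (maxn m n))); first by apply: ma; exact: leq_maxl.
  apply: (le_trans (ab _)); apply: mb; exact: leq_maxr.
have hs : has_sup (range a).
  by split; [exists (a 0%N), 0%N|exists (b 0%N) => _ [m _ <-]].
exists (sup (range a)) => n; apply/andP; split.
  by apply: ub_le_sup; [case: hs|exists n].
by apply: ge_sup; [case: hs|move=> _ [m _ <-]].
Qed.

Lemma pow_small (q M e : R) : 0 <= q < 1 -> 0 < e -> exists n, M * q ^+ n < e.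
Proof.
move=> /andP[q0 q1] e0.
have := @cvg_geometric R M q; rewrite ger0_norm// => /(_ q1) /cvgrPdist_lt /(_ _ e0).
move=> [N _ /(_ N)] /= h; exists N.
by apply: le_lt_trans (h (leqnn N)); rewrite sub0r normrN ler_norm.
Qed.

Lemma norm_comb_le (A B w h e : R) : 0 <= w -> 0 <= h -> 0 <= e ->
  `|A| <= e / 2 * (w + h) -> `|B| <= e / 2 * (w + h) ->
  `|A * w + B * h| <= e * (w + h) ^+ 2.
Proof.
move=> w0 h0 e0 hA hB.
rewrite (le_trans (ler_normD _ _))// !normrM (ger0_norm w0) (ger0_norm h0).
have h1 : `|A| * w <= e / 2 * (w + h) * w by exact: ler_wpM2r.
have h2 : `|B| * h <= e / 2 * (w + h) * h by exact: ler_wpM2r.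
have h3 : 0 <= e / 2 * (w + h) ^+ 2 by apply: mulr_ge0; [lra|exact: sqr_ge0].
have -> : e * (w + h) ^+ 2 = e / 2 * (w + h) * w + e / 2 * (w + h) * h +
  e / 2 * (w + h) ^+ 2 by field.
lra.
Qed.

(* Cauchy-Riemann equations in Frechet form: [a + ib] is the complex derivative
   of [u + iv]. *)
Definition cauchy_riemann (u v : R -> R -> R) (x y a b : R) : Prop :=
  forall e : R, 0 < e -> exists2 d : R, 0 < d & forall x' y',
    `|x' - x| < d -> `|y' - y| < d ->
    `|u x' y' - u x y - (a * (x' - x) - b * (y' - y))|
       <= e * (`|x' - x| + `|y' - y|) /\
    `|v x' y' - v x y - (b * (x' - x) + a * (y' - y))|
       <= e * (`|x' - x| + `|y' - y|).

Definition second_diff (W : R -> R -> R) (x1 x2 y1 y2 : R) : R :=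
  W x2 y2 - W x1 y2 - W x2 y1 + W x1 y1.

Section Goursat.
Variables (u v P S : R -> R -> R) (a b c d : R).
Hypothesis CR : forall x y, a < x < b -> c < y < d ->
  exists k l, cauchy_riemann u v x y k l.
Hypothesis dP : forall x y, a < x < b -> c < y < d ->
  is_derive x 1 (P ^~ y) (u x y).
Hypothesis dS : forall x y, a < x < b -> c < y < d ->
  is_derive y 1 (S x) (v x y).

(** Since [P] and [S] are primitives of [u] in [x] and of [v] in [y], this is minus the real part of
    the contour integral of [u + iv] around the rectangle, written without integrals. *)
Let E x1 x2 y1 y2 := second_diff P x1 x2 y1 y2 + second_diff S x1 x2 y1 y2.

(** By the mean value theorem the two second differences are a vertical increment of [u] times the
    width and a horizontal increment of [v] times the height. The Cauchy-Riemann equations make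
    their linear parts [- l * h * w] and [l * w * h], which cancel. Four errors, each bounded with
    [e / 4], remain. *)
Let E_local (p q e : R) : a < p < b -> c < q < d -> 0 < e ->
  exists2 r : R, 0 < r & forall x1 x2 y1 y2 : R, a < x1 -> x2 < b -> c < y1 -> y2 < d ->
    x1 <= p <= x2 -> y1 <= q <= y2 -> x2 - x1 < r -> y2 - y1 < r ->
    `|E x1 x2 y1 y2| <= e * ((x2 - x1) + (y2 - y1)) ^+ 2.
Proof.
move=> pab qcd e0.
have [k [l /(_ (e / 4))[|r r0 H]]] := CR pab qcd; first lra.
exists r => // x1 x2 y1 y2 ax1 x2b cy1 y2d /andP[x1p px2] /andP[y1q qy2] hx hy.
have [||xi /andP[xi1 xi2] Exi] := @mean_value (fun x => P x y2 - P x y1)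
    (fun x => u x y2 - u x y1) x1 x2; first lra.
  by move=> x /andP[? ?]; apply: is_deriveB; apply: dP; lra.
have [||et /andP[et1 et2] Eet] := @mean_value (fun y => S x2 y - S x1 y)
    (fun y => v x2 y - v x1 y) y1 y2; first lra.
  by move=> y /andP[? ?]; apply: is_deriveB; apply: dS; lra.
have -> : E x1 x2 y1 y2 =
   (u xi y2 - u xi y1) * (x2 - x1) + (v x2 et - v x1 et) * (y2 - y1).
  by rewrite -Exi -Eet /E /second_diff; ring.
have C x' y' : x1 <= x' <= x2 -> y1 <= y' <= y2 ->
    `|u x' y' - u p q - (k * (x' - p) - l * (y' - q))|
       <= e / 4 * ((x2 - x1) + (y2 - y1)) /\
    `|v x' y' - v p q - (l * (x' - p) + k * (y' - q))|
       <= e / 4 * ((x2 - x1) + (y2 - y1)).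
  move=> /andP[? ?] /andP[? ?].
  have hp : `|x' - p| <= x2 - x1 by rewrite ler_norml; clear H dP dS CR; lra.
  have hq : `|y' - q| <= y2 - y1 by rewrite ler_norml; clear H dP dS CR; lra.
  have [h1 h2] := H _ _ (le_lt_trans hp hx) (le_lt_trans hq hy).
  have h3 : e / 4 * (`|x' - p| + `|y' - q|) <= e / 4 * ((x2 - x1) + (y2 - y1)).
    by rewrite ler_wpM2l ?lerD// divr_ge0// ltW.
  by split; [exact: le_trans h1 h3|exact: le_trans h2 h3].
have xx : x1 <= x2 by exact: le_trans px2.
have yy : y1 <= y2 by exact: le_trans qy2.
have xi12 : x1 <= xi <= x2 by rewrite xi1.
have et12 : y1 <= et <= y2 by rewrite et1.
have [|c1 _] := C xi y2 xi12; first by rewrite lexx yy.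
have [|c2 _] := C xi y1 xi12; first by rewrite lexx yy.
have [|_ c3] := C x2 et _ et12; first by rewrite lexx xx.
have [|_ c4] := C x1 et _ et12; first by rewrite lexx xx.
clear C.
set w := x2 - x1 in c1 c2 c3 c4 *; set h := y2 - y1 in c1 c2 c3 c4 *.
have w0 : 0 <= w by rewrite subr_ge0 (le_trans x1p).
have h0 : 0 <= h by rewrite subr_ge0 (le_trans y1q).
have -> : (u xi y2 - u xi y1) * w + (v x2 et - v x1 et) * h =
  (u xi y2 - u xi y1 + l * h) * w + (v x2 et - v x1 et - l * w) * h by ring.
apply: norm_comb_le => //; first exact: ltW.
  have -> : u xi y2 - u xi y1 + l * h =
    (u xi y2 - u p q - (k * (xi - p) - l * (y2 - q))) -
    (u xi y1 - u p q - (k * (xi - p) - l * (y1 - q))) by rewrite /h; ring.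
  by apply: (le_trans (ler_normB _ _)); clear -c1 c2; lra.
have -> : v x2 et - v x1 et - l * w =
    (v x2 et - v p q - (l * (x2 - p) + k * (et - q))) -
    (v x1 et - v p q - (l * (x1 - p) + k * (et - q))) by rewrite /w; ring.
by apply: (le_trans (ler_normB _ _)); clear -c3 c4; lra.
Qed.

Let bad (e : R) (r : (R * R) * (R * R)) := [/\ a < r.1.1, r.1.1 <= r.1.2, r.1.2 < b,
  (c < r.2.1 /\ r.2.1 <= r.2.2 /\ r.2.2 < d) &
  e * ((r.1.2 - r.1.1) + (r.2.2 - r.2.1)) ^+ 2 < `|E r.1.1 r.1.2 r.2.1 r.2.2| ].

Let halved (r r' : (R * R) * (R * R)) := [/\ r.1.1 <= r'.1.1, r'.1.2 <= r.1.2,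
   r.2.1 <= r'.2.1, r'.2.2 <= r.2.2 &
   r'.1.2 - r'.1.1 = (r.1.2 - r.1.1) / 2 /\ r'.2.2 - r'.2.1 = (r.2.2 - r.2.1) / 2 ].

(** [E] is additive over the four quarters, while halving the sides divides the threshold in [bad]
    by exactly 4; so some quarter is again bad. *)
Let bisect (e : R) r : bad e r -> exists r', bad e r' /\ halved r r'.
Proof.
case: r => [[x1 x2] [y1 y2]] [/= ax xx xb [cy [yy yd]] h].
apply: contrapT => /forallNP no.
pose xm := (x1 + x2) / 2; pose ym := (y1 + y2) / 2.
have Ele x1' x2' y1' y2' : x1 <= x1' -> x2' <= x2 -> y1 <= y1' -> y2' <= y2 ->
    x2' - x1' = (x2 - x1) / 2 -> y2' - y1' = (y2 - y1) / 2 ->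
    `|E x1' x2' y1' y2'| <= e * ((x2 - x1) + (y2 - y1)) ^+ 2 / 4.
  move=> *; rewrite leNgt; apply/negP => K.
  apply: (no ((x1', x2'), (y1', y2'))); split; split => //=; try lra.
  apply: le_lt_trans K; rewrite le_eqVlt; apply/orP; left; apply/eqP.
  rewrite (_ : x2' - x1' = (x2 - x1) / 2)// (_ : y2' - y1' = (y2 - y1) / 2)//.
  by field.
have h1 : `|E x1 xm y1 ym| <= e * ((x2 - x1) + (y2 - y1)) ^+ 2 / 4 by apply: Ele; rewrite /xm /ym; lra.
have h2 : `|E xm x2 y1 ym| <= e * ((x2 - x1) + (y2 - y1)) ^+ 2 / 4 by apply: Ele; rewrite /xm /ym; lra.
have h3 : `|E x1 xm ym y2| <= e * ((x2 - x1) + (y2 - y1)) ^+ 2 / 4 by apply: Ele; rewrite /xm /ym; lra.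
have h4 : `|E xm x2 ym y2| <= e * ((x2 - x1) + (y2 - y1)) ^+ 2 / 4 by apply: Ele; rewrite /xm /ym; lra.
have Es : E x1 x2 y1 y2 = E x1 xm y1 ym + E xm x2 y1 ym + E x1 xm ym y2 + E xm x2 ym y2.
  by rewrite /E /second_diff; ring.
move: h; rewrite Es ltNge => /negP; apply.
move: h1 h2 h3 h4; rewrite !ler_norml; lra.
Qed.

Lemma goursat (x1 x2 y1 y2 : R) : a < x1 -> x1 <= x2 -> x2 < b ->
  c < y1 -> y1 <= y2 -> y2 < d ->
  second_diff P x1 x2 y1 y2 = - second_diff S x1 x2 y1 y2.
Proof.
move=> ax xx xb cy yy yd; apply/eqP; rewrite -subr_eq0 opprK -normr_le0.
rewrite -/(E x1 x2 y1 y2) leNgt; apply/negP => E0.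
pose s := (x2 - x1) + (y2 - y1).
(* With this [e] the rectangle is bad: [e * s ^+ 2] is less than the modulus of [E]. The [+ 1] keeps
   the denominator positive when the rectangle is a point. *)
pose e := `|E x1 x2 y1 y2| / (2 * (s ^+ 2 + 1)).
have s20 : 0 <= s ^+ 2 by exact: sqr_ge0.
have e0 : 0 < e by apply: divr_gt0 => //; lra.
have bad0 : bad e ((x1, x2), (y1, y2)).
  split => //=; rewrite -/s.
  have : e * (2 * (s ^+ 2 + 1)) = `|E x1 x2 y1 y2|.
    by rewrite /e divfK//; apply/eqP; lra.
  have : 0 <= e * s ^+ 2 by apply: mulr_ge0 => //; lra.
  lra.
(* Outside bad rectangles [step] is the identity, a default never met along the sequence. *)
pose step r := if pselect (bad e r) is left br then projT1 (cid (bisect br)) else r.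
pose r n := iter n step ((x1, x2), (y1, y2)).
have badr n : bad e (r n).
  elim: n => [//|n IH]; rewrite /r iterS -/(r n) /step.
  by case: pselect => // br; case: cid => r' [].
have hr n : halved (r n) (r n.+1).
  rewrite {2}/r iterS -/(r n) /step; case: pselect => // br.
  by case: cid => r' [].
have [p pn] : exists p, forall n, (r n).1.1 <= p <= (r n).1.2.
  apply: nested_intervals_meet => n; [by case: (hr n)|by case: (hr n)|by case: (badr n)].
have [q qn] : exists q, forall n, (r n).2.1 <= q <= (r n).2.2.
  apply: nested_intervals_meet => n; [by case: (hr n)|by case: (hr n)|by case: (badr n) => _ _ _ [? []]].
have wx n : (r n).1.2 - (r n).1.1 = (x2 - x1) * 2^-1 ^+ n.
  elim: n => [|n IH]; first by rewrite expr0 mulr1.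
  by case: (hr n) => _ _ _ _ [-> _]; rewrite IH exprS; ring.
have wy n : (r n).2.2 - (r n).2.1 = (y2 - y1) * 2^-1 ^+ n.
  elim: n => [|n IH]; first by rewrite expr0 mulr1.
  by case: (hr n) => _ _ _ _ [_ ->]; rewrite IH exprS; ring.
have [t t0 Ht] : exists2 t : R, 0 < t & forall x1 x2 y1 y2 : R, a < x1 -> x2 < b -> c < y1 -> y2 < d ->
    x1 <= p <= x2 -> y1 <= q <= y2 -> x2 - x1 < t -> y2 - y1 < t ->
    `|E x1 x2 y1 y2| <= e * ((x2 - x1) + (y2 - y1)) ^+ 2.
  by apply: E_local => //; have /= := pn 0%N; have /= := qn 0%N; lra.
have [|n hn] := @pow_small 2^-1 s t _ t0; first by rewrite invr_ge0 invf_lt1 ?ltr1n ?ler0n.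
have h0 : 0 <= 2^-1 ^+ n :> R by apply: exprn_ge0; lra.
case: (badr n) => b1 b2 b3 [b4 [b5 b6]]; rewrite ltNge => /negP; apply.
have k1 : 0 <= (x2 - x1) * 2^-1 ^+ n by apply: mulr_ge0 => //; lra.
have k2 : 0 <= (y2 - y1) * 2^-1 ^+ n by apply: mulr_ge0 => //; lra.
by apply: Ht => //; rewrite ?wx ?wy; move: hn; rewrite /s mulrDl; lra.
Qed.

End Goursat.

End RealAnalysis.

(** * The maximum principle *)

Section MaximumPrinciple.
Context {R : realType}.

Lemma is_derive_epsP (f : R -> R) (x l : R) :
  is_derive x 1 f l <->
  (forall e : R, 0 < e -> exists2 d : R, 0 < d & forall y : R, `|y - x| < d ->
     `|f y - f x - l * (y - x)| <= e * `|y - x|).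
Proof.
split.
  move=> [df fl] e e0; move/cvgrPdist_le: df => /(_ _ e0).
  rewrite [lim _]fl => -[d /= d0 H]; exists d => // y yx.
  have [->|nyx] := eqVneq y x; first by rewrite !subrr mulr0 subr0 normr0 mulr0.
  have k0 : y - x != 0 by rewrite subr_eq0.
  have := H (y - x); rewrite /= sub0r normrN => /(_ yx k0).
  rewrite /GRing.scale/= mulr1 subrK -[X in _ -> _ <= X * _]mulr1.
  move=> h; have -> : f y - f x - l * (y - x) =
     - (l - (y - x)^-1 * (f y - f x)) * (y - x) by field.
  by rewrite normrM normrN mulr1; apply: ler_wpM2r.
move=> H.
suff c : (fun h : R => h^-1 *: (f (h *: (1 : R) + x) - f x)) @ 0^' --> l.
  by apply: DeriveDef; [apply/cvg_ex; exists l|exact/cvg_lim].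
apply/cvgrPdist_le => e e0; have [d d0 {}H] := H e e0.
exists d => //= h /=; rewrite sub0r normrN => hd h0.
have := H (h + x); rewrite addrK => /(_ hd).
rewrite /GRing.scale/= mulr1.
have -> : l - h^-1 * (f (h + x) - f x) = - (f (h + x) - f x - l * h) * h^-1 by field.
by rewrite normrM normrN normfV ler_pdivrMr ?normr_gt0.
Qed.

(** If [l > 0], then [f'], which vanishes at [x], is at least [l / 2 * (y - x)] just to the right of
    [x], and [f] would grow there. *)
Lemma second_derivative_at_max (f f' : R -> R) (x t l : R) : 0 < t ->
  (forall y, `|y - x| < t -> is_derive y 1 f (f' y)) ->
  (forall y, `|y - x| < t -> f y <= f x) -> is_derive x 1 f' l -> l <= 0.
Proof.
move=> t0 df fx /is_derive_epsP H; rewrite leNgt; apply/negP => l0.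
have f'x : f' x = 0.
  have xt : x - t <= x + t by lra.
  have : is_derive x 1 f 0.
    apply: (derive1_at_max xt); rewrite ?in_itv/=; last 2 first.
    - lra.
    - by move=> y; rewrite in_itv/= => ?; apply: fx; rewrite ltr_norml; lra.
    move=> y; rewrite in_itv/= => ?.
    by have [] : is_derive y 1 f (f' y) by apply: df; rewrite ltr_norml; lra.
  have : is_derive x 1 f (f' x) by apply: df; rewrite subrr normr0.
  by move=> [_ <-] [_ <-].
have [|d d0 {}H] := H (l / 2); first lra.
pose h := Num.min d t / 2.
have [hd ht h0] : [/\ h < d, h < t & 0 < h].
  have : Num.min d t <= d by rewrite ge_min lexx.
  have : Num.min d t <= t by rewrite ge_min lexx orbT.
  have : 0 < Num.min d t by rewrite lt_min d0.
  by rewrite /h => *; split; lra.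
(* The interval from [x] to [x + h] is cut in half because the intermediate point of [mean_value]
   may be [x] itself, where [f'] is zero; on the right half [f'] is strictly positive. *)
have [||c /andP[xc cxh] E] := @mean_value _ f f' (x + h / 2) (x + h); first lra.
  by move=> y ?; apply: df; rewrite ltr_norml; lra.
have [||c' /andP[xc' cxh'] E'] := @mean_value _ f f' x (x + h / 2); first lra.
  by move=> y ?; apply: df; rewrite ltr_norml; lra.
have pos y : x <= y <= x + h -> l / 2 * (y - x) <= f' y.
  move=> xy; have yx : `|y - x| = y - x by rewrite ger0_norm; lra.
  have /H : `|y - x| < d by rewrite yx; lra.
  by rewrite yx f'x subr0 ler_norml; lra.
have p1 : 0 < f' c.
  apply: lt_le_trans (pos _ _); last lra.
  by apply: mulr_gt0; lra.
have p2 : 0 <= f' c'.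
  apply: le_trans (pos _ _); last lra.
  by apply: mulr_ge0; lra.
have : f (x + h) <= f x by apply: fx; rewrite addrAC subrr add0r gtr0_norm.
have : 0 < f' c * (x + h - (x + h / 2)) by apply: mulr_gt0; lra.
have : 0 <= f' c' * (x + h / 2 - x) by apply: mulr_ge0; lra.
lra.
Qed.

Definition cont2_at (K : set (R * R)) (f : R * R -> R) (z : R * R) : Prop :=
  forall e : R, 0 < e -> exists2 d : R, 0 < d & forall w, K w ->
    `|w.1 - z.1| < d -> `|w.2 - z.2| < d -> `|f w - f z| <= e.

Lemma compact_max2 (K : set (R * R)) (f : R * R -> R) :
  compact K -> K !=set0 -> (forall z, K z -> cont2_at K f z) ->
  exists2 c, K c & forall w, K w -> f w <= f c.
Proof.
move=> cK K0 cf.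
have [|c cin H] := compact_EVT_max K0 cK (f := f).
  rewrite continuous_subspace_in => z /set_mem Kz.
  apply/cvgrPdist_le => e e0; have [d d0 H] := cf z Kz e e0.
  rewrite -nbhs_subspace_in//.
  suff : nbhs z [set w | K w -> `|f z - f w| <= e] by [].
  apply/nbhs_ballP; exists d => //= -[w1 w2] [/= b1 b2] Kw.
  by rewrite distrC; apply: H => //=; rewrite distrC.
by exists c; [exact: set_mem|move=> w Kw; apply: H; exact: mem_set].
Qed.

End MaximumPrinciple.

Section LocalMaximum.
Context {R : realType}.
Implicit Types (u v : R -> R -> R).

Lemma cauchy_riemann_cont u v (x y a b : R) : cauchy_riemann u v x y a b ->
  forall e : R, 0 < e -> exists2 d : R, 0 < d & forall x' y',
    `|x' - x| < d -> `|y' - y| < d ->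
    `|u x' y' - u x y| <= e /\ `|v x' y' - v x y| <= e.
Proof.
move=> H e e0; have [d d0 {}H] := H 1 ltr01.
pose K := `|a| + `|b| + 1.
have K0 : 0 < K by rewrite /K ltr_wpDl// addr_ge0.
have e'0 : 0 < e / (2 * K) by rewrite divr_gt0// mulr_gt0.
exists (Num.min d (e / (2 * K))) => [|x' y']; first by rewrite lt_min d0.
rewrite !lt_min => /andP[xd xe] /andP[yd ye]; have [h1 h2] := H _ _ xd yd.
have h3 : K * (`|x' - x| + `|y' - y|) <= e.
  have -> : e = K * (e / (2 * K) + e / (2 * K)) by field; rewrite gt_eqF.
  by rewrite ler_pM2l// lerD// ltW.
have aux (s t : R) : `|s| <= `|a| \/ `|s| <= `|b| -> `|t| <= `|a| \/ `|t| <= `|b| ->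
    `|s * (x' - x) + t * (y' - y)| <= (`|a| + `|b|) * (`|x' - x| + `|y' - y|).
  move=> hs ht; apply: (le_trans (ler_normD _ _)); rewrite !normrM mulrDr.
  by apply: lerD; apply: ler_wpM2r => //; [case: hs|case: ht] => /le_trans; apply;
    rewrite ?lerDl ?lerDr.
split.
  have -> : u x' y' - u x y = (u x' y' - u x y - (a * (x' - x) - b * (y' - y)))
     + (a * (x' - x) + (- b) * (y' - y)) by ring.
  apply: le_trans h3; apply: (le_trans (ler_normD _ _)).
  have := aux a (- b); rewrite normrN => /(_ (or_introl (lexx _)) (or_intror (lexx _))).
  by move: h1; rewrite /K; clear; lra.
have -> : v x' y' - v x y = (v x' y' - v x y - (b * (x' - x) + a * (y' - y)))
   + (b * (x' - x) + a * (y' - y)) by ring.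
apply: le_trans h3; apply: (le_trans (ler_normD _ _)).
have := aux b a (or_intror (lexx _)) (or_introl (lexx _)).
by move: h2; rewrite /K; clear; lra.
Qed.

Lemma cauchy_riemann_partial u v (x y a b : R) : cauchy_riemann u v x y a b ->
  [/\ is_derive x 1 (u ^~ y) a, is_derive x 1 (v ^~ y) b,
      is_derive y 1 (u x) (- b) & is_derive y 1 (v x) a].
Proof.
move=> H; split; apply/is_derive_epsP => e e0; have [d d0 {}H] := H e e0;
  have zd (z : R) : `|z - z| < d by rewrite subrr normr0.
all: exists d => // t td.
- by have [] := H t y td (zd y); rewrite subrr normr0 mulr0 subr0 addr0.
- by have [] := H t y td (zd y); rewrite subrr normr0 !mulr0 !addr0.
- by have [] := H x t (zd x) td; rewrite subrr normr0 mulr0 sub0r add0r mulNr.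
- by have [] := H x t (zd x) td; rewrite subrr normr0 !mulr0 !add0r.
Qed.

Lemma is_derive1_translate (f : R -> R) (x h l : R) :
  is_derive (x + h) 1 f l -> is_derive x 1 (fun t => f (t + h)) l.
Proof.
move=> /is_derive_epsP H; apply/is_derive_epsP => e e0.
have [d d0 {}H] := H e e0; exists d => // y yd.
have E : y + h - (x + h) = y - x by ring.
by have := H (y + h); rewrite E; apply.
Qed.

Lemma is_derive_sqr (x p : R) : is_derive x 1 (fun t : R => (t - p) ^+ 2) (2 * (x - p)).
Proof.
apply/is_derive_epsP => e e0; exists e => // y ye.
have -> : (y - p) ^+ 2 - (x - p) ^+ 2 - 2 * (x - p) * (y - x) = (y - x) * (y - x) by ring.
by rewrite normrM ler_wpM2r// ltW.
Qed.

Lemma is_derive_affine (x p c : R) : is_derive x 1 (fun t : R => c * (t - p)) c.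
Proof.
apply/is_derive_epsP => e e0; exists e => // y ye.
have -> : c * (y - p) - c * (x - p) - c * (y - x) = 0 by ring.
by rewrite normr0 mulr_ge0// ltW.
Qed.

Lemma is_derive_addZ (f g : R -> R) (x k df dg : R) :
  is_derive x 1 f df -> is_derive x 1 g dg ->
  is_derive x 1 (fun t => f t + k * g t) (df + k * dg).
Proof.
by move=> hf hg; apply: (is_deriveD (f := f) (g := k \*: g)).
Qed.

Lemma is_derive_Zsub (f g : R -> R) (x k df dg : R) :
  is_derive x 1 f df -> is_derive x 1 g dg ->
  is_derive x 1 (fun t => k * (f t - g t)) (k * (df - dg)).
Proof.
by move=> hf hg; apply: (is_deriveZ (f := f - g)).
Qed.

Lemma mean_value_le (f g : R -> R) (a b L : R) :
  (forall t, a <= t <= b \/ b <= t <= a -> is_derive t 1 f (g t) /\ `|g t| <= L) ->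
  `|f b - f a| <= L * `|b - a|.
Proof.
move=> H; case: (leP a b) => [ab|/ltW ab].
  have [t tab|c cab ->] := mean_value ab (f := f) (g := g).
    by have [] := H t (or_introl tab).
  by rewrite normrM ler_wpM2r//; have [] := H c (or_introl cab).
have [t tab|c cab E] := mean_value ab (f := f) (g := g).
  by have [] := H t (or_intror tab).
rewrite distrC E normrM distrC ler_wpM2r//.
by have [] := H c (or_intror cab).
Qed.

Lemma cont2_lipschitz (K : set (R * R)) (f : R * R -> R) (z : R * R) (L : R) : 0 <= L ->
  (forall w, K w -> `|f w - f z| <= L * (`|w.1 - z.1| + `|w.2 - z.2|)) ->
  cont2_at K f z.
Proof.
move=> L0 H e e0; exists (e / (2 * (L + 1))); first by rewrite divr_gt0//; lra.
move=> w Kw h1 h2; apply: (le_trans (H w Kw)).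
have h3 : `|w.1 - z.1| + `|w.2 - z.2| <= e / (L + 1).
  have -> : e / (L + 1) = e / (2 * (L + 1)) + e / (2 * (L + 1)).
    by field; apply/eqP; lra.
  by rewrite lerD// ltW.
apply: (@le_trans _ _ (L * (e / (L + 1)))); first exact: ler_wpM2l.
have h4 : 0 <= e / (L + 1) by rewrite divr_ge0//; lra.
have : (L + 1) * (e / (L + 1)) = e by field; apply/eqP; lra.
lra.
Qed.

End LocalMaximum.

Section NoLocalMaximum.
Context {R : realType}.
Implicit Types (u v : R -> R -> R).

(** Each horizontal line gets its own primitive with an arbitrary constant, so [P] has no regularity
    in [y]. Only its differences in [x] are meaningful, and the last clause, an instance of
    [goursat], controls how they vary with [y]. *)
Lemma horizontal_vertical_primitives u v (p q r0 r : R) :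
 (forall x y, `|x - p| < r0 -> `|y - q| < r0 ->
    exists a b, cauchy_riemann u v x y a b) ->
 0 < r <= r0 -> exists P S : R -> R -> R,
 let I x := p - r / 2 < x < p + r / 2 in let J y := q - r / 2 < y < q + r / 2 in
 [/\ forall x y, I x -> J y -> is_derive x 1 (P ^~ y) (u x y),
   forall x y, I x -> J y -> is_derive y 1 (S x) (v x y) &
   forall x1 x2 y1 y2, I x1 -> I x2 -> J y1 -> J y2 -> x1 <= x2 ->
     (P x2 y2 - P x1 y2) - (P x2 y1 - P x1 y1) =
     - ((S x2 y2 - S x1 y2) - (S x2 y1 - S x1 y1))].
Proof.
move=> CR /andP[r1 r2].
have near x y : p - r < x < p + r -> q - r < y < q + r ->
    exists a b, cauchy_riemann u v x y a b.
  by move=> ? ?; apply: CR; rewrite ltr_norml; lra.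
have [P dP] : {P : R -> R -> R & forall y, q - r < y < q + r ->
    forall x, p - r / 2 < x < p + r / 2 -> is_derive x 1 (P y) (u x y)}.
  apply: (boolp.choice (P := fun y F => q - r < y < q + r -> forall x,
     p - r / 2 < x < p + r / 2 -> is_derive x 1 F (u x y))) => y.
  have [yq|] := pselect (q - r < y < q + r); last by exists id.
  have [||x xp|F dF] := @antiderivative R (u ^~ y) (p - r) (p + r) (p - r / 2) (p + r / 2).
  - lra.
  - lra.
  - have [a [b /cauchy_riemann_partial[h _ _ _]]] := near x y xp yq.
    exact: derive_continuous h.
  - by exists F.
have [S dS] : {S : R -> R -> R & forall x, p - r < x < p + r ->
    forall y, q - r / 2 < y < q + r / 2 -> is_derive y 1 (S x) (v x y)}.
  apply: (boolp.choice (P := fun x F => p - r < x < p + r -> forall y,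
     q - r / 2 < y < q + r / 2 -> is_derive y 1 F (v x y))) => x.
  have [xp|] := pselect (p - r < x < p + r); last by exists id.
  have [||y yq|F dF] := @antiderivative R (v x) (q - r) (q + r) (q - r / 2) (q + r / 2).
  - lra.
  - lra.
  - have [a [b /cauchy_riemann_partial[_ _ _ h]]] := near x y xp yq.
    exact: derive_continuous h.
  - by exists F.
have dP' x y : p - r / 2 < x < p + r / 2 -> q - r / 2 < y < q + r / 2 ->
  is_derive x 1 (P y) (u x y) by move=> ? ?; apply: dP; lra.
have dS' x y : p - r / 2 < x < p + r / 2 -> q - r / 2 < y < q + r / 2 ->
  is_derive y 1 (S x) (v x y) by move=> ? ?; apply: dS; lra.
exists (fun x y => P y x), S => I J; split=> // x1 x2 y1 y2.
wlog yy : y1 y2 / y1 <= y2 => [W|].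
  case: (leP y1 y2) => [yy|/ltW yy] Ix1 Ix2 Jy1 Jy2 xx; first exact: W.
  by have := W y2 y1 yy Ix1 Ix2 Jy2 Jy1 xx; lra.
move=> /andP[Ix1 _] /andP[_ Ix2] /andP[Jy1 _] /andP[_ Jy2] xx.
have CR' x y : p - r / 2 < x < p + r / 2 -> q - r / 2 < y < q + r / 2 ->
  exists a b, cauchy_riemann u v x y a b by move=> ? ?; apply: near; lra.
have := goursat CR' dP' dS' Ix1 xx Ix2 Jy1 yy Jy2.
by rewrite /second_diff; lra.
Qed.

(** The term [e * x ^+ 2] has Laplacian [2 * e], which would exclude a local maximum if [u] were
    twice differentiable. As only first derivatives are at hand, the second derivative test is
    applied to a mean of [u], perturbed so that its maximum over a box is attained inside. *)
Lemma no_local_maximum u v (p q r0 e : R) : 0 < r0 -> 0 < e ->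
  (forall x y, `|x - p| < r0 -> `|y - q| < r0 ->
    exists a b, cauchy_riemann u v x y a b) ->
  (forall x y, `|x - p| < r0 -> `|y - q| < r0 ->
    u x y + e * x ^+ 2 <= u p q + e * p ^+ 2) -> False.
Proof.
move=> r00 e0 CR umax.
have [r rr bnd] : exists2 r, 0 < r <= r0 & forall x y, `|x - p| < r ->
    `|y - q| < r -> `|u x y - u p q| <= 1 /\ `|v x y - v p q| <= 1.
  have [||a [b H]] := CR p q; rewrite ?subrr ?normr0//.
  have [d d0 {}H] := cauchy_riemann_cont H ltr01.
  exists (Num.min d r0); first by rewrite lt_min d0 r00 ge_min lexx orbT.
  by move=> x y; rewrite !lt_min => /andP[? _] /andP[? _]; exact: H.
have [P [S [/= dP dS PS]]] := horizontal_vertical_primitives CR rr.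
have /andP[rpos _] := rr.
pose d := r / 4; have d0 : 0 < d by rewrite divr_gt0.
have [||a0 [b0 cr0]] := CR p q; rewrite ?subrr ?normr0//.
have ed0 : 0 < e * d ^+ 2 / 16 by rewrite divr_gt0// mulr_gt0// exprn_gt0.
have [d1 d10 near_pq] := cauchy_riemann_cont cr0 ed0.
(* Chosen so that [h < k] lets [e * x ^+ 2] vary by at most [e * d ^+ 2 / 16] along a segment of
   length [h]; [d1] does the same for [u] near [(p, q)]. *)
pose k := d ^+ 2 / (16 * (2 * `|p| + r + 1)).
have p0 : 0 <= `|p| by [].
have k0 : 0 < k by rewrite divr_gt0 ?exprn_gt0// mulr_gt0//; clear -p0 rpos; lra.
pose h := Num.min d (Num.min d1 k) / 2.
have [h0 hd hd1 hk] : [/\ 0 < h, h < d, h < d1 & h < k].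
  have : 0 < Num.min d (Num.min d1 k) by rewrite !lt_min d0 d10.
  have : Num.min d (Num.min d1 k) <= d by rewrite !ge_min lexx.
  have : Num.min d (Num.min d1 k) <= d1 by rewrite !ge_min lexx orbT.
  have : Num.min d (Num.min d1 k) <= k by rewrite !ge_min lexx !orbT.
  by rewrite /h; clear; move=> *; split; lra.
have rd : r / 2 = 2 * d by rewrite /d; field.
rewrite rd in dP dS PS.
pose I (x : R) := p - d <= x <= p + d; pose J (y : R) := q - d <= y <= q + d.
have II x : I x -> p - 2 * d < x < p + 2 * d by rewrite /I; clear -d0; lra.
have IIh x : I x -> p - 2 * d < x + h < p + 2 * d by rewrite /I; clear -d0 h0 hd; lra.
have JJ y : J y -> q - 2 * d < y < q + 2 * d by rewrite /J; clear -d0; lra.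
have Ip : I p by rewrite /I; clear -d0; lra.
have Jq : J q by rewrite /J; clear -d0; lra.
(* [U x y] is the mean of [u] over the segment from [(x, y)] to [(x + h, y)]; [UT]
   expresses its variation in [y] through [v], so that [U] is harmonic. *)
pose U x y := h^-1 * (P (x + h) y - P x y).
pose T x y := h^-1 * (S (x + h) y - S x y).
(* The penalty spends [e] of the Laplacian [2 * e] to drive the maximum into the disc of radius [d]:
   at [(p, q)] the value is at least [M - e * d ^+ 2 / 16], outside the disc at most
   [M - e * d ^+ 2 / 8]. *)
pose V x y := U x y + e * x ^+ 2 - e / 4 * ((x - p) ^+ 2 + (y - q) ^+ 2).
have xxh (x : R) : x <= x + h by rewrite lerDl ltW.
have UT x y y' : I x -> J y -> J y' -> U x y' - U x y = - (T x y' - T x y).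
  move=> Ix Jy Jy'; rewrite /U /T -!mulrBr -mulrN.
  by rewrite PS//; auto.
have Uu x y : I x -> J y -> exists2 xi, x <= xi <= x + h & U x y = u xi y.
  move=> Ix Jy; have [t xt|xi xxi E] := mean_value (f := P ^~ y) (g := u ^~ y) (xxh x).
    by apply: dP; [move: (II _ Ix) (IIh _ Ix) xt; clear; lra|exact: JJ].
  exists xi => //; rewrite /U E addrAC subrr add0r; field.
  by rewrite gt_eqF.
pose M := u p q + e * p ^+ 2.
have uM x y : p - 2 * d < x < p + 2 * d -> q - 2 * d < y < q + 2 * d ->
    u x y + e * x ^+ 2 <= M.
  move: rr rd; clear - umax => /andP[? ?] ? ? ?.
  by apply: umax; rewrite ltr_norml; lra.
have Vpq : M - e * d ^+ 2 / 16 <= V p q.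
  have [xi /andP[xi1 xi2] E] := Uu p q Ip Jq.
  rewrite /V E !subrr expr0n /= addr0 mulr0 subr0 /M.
  have [||h1 _] := near_pq xi q; rewrite ?subrr ?normr0//.
    by rewrite ltr_norml; move: xi1 xi2 hd1 h0; clear; lra.
  by move: h1; rewrite ler_norml; clear; lra.
have Vbd x y : I x -> J y -> d ^+ 2 <= (x - p) ^+ 2 + (y - q) ^+ 2 ->
    V x y <= M - e * d ^+ 2 / 8.
  move=> Ix Jy xy; have [xi xi12 E] := Uu x y Ix Jy.
  have h1 : u xi y + e * xi ^+ 2 <= M.
    by apply: uM; [move: (II _ Ix) (IIh _ Ix) xi12; clear; lra|exact: JJ].
  have h2 : e / 4 * d ^+ 2 <= e / 4 * ((x - p) ^+ 2 + (y - q) ^+ 2).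
    by rewrite ler_wpM2l// divr_ge0// ltW.
  have h3 : e * ((x - xi) * (x + xi)) <= e * d ^+ 2 / 16.
    rewrite -mulrA ler_pM2l//; apply: (le_trans (ler_norm _)); rewrite normrM.
    have a1 : `|x - xi| <= h by rewrite ler_norml; move: xi12; clear; lra.
    have a2 : `|x + xi| <= 2 * `|p| + r.
      rewrite (_ : x + xi = (x - p) + (xi - p) + 2 * p); last by ring.
      apply: (le_trans (ler_normD _ _)); rewrite normrM (ger0_norm (_ : 0 <= 2))//.
      rewrite addrC lerD2l; apply: (le_trans (ler_normD _ _)).
      have a3 : `|x - p| <= 2 * d by rewrite ler_norml; move: (II _ Ix); clear; lra.
      have a4 : `|xi - p| <= 2 * d.
        by rewrite ler_norml; move: (II _ Ix) (IIh _ Ix) xi12; clear; lra.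
      by move: a3 a4 rd; clear; lra.
    apply: (@le_trans _ _ (k * (2 * `|p| + r))).
      apply: ler_pM => //; exact: le_trans a1 (ltW hk).
    have : k * (2 * `|p| + r + 1) = d ^+ 2 / 16.
      by rewrite /k; field; apply/eqP; move: p0 rpos; clear; lra.
    by move: k0; clear; lra.
  by move: ed0 h1 h2 h3; rewrite /V E; clear; lra.
(* The variation in [y] is bounded through [T], as nothing direct is known of [P] in that direction.
   Near [(p, q)] both [u] and [v] oscillate by at most 2, whence the slope [2 / h]. *)
have UL x y x' y' : I x -> J y -> I x' -> J y' ->
    `|U x' y' - U x y| <= 2 / h * (`|x' - x| + `|y' - y|).
  move=> Ix Jy Ix' Jy'.
  have bd (w : R -> R -> R) a b a' b' : (forall x y, `|x - p| < r -> `|y - q| < r ->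
      `|w x y - w p q| <= 1) -> p - 2 * d < a < p + 2 * d -> q - 2 * d < b < q + 2 * d ->
      p - 2 * d < a' < p + 2 * d -> q - 2 * d < b' < q + 2 * d ->
      `|w a b - w a' b'| <= 2.
    move=> H ha hb ha' hb'.
    have := H a b; have := H a' b'; rewrite !ltr_norml.
    move=> /(_ _ _)/le_trans - h1 /(_ _ _)/le_trans - h2.
    rewrite (_ : w a b - w a' b' = (w a b - w p q) - (w a' b' - w p q)); last by ring.
    apply: (le_trans (ler_normB _ _)); rewrite (_ : 2 = 1 + 1 :> R)// lerD//.
      by apply: h2; [move: ha rd rpos|move: hb rd rpos|]; clear; lra.
    by apply: h1; [move: ha' rd rpos|move: hb' rd rpos|]; clear; lra.
  have ih (s : R) : `|s| <= 2 -> `|h^-1 * s| <= 2 / h.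
    by move=> hs; rewrite normrM (gtr0_norm (_ : 0 < h^-1)) ?invr_gt0// mulrC ler_pM2r ?invr_gt0.
  rewrite (_ : U x' y' - U x y = (U x' y' - U x y') + (U x y' - U x y)); last by ring.
  rewrite mulrDr; apply: (le_trans (ler_normD _ _)); apply: lerD.
    apply: (@mean_value_le _ (U ^~ y') (fun t => h^-1 * (u (t + h) y' - u t y'))).
    move=> t ht; have It : I t by move: ht Ix Ix'; rewrite /I; clear; lra.
    split; first by apply: (@is_derive_Zsub _ (fun t => P (t + h) y') (P ^~ y')); [apply: (@is_derive1_translate _ (P ^~ y') t h (u (t + h) y'))|]; apply: dP; auto.
    by apply: ih; apply: bd; auto => a b ha hb; case: (bnd a b ha hb).
  rewrite UT// normrN.
  apply: (@mean_value_le _ (T x) (fun t => h^-1 * (v (x + h) t - v x t))).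
  move=> t ht; have Jt : J t by move: ht Jy Jy'; rewrite /J; clear; lra.
  split; first by apply: (@is_derive_Zsub _ (S (x + h)) (S x)); apply: dS; auto.
  by apply: ih; apply: bd; auto => a b ha hb; case: (bnd a b ha hb).
have VL (z w : R * R) : I z.1 -> J z.2 -> I w.1 -> J w.2 ->
    `|V w.1 w.2 - V z.1 z.2| <=
      (2 / h + e * (2 * `|p| + 3 * d)) * (`|w.1 - z.1| + `|w.2 - z.2|).
  case: z w => [a b] [a' b'] /= Ia Jb Ia' Jb'; rewrite mulrDl.
  rewrite (_ : V a' b' - V a b = (U a' b' - U a b) + e * ((a' - a) * (a' + a)
     - ((a' - a) * (a' + a - 2 * p) + (b' - b) * (b' + b - 2 * q)) / 4)); last first.
    by rewrite /V; field.
  apply: (le_trans (ler_normD _ _)); apply: lerD; first exact: UL.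
  rewrite normrM (gtr0_norm e0) -mulrA ler_pM2l//.
  have a1 : `|a' + a| <= 2 * `|p| + 2 * d.
    rewrite (_ : a' + a = 2 * p + ((a' - p) + (a - p))); last by ring.
    apply: (le_trans (ler_normD _ _)); rewrite normrM (ger0_norm (_ : 0 <= 2))//.
    by rewrite lerD2l ler_norml; move: Ia Ia'; rewrite /I; clear; lra.
  have a2 : `|a' + a - 2 * p| <= 2 * d.
    by rewrite ler_norml; move: Ia Ia'; rewrite /I; clear; lra.
  have b2 : `|b' + b - 2 * q| <= 2 * d.
    by rewrite ler_norml; move: Jb Jb'; rewrite /J; clear; lra.
  apply: (le_trans (ler_normB _ _)); rewrite normrM.
  have c1 : `|a' - a| * `|a' + a| <= `|a' - a| * (2 * `|p| + 2 * d) by exact: ler_wpM2l.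
  have c2 : `|((a' - a) * (a' + a - 2 * p) + (b' - b) * (b' + b - 2 * q)) / 4| <=
    (`|a' - a| * (2 * d) + `|b' - b| * (2 * d)) / 4.
    rewrite normrM (gtr0_norm (_ : 0 < 4^-1))// ler_pM2r//.
    by apply: (le_trans (ler_normD _ _)); rewrite !normrM lerD// ler_wpM2l.
  have c3 : 0 <= `|a' - a| * d by rewrite mulr_ge0// ltW.
  have c4 : 0 <= `|b' - b| * d by rewrite mulr_ge0// ltW.
  have c5 : 0 <= `|b' - b| * `|p| by rewrite mulr_ge0.
  by move: c1 c2 c3 c4 c5; clear; lra.
pose K : set (R * R) := `[p - d, p + d] `*` `[q - d, q + d].
have KIJ z : K z <-> I z.1 /\ J z.2 by rewrite /K /I /J /= !in_itv.
have [||z Kz|[x y] /KIJ[/= Ix Jy] mx] := compact_max2 (K := K) (f := fun z => V z.1 z.2).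
- by apply: compact_setX; exact: segment_compact.
- by exists (p, q); apply/KIJ.
- have /KIJ[Iz Jz] := Kz.
  apply: (@cont2_lipschitz _ _ _ _ (2 / h + e * (2 * `|p| + 3 * d))) => [|w /KIJ[Iw Jw]].
    apply: addr_ge0; first by rewrite divr_ge0// ltW.
    by rewrite mulr_ge0 ?(ltW e0)//; move: p0 d0; clear; lra.
  exact: VL.
have {}mx x' y' : I x' -> J y' -> V x' y' <= V x y.
  by move=> Ix' Jy'; apply: (mx (x', y')); apply/KIJ.
have xy : (x - p) ^+ 2 + (y - q) ^+ 2 < d ^+ 2.
  rewrite ltNge; apply/negP => /(Vbd _ _ Ix Jy) h1.
  have h2 := mx _ _ Ip Jq; have h3 : 0 < e * d ^+ 2 by rewrite mulr_gt0// exprn_gt0.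
  by move: Vpq h1 h2 h3; clear; lra.
have dsq : 0 < d ^+ 2 - ((x - p) ^+ 2 + (y - q) ^+ 2) by rewrite subr_gt0.
have xd : `|x - p| < d.
  rewrite -(ltr_pXn2r (n := 2))// ?nnegrE ?(ltW d0)// -normrX ger0_norm ?sqr_ge0//.
  by move: dsq (sqr_ge0 (y - q)); clear; lra.
have yd : `|y - q| < d.
  rewrite -(ltr_pXn2r (n := 2))// ?nnegrE ?(ltW d0)// -normrX ger0_norm ?sqr_ge0//.
  by move: dsq (sqr_ge0 (x - p)); clear; lra.
have [||a [b /cauchy_riemann_partial[ux vx uy vy]]] := CR x y.
- by move: rr rd xd; rewrite !ltr_norml; clear -d0; lra.
- by move: rr rd yd; rewrite !ltr_norml; clear -d0; lra.
have [||a' [b' /cauchy_riemann_partial[ux' vx' uy' vy']]] := CR (x + h) y.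
- by move: rr rd xd; rewrite !ltr_norml; clear -d0 h0 hd; lra.
- by move: rr rd yd; rewrite !ltr_norml; clear -d0; lra.
have nearI t : `|t - x| < d - `|x - p| -> I t.
  move=> h1; have : `|t - p| < d.
    rewrite (_ : t - p = (t - x) + (x - p)); last by ring.
    by apply: (le_lt_trans (ler_normD _ _)); move: h1; clear; lra.
  by rewrite ltr_norml /I; clear; lra.
have nearJ t : `|t - y| < d - `|y - q| -> J t.
  move=> h1; have : `|t - q| < d.
    rewrite (_ : t - q = (t - y) + (y - q)); last by ring.
    by apply: (le_lt_trans (ler_normD _ _)); move: h1; clear; lra.
  by rewrite ltr_norml /J; clear; lra.
have Vxx : h^-1 * (a' - a) + e * 2 + - (e / 4) * 2 <= 0.
  apply: (@second_derivative_at_max _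
    (fun t => U t y + e * (t - 0) ^+ 2 + - (e / 4) * (t - p) ^+ 2)
    (fun t => h^-1 * (u (t + h) y - u t y) + e * (2 * (t - 0)) + - (e / 4) * (2 * (t - p)))
    x (d - `|x - p|)).
  - by rewrite subr_gt0.
  - move=> t /nearI It; do 2 (apply: is_derive_addZ; last exact: is_derive_sqr).
    by apply: (@is_derive_Zsub _ (fun t => P (t + h) y) (P ^~ y)); [apply: (@is_derive1_translate _ (P ^~ y) t h (u (t + h) y))|]; apply: dP; auto.
  - move=> t /nearI It; have := mx t y It Jy.
    by rewrite /V !subr0; clear; lra.
  - do 2 (apply: is_derive_addZ; last exact: is_derive_affine).
    apply: (@is_derive_Zsub _ (fun t => u (t + h) y) (u ^~ y)) => //; apply: (@is_derive1_translate _ (u ^~ y) x h a').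
have Vyy : - h^-1 * (a' - a) + - (e / 4) * 2 <= 0.
  apply: (@second_derivative_at_max _
    (fun t => - h^-1 * (S (x + h) t - S x t) + - (e / 4) * (t - q) ^+ 2)
    (fun t => - h^-1 * (v (x + h) t - v x t) + - (e / 4) * (2 * (t - q)))
    y (d - `|y - q|)).
  - by rewrite subr_gt0.
  - move=> t /nearJ Jt; apply: is_derive_addZ; last exact: is_derive_sqr.
    by apply: (@is_derive_Zsub _ (S (x + h)) (S x)); apply: dS; auto.
  - move=> t /nearJ Jt; have := mx x t Ix Jt; have := UT x y t Ix Jy Jt.
    by rewrite /V /T; clear; lra.
  - apply: is_derive_addZ; last exact: is_derive_affine.
(* The difference quotients [h^-1 * (a' - a)] cancel in the sum, because the derivative of [u] in
   [x] equals that of [v] in [y]; what remains is [e <= 0]. *)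
by move: Vxx Vyy; clear -e0; lra.
Qed.

End NoLocalMaximum.

(** * Complex derivatives *)

Notation cabs := Normc.normc.
Arguments Normc.normc : simpl never.

Section ComplexModulus.
Context {R : realType}.
Implicit Types (z w : R[i]).

Lemma normE z : `|z| = (cabs z)%:C. Proof. by []. Qed.

Lemma cabs_ge0 z : 0 <= cabs z.
Proof. rewrite -lecR -normE; exact: normr_ge0. Qed.

Lemma cabs0 : cabs (0 : R[i]) = 0.
Proof. by apply: complexI; rewrite -normE normr0. Qed.

Lemma cabs_eq0 z : (cabs z == 0) = (z == 0).
Proof. by rewrite -(inj_eq (@complexI R)) -normE normr_eq0. Qed.

Lemma cabs_gt0 z : (0 < cabs z) = (z != 0).
Proof. by rewrite lt_def cabs_ge0 andbT cabs_eq0. Qed.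

Lemma cabsM z w : cabs (z * w) = cabs z * cabs w.
Proof. by apply: complexI; rewrite rmorphM/= -!normE normrM. Qed.

Lemma cabsN z : cabs (- z) = cabs z.
Proof. by apply: complexI; rewrite -!normE normrN. Qed.

Lemma cabsV z : cabs z^-1 = (cabs z)^-1.
Proof. by apply: complexI; rewrite fmorphV/= -!normE normfV. Qed.

Lemma cabsX z n : cabs (z ^+ n) = cabs z ^+ n.
Proof. by apply: complexI; rewrite rmorphXn/= -!normE normrX. Qed.

Lemma cabs_conj z : cabs z^*%C = cabs z.
Proof. by apply: complexI; rewrite -!normE normcJ. Qed.

Lemma cabs_real (x : R) : cabs x%:C = `|x|.
Proof. by rewrite /Normc.normc /= expr0n addr0 sqrtr_sqr. Qed.

Lemma cabsD z w : cabs (z + w) <= cabs z + cabs w.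
Proof. by rewrite -lecR rmorphD/= -!normE ler_normD. Qed.

Lemma cabsB z w : cabs (z - w) <= cabs z + cabs w.
Proof. by rewrite -(cabsN w) cabsD. Qed.

Lemma cabs_distC z w : cabs (z - w) = cabs (w - z).
Proof. by rewrite -cabsN opprB. Qed.

Lemma sqr_cabs z : cabs z ^+ 2 = complex.Re z ^+ 2 + complex.Im z ^+ 2.
Proof. by case: z => x y; rewrite /Normc.normc/= sqr_sqrtr// addr_ge0// sqr_ge0. Qed.

Lemma le_cabs (a : R) z : 0 <= a -> (a <= cabs z) = (a ^+ 2 <= complex.Re z ^+ 2 + complex.Im z ^+ 2).
Proof. by move=> a0; rewrite -sqr_cabs ler_pXn2r// nnegrE ?cabs_ge0. Qed.

Lemma cabs_le (a : R) z : 0 <= a -> (cabs z <= a) = (complex.Re z ^+ 2 + complex.Im z ^+ 2 <= a ^+ 2).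
Proof. by move=> a0; rewrite -sqr_cabs ler_pXn2r// nnegrE ?cabs_ge0. Qed.

Lemma normRe_le_cabs z : `|complex.Re z| <= cabs z.
Proof. by rewrite le_cabs// real_normK ?num_real// lerDl sqr_ge0. Qed.

Lemma normIm_le_cabs z : `|complex.Im z| <= cabs z.
Proof. by rewrite le_cabs// real_normK ?num_real// lerDr sqr_ge0. Qed.

Lemma Re_le_cabs z : complex.Re z <= cabs z.
Proof. exact: le_trans (ler_norm _) (normRe_le_cabs z). Qed.

Lemma cabs_le_ReIm z : cabs z <= `|complex.Re z| + `|complex.Im z|.
Proof.
rewrite cabs_le ?addr_ge0// sqrrD !real_normK ?num_real//.
by rewrite lerD2r lerDl mulrn_wge0// mulr_ge0.
Qed.

Lemma ReM z w : complex.Re (z * w) =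
  complex.Re z * complex.Re w - complex.Im z * complex.Im w.
Proof. by case: z; case: w. Qed.

Lemma ImM z w : complex.Im (z * w) =
  complex.Re z * complex.Im w + complex.Im z * complex.Re w.
Proof. by case: z; case: w. Qed.

Lemma ReV z : complex.Re z^-1 = complex.Re z / cabs z ^+ 2.
Proof. by rewrite sqr_cabs; case: z. Qed.

Lemma ImV z : complex.Im z^-1 = - (complex.Im z / cabs z ^+ 2).
Proof. by rewrite sqr_cabs; case: z. Qed.

Lemma ReD z w : complex.Re (z + w) = complex.Re z + complex.Re w.
Proof. by case: z; case: w. Qed.
Lemma ImD z w : complex.Im (z + w) = complex.Im z + complex.Im w.
Proof. by case: z; case: w. Qed.
Lemma ReN z : complex.Re (- z) = - complex.Re z.
Proof. by case: z. Qed.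
Lemma ImN z : complex.Im (- z) = - complex.Im z.
Proof. by case: z. Qed.

Definition ReImE := (ReD, ImD, ReN, ImN, ReM, ImM).

Lemma complex_ext z w : complex.Re z = complex.Re w -> complex.Im z = complex.Im w -> z = w.
Proof. by case: z w => [a b] [c d] /= -> ->. Qed.

Lemma conjcM z w : (z * w)^*%C = z^*%C * w^*%C.
Proof. exact: rmorphM. Qed.

Lemma conjcN z : (- z)^*%C = - z^*%C.
Proof. exact: rmorphN. Qed.

Lemma mulr_conj z : z * z^*%C = (cabs z ^+ 2)%:C.
Proof. by rewrite -sqr_normc normE rmorphXn. Qed.

End ComplexModulus.

Section ComplexDerivative.
Context {R : realType}.
Implicit Types (D : set R[i]) (f g : R[i] -> R[i]) (z w l : R[i]).

(* Complex differentiability within [D]; at interior points of [D] this is the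
   usual notion, at boundary points it yields continuity within [D]. *)
Definition cderiv D f z l : Prop :=
  forall e : R, 0 < e -> exists2 d : R, 0 < d & forall w, D w -> cabs (w - z) < d ->
    cabs (f w - f z - l * (w - z)) <= e * cabs (w - z).

Definition cdifferentiable D f : Prop := forall z, D z -> exists l, cderiv D f z l.

Lemma cderiv_sub D D' f z l : D' `<=` D -> cderiv D f z l -> cderiv D' f z l.
Proof.
by move=> DD H e e0; have [d d0 {}H] := H e e0; exists d => // w /DD; exact: H.
Qed.

Lemma cdifferentiable_sub D D' f : D' `<=` D -> cdifferentiable D f -> cdifferentiable D' f.
Proof.
by move=> DD H z Dz; have [l hl] := H z (DD _ Dz); exists l; exact: cderiv_sub hl.
Qed.

Lemma cdifferentiable_ext D f g : (forall z, D z -> f z = g z) ->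
  cdifferentiable D f -> cdifferentiable D g.
Proof.
move=> fg H z Dz; have [l {}H] := H z Dz; exists l => e e0.
have [d d0 {}H] := H e e0; exists d => // w Dw wz; rewrite -!fg//.
exact: H.
Qed.

Lemma cderiv_lipschitz D f z l : cderiv D f z l -> exists2 d : R, 0 < d &
  forall w, D w -> cabs (w - z) < d -> cabs (f w - f z) <= (cabs l + 1) * cabs (w - z).
Proof.
move=> /(_ 1 ltr01)[d d0 H]; exists d => // w Dw wz.
have := H w Dw wz; have := cabsD (f w - f z - l * (w - z)) (l * (w - z)).
by rewrite subrK cabsM; clear; lra.
Qed.

Lemma cderiv_cont D f z l : cderiv D f z l -> forall e : R, 0 < e ->
  exists2 d : R, 0 < d & forall w, D w -> cabs (w - z) < d -> cabs (f w - f z) <= e.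
Proof.
move=> /cderiv_lipschitz[d d0 H] e e0; have k0 := cabs_ge0 l.
have e1 : 0 < e / (cabs l + 1) by rewrite divr_gt0//; lra.
exists (Num.min d (e / (cabs l + 1))); first by rewrite lt_min d0.
move=> w Dw; rewrite lt_min => /andP[h1 h2]; apply: (le_trans (H w Dw h1)).
have -> : e = (cabs l + 1) * (e / (cabs l + 1)) by field; apply/eqP; lra.
by apply: ler_wpM2l; [lra|exact: ltW].
Qed.

Lemma cderiv_cst D c z : cderiv D (fun=> c) z 0.
Proof.
move=> e e0; exists e => // w _ _; rewrite mul0r subr0 subrr cabs0.
by rewrite mulr_ge0 ?cabs_ge0// ltW.
Qed.

Lemma cderiv_id D z : cderiv D id z 1.
Proof.
move=> e e0; exists e => // w _ _; rewrite mul1r subrr cabs0.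
by rewrite mulr_ge0 ?cabs_ge0// ltW.
Qed.

Lemma cderivD D f g z l k : cderiv D f z l -> cderiv D g z k ->
  cderiv D (fun w => f w + g w) z (l + k).
Proof.
move=> hf hg e e0; have e2 : 0 < e / 2 by rewrite divr_gt0.
have [d d0 {}hf] := hf _ e2; have [d' d'0 {}hg] := hg _ e2.
exists (Num.min d d'); first by rewrite lt_min d0.
move=> w Dw; rewrite lt_min => /andP[h1 h2].
have -> : f w + g w - (f z + g z) - (l + k) * (w - z) =
  (f w - f z - l * (w - z)) + (g w - g z - k * (w - z)) by ring.
apply: (le_trans (cabsD _ _)).
by have := hf w Dw h1; have := hg w Dw h2; clear; lra.
Qed.

Lemma cderivM D f g z l k : cderiv D f z l -> cderiv D g z k ->
  cderiv D (fun w => f w * g w) z (l * g z + f z * k).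
Proof.
move=> hf hg e e0.
pose A := cabs (g z) + cabs (f z) + 1.
have A0 : 0 < A by rewrite ltr_wpDl// addr_ge0 ?cabs_ge0.
have e2 : 0 < e / (2 * A) by rewrite divr_gt0// mulr_gt0.
have [d1 d10 Hf] := hf _ e2; have [d2 d20 Hg] := hg _ e2.
have [d3 d30 Lf] := cderiv_lipschitz hf; have [d4 d40 Lg] := cderiv_lipschitz hg.
pose B := (cabs l + 1) * (cabs k + 1).
have B0 : 0 < B by rewrite mulr_gt0// ltr_wpDl ?cabs_ge0.
have e3 : 0 < e / (2 * B) by rewrite divr_gt0// mulr_gt0.
exists (Num.min (Num.min d1 d2) (Num.min (Num.min d3 d4) (e / (2 * B)))).
  by rewrite !lt_min d10 d20 d30 d40.
move=> w Dw; rewrite !lt_min => /andP[/andP[w1 w2] /andP[/andP[w3 w4] w5]].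
have -> : f w * g w - f z * g z - (l * g z + f z * k) * (w - z) =
  (f w - f z - l * (w - z)) * g z + f z * (g w - g z - k * (w - z)) +
  (f w - f z) * (g w - g z) by ring.
have t0 := cabs_ge0 (w - z).
apply: (le_trans (cabsD _ _)); have -> : e * cabs (w - z) =
  e / 2 * cabs (w - z) + e / 2 * cabs (w - z) by field.
apply: lerD.
  apply: (le_trans (cabsD _ _)); rewrite !cabsM.
  have h1 : cabs (f w - f z - l * (w - z)) * cabs (g z) <=
      e / (2 * A) * cabs (w - z) * cabs (g z).
    by apply: ler_wpM2r; [exact: cabs_ge0|exact: Hf].
  have h2 : cabs (f z) * cabs (g w - g z - k * (w - z)) <=
      cabs (f z) * (e / (2 * A) * cabs (w - z)).
    by apply: ler_wpM2l; [exact: cabs_ge0|exact: Hg].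
  have h3 : e / 2 * cabs (w - z) = A * (e / (2 * A) * cabs (w - z)).
    by field; rewrite gt_eqF.
  have h4 : 0 <= e / (2 * A) * cabs (w - z) by rewrite mulr_ge0// ltW.
  rewrite h3 /A; move: h1 h2 h4; rewrite /A; clear; lra.
rewrite cabsM; apply: (@le_trans _ _ (((cabs l + 1) * cabs (w - z)) *
    ((cabs k + 1) * cabs (w - z)))).
  by apply: ler_pM; rewrite ?cabs_ge0//; [exact: Lf|exact: Lg].
have -> : e / 2 * cabs (w - z) = B * (e / (2 * B)) * cabs (w - z).
  by field; rewrite gt_eqF.
have -> : (cabs l + 1) * cabs (w - z) * ((cabs k + 1) * cabs (w - z)) =
  B * cabs (w - z) * cabs (w - z) by rewrite /B; ring.
by apply: ler_wpM2r => //; rewrite ler_pM2l// ltW.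
Qed.

Lemma cderivV D z : z != 0 -> cderiv D (fun w => w^-1) z (- z ^- 2).
Proof.
move=> z0 e e0; have c0 : 0 < cabs z by rewrite cabs_gt0.
have e3 : 0 < e * cabs z ^+ 3 / 2 by rewrite divr_gt0// mulr_gt0// exprn_gt0.
exists (Num.min (cabs z / 2) (e * cabs z ^+ 3 / 2)); first by rewrite lt_min divr_gt0.
move=> w _; rewrite lt_min => /andP[h1 h2].
have wz : cabs z / 2 <= cabs w.
  have := cabsB w (w - z); rewrite (_ : w - (w - z) = z); last by ring.
  by move: h1; clear; lra.
have w0 : w != 0 by rewrite -cabs_gt0; move: wz c0; clear; lra.
have -> : w^-1 - z^-1 - (- z ^- 2) * (w - z) = (w - z) * (w - z) / (w * z ^+ 2).
  by field; rewrite ?w0 ?z0.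
rewrite !cabsM cabsV cabsM cabsX -mulrA mulrC; apply: ler_wpM2r; first exact: cabs_ge0.
rewrite ler_pdivrMr; last by rewrite mulr_gt0 ?exprn_gt0// cabs_gt0.
apply: (le_trans (ltW h2)); have -> : e * cabs z ^+ 3 / 2 = e * (cabs z / 2 * cabs z ^+ 2).
  by field.
by rewrite ler_pM2l// ler_wpM2r// sqr_ge0.
Qed.

Lemma cderiv_comp D D' f g z l k : (forall w, D w -> D' (g w)) ->
  cderiv D g z k -> cderiv D' f (g z) l -> cderiv D (fun w => f (g w)) z (l * k).
Proof.
move=> DD hg hf e e0; have [d3 d30 Lg] := cderiv_lipschitz hg.
have k1 : 0 < cabs k + 1 by rewrite ltr_wpDl ?cabs_ge0.
have l1 : 0 < cabs l + 1 by rewrite ltr_wpDl ?cabs_ge0.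
have [|d1 d10 Hf] := hf (e / (2 * (cabs k + 1))); first by rewrite divr_gt0// mulr_gt0.
have [|d2 d20 Hg] := hg (e / (2 * (cabs l + 1))); first by rewrite divr_gt0// mulr_gt0.
exists (Num.min d3 (Num.min d2 (d1 / (cabs k + 1)))).
  by rewrite !lt_min d30 d20 divr_gt0.
move=> w Dw; rewrite !lt_min => /andP[w3 /andP[w2 w1]].
have hL := Lg w Dw w3.
have h1 : cabs (g w - g z) < d1.
  apply: le_lt_trans hL _.
  by rewrite mulrC -ltr_pdivlMr.
have -> : f (g w) - f (g z) - l * k * (w - z) =
  (f (g w) - f (g z) - l * (g w - g z)) + l * (g w - g z - k * (w - z)) by ring.
apply: (le_trans (cabsD _ _)); have -> : e * cabs (w - z) =
  e / (2 * (cabs k + 1)) * ((cabs k + 1) * cabs (w - z)) +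
  (cabs l + 1) * (e / (2 * (cabs l + 1)) * cabs (w - z)).
  by field; rewrite !gt_eqF.
apply: lerD.
  apply: (le_trans (Hf _ (DD _ Dw) h1)).
  by apply: ler_wpM2l hL; rewrite divr_ge0 ?ltW// mulr_gt0.
rewrite cabsM; apply: ler_pM; rewrite ?cabs_ge0//; first by rewrite lerDl.
exact: Hg.
Qed.

Lemma cdifferentiable_cst D c : cdifferentiable D (fun=> c).
Proof. by move=> z _; exists 0; exact: cderiv_cst. Qed.

Lemma cdifferentiable_id D : cdifferentiable D id.
Proof. by move=> z _; exists 1; exact: cderiv_id. Qed.

Lemma cdifferentiableD D f g : cdifferentiable D f -> cdifferentiable D g ->
  cdifferentiable D (fun w => f w + g w).
Proof.
move=> hf hg z Dz; have [l hl] := hf z Dz; have [k hk] := hg z Dz.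
by exists (l + k); exact: cderivD.
Qed.

Lemma cdifferentiableM D f g : cdifferentiable D f -> cdifferentiable D g ->
  cdifferentiable D (fun w => f w * g w).
Proof.
move=> hf hg z Dz; have [l hl] := hf z Dz; have [k hk] := hg z Dz.
by eexists; exact: cderivM hl hk.
Qed.

Lemma cdifferentiableX D f n : cdifferentiable D f -> cdifferentiable D (fun w => f w ^+ n).
Proof.
move=> hf; elim: n => [|n IH].
  by apply: (cdifferentiable_ext (f := fun=> 1)) => //; exact: cdifferentiable_cst.
apply: (cdifferentiable_ext (f := fun w => f w * f w ^+ n)).
  by move=> z _; rewrite exprS.
exact: cdifferentiableM.
Qed.

Lemma cdifferentiableV D f : (forall z, D z -> f z != 0) -> cdifferentiable D f ->
  cdifferentiable D (fun w => (f w)^-1).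
Proof.
move=> f0 hf z Dz; have [l hl] := hf z Dz.
by eexists; exact: (@cderiv_comp D setT (fun w => w^-1) f z _ l _ hl (cderivV _ (f0 z Dz))).
Qed.

Lemma cauchy_riemann_of_cderiv D f (x y : R) l (d : R) : 0 < d ->
  (forall w, `|complex.Re w - x| < d -> `|complex.Im w - y| < d -> D w) ->
  cderiv D f (x +i* y) l ->
  cauchy_riemann (fun x y => complex.Re (f (x +i* y))) (fun x y => complex.Im (f (x +i* y)))
    x y (complex.Re l) (complex.Im l).
Proof.
move=> d0 Dw H e e0; have [d1 d10 {}H] := H e e0.
exists (Num.min d (d1 / 2)); first by rewrite lt_min d0 divr_gt0.
move=> x' y'; rewrite !lt_min => /andP[x1 x2] /andP[y1 y2].
have E : (x' +i* y') - (x +i* y) = (x' - x) +i* (y' - y) by [].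
have le := cabs_le_ReIm ((x' +i* y') - (x +i* y)); rewrite E /= in le.
have hh := H (x' +i* y') (Dw (x' +i* y') x1 y1); rewrite E in hh.
have {}hh : cabs (f (x' +i* y') - f (x +i* y) - l * ((x' - x) +i* (y' - y))) <=
   e * (`|x' - x| + `|y' - y|).
  apply: le_trans (hh _) _; last by rewrite ler_pM2l.
  by apply: le_lt_trans le _; move: x2 y2; clear; lra.
split.
  apply: le_trans hh; apply: le_trans (normRe_le_cabs _).
  by rewrite !ReImE.
apply: le_trans hh; apply: le_trans (normIm_le_cabs _).
by rewrite !ReImE/= [complex.Re l * _ + _]addrC.
Qed.

End ComplexDerivative.

(** * Holomorphic functions: maximum principle, Phragmen-Lindelof, identity theorem *)

Section HolomorphicFunctions.
Context {R : realType}.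
Implicit Types (D : set R[i]) (f : R[i] -> R[i]) (z w : R[i]).

Definition plane_set D : set (R * R) := [set p | D (p.1 +i* p.2)].

Definition interior_pt D z := exists2 d : R, 0 < d & forall w,
  `|complex.Re w - complex.Re z| < d -> `|complex.Im w - complex.Im z| < d -> D w.

(** In place of a boundary, each point of [D] either satisfies the bound or has a square
    neighbourhood in [D]. A maximum of [Re f + e x^2] fits neither case when the bound fails at some
    [z0]: at a point of the first kind it is too small if [e] is small, and the second kind
    contradicts [no_local_maximum]. *)
Lemma maximum_principle D f (m : R) : compact (plane_set D) ->
  cdifferentiable D f ->
  (forall z, D z -> complex.Re (f z) <= m \/ interior_pt D z) ->
  forall z, D z -> complex.Re (f z) <= m.
Proof.
move=> cD df bd z0 Dz0; rewrite leNgt; apply/negP => z0m.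
pose u x y := complex.Re (f (x +i* y)).
have D0 : plane_set D !=set0.
  by exists (complex.Re z0, complex.Im z0); rewrite /plane_set/=; case: z0 Dz0 {z0m}.
have cf (K : set (R * R)) (z : R * R) (c : R) : plane_set D z -> K `<=` plane_set D ->
    cont2_at K (fun p => u p.1 p.2 + c * p.1 ^+ 2) z.
  case: z => x y Dz KD e e0; have [l hl] := df _ Dz.
  have e2 : 0 < e / 2 by rewrite divr_gt0.
  have [d d0 H] := cderiv_cont hl e2.
  pose B := `|c| * (2 * `|x| + 1) + 1.
  have B0 : 0 < B by rewrite ltr_wpDl// mulr_ge0//; have := normr_ge0 x; lra.
  exists (Num.min (d / 2) (Num.min 1 (e / (2 * B)))).
    by rewrite !lt_min ltr01 !divr_gt0 ?mulr_gt0.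
  move=> [x' y'] /= /KD Kp; rewrite !lt_min => /andP[x1 /andP[x2 x3]] /andP[y1 _].
  have -> : u x' y' + c * x' ^+ 2 - (u x y + c * x ^+ 2) =
    (u x' y' - u x y) + c * ((x' - x) * (x' + x)) by ring.
  apply: (le_trans (ler_normD _ _)); rewrite [leRHS](_ : e = e / 2 + e / 2); last by field.
  apply: lerD.
    have -> : u x' y' - u x y = complex.Re (f (x' +i* y') - f (x +i* y)).
      by rewrite /u !ReImE.
    apply: (le_trans (normRe_le_cabs _)); apply: H => //.
    by apply: (le_lt_trans (cabs_le_ReIm _)) => /=; move: x1 y1; clear; lra.
  have h1 : `|x' + x| <= 2 * `|x| + 1.
    rewrite (_ : x' + x = 2 * x + (x' - x)); last by ring.
    apply: (le_trans (ler_normD _ _)); rewrite normrM (ger0_norm (_ : 0 <= 2))//.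
    by rewrite lerD2l ltW.
  have h2 : `|c| * (`|x' - x| * `|x' + x|) <= `|x' - x| * B.
    rewrite mulrCA; apply: ler_wpM2l => //; rewrite /B.
    have := ler_wpM2l (normr_ge0 c) h1; lra.
  rewrite !normrM; apply: (le_trans h2); rewrite -ler_pdivlMr//.
  by apply: ltW; apply: (lt_le_trans x3); rewrite invfM mulrA.
have cx2 (z : R * R) : plane_set D z -> cont2_at (plane_set D) (fun p => p.1 ^+ 2) z.
  move=> Dz e e0; have [d d0 H] := cf _ z 1 Dz (fun _ => id) (e / 2) (divr_gt0 e0 (ltr0n _ 2)).
  have [d' d'0 H'] := cf _ z 0 Dz (fun _ => id) (e / 2) (divr_gt0 e0 (ltr0n _ 2)).
  exists (Num.min d d'); first by rewrite lt_min d0.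
  move=> w Dw; rewrite !lt_min => /andP[a b] /andP[a' b'].
  have := H w Dw a a'; have := H' w Dw b b'.
  rewrite !mul1r !mul0r !addr0 => h1 h2.
  rewrite (_ : w.1 ^+ 2 - z.1 ^+ 2 = (u w.1 w.2 + w.1 ^+ 2 - (u z.1 z.2 + z.1 ^+ 2))
     - (u w.1 w.2 - u z.1 z.2)); last by ring.
  by apply: (le_trans (ler_normB _ _)); move: h1 h2; clear; lra.
have [b Db bmax] := compact_max2 cD D0 cx2.
(* [b] maximises [x^2] on [D], so [e * x ^+ 2] stays below half the excess of [Re (f z0)] over
   [m]. *)
pose e := (complex.Re (f z0) - m) / (2 * (b.1 ^+ 2 + 1)).
have b0 : 0 <= b.1 ^+ 2 by exact: sqr_ge0.
have e0 : 0 < e by rewrite divr_gt0 ?subr_gt0//; lra.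
have [|[x y] Dc cmax] := @compact_max2 _ _ (fun p => u p.1 p.2 + e * p.1 ^+ 2) cD D0.
  by move=> [a1 a2] Dz; exact: cf.
have {}cmax x' y' : D (x' +i* y') -> u x' y' + e * x' ^+ 2 <= u x y + e * x ^+ 2.
  by move=> D'; exact: (cmax (x', y')).
have [h|[d d0 H]] := bd _ Dc.
  have Dz0' : D (complex.Re z0 +i* complex.Im z0) by case: (z0) Dz0.
  have h1 := cmax _ _ Dz0'.
  have h2 := bmax (x, y) Dc; rewrite /= in h2.
  have h3 : e * x ^+ 2 <= e * b.1 ^+ 2 by rewrite ler_pM2l.
  have h4 : e * (2 * (b.1 ^+ 2 + 1)) = complex.Re (f z0) - m.
    by rewrite /e divfK//; apply/eqP; lra.
  have h5 : u (complex.Re z0) (complex.Im z0) = complex.Re (f z0).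
    by rewrite /u; case: (z0).
  have h6 : 0 <= e * complex.Re z0 ^+ 2 by rewrite mulr_ge0 ?sqr_ge0// ltW.
  have h7 : 0 <= e * b.1 ^+ 2 by rewrite mulr_ge0// ltW.
  have h8 : u x y <= m := h.
  by move: h1 h3 h4 h5 h6 h7 h8 e0; clear; lra.
apply: (@no_local_maximum _ u (fun x y => complex.Im (f (x +i* y))) x y d e d0 e0).
  move=> x' y' hx hy; have Dxy : D (x' +i* y') by apply: H.
  have [l hl] := df _ Dxy; exists (complex.Re l), (complex.Im l).
  have dd : 0 < Num.min (d - `|x' - x|) (d - `|y' - y|) by rewrite lt_min !subr_gt0 hx.
  apply: (cauchy_riemann_of_cderiv dd) hl => w.
  rewrite !lt_min => /andP[w1 _] /andP[_ w2]; apply: H => /=.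
    rewrite (_ : _ - x = (complex.Re w - x') + (x' - x)); last by ring.
    by apply: (le_lt_trans (ler_normD _ _)); move: w1; clear; lra.
  rewrite (_ : _ - y = (complex.Im w - y') + (y' - y)); last by ring.
  by apply: (le_lt_trans (ler_normD _ _)); move: w2; clear; lra.
by move=> x' y' hx hy; apply: cmax; exact: H.
Qed.

(** Multiplying [f] by the conjugate of [f z0] makes its value at [z0] the real number [|f z0|^2],
    which reduces the modulus to the real part. *)
Lemma maximum_modulus D f (m : R) : compact (plane_set D) ->
  cdifferentiable D f ->
  (forall z, D z -> cabs (f z) <= m \/ interior_pt D z) ->
  forall z, D z -> cabs (f z) <= m.
Proof.
move=> cD df bd z0 Dz0.
have [->|fz0] := eqVneq (f z0) 0.
  (* Here [0 <= m] is to be shown. For [m < 0] no point could satisfy the bound, so all of [D] would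
     be interior, and the maximum principle would prove [0 <= -1]. *)
  rewrite cabs0 leNgt; apply/negP => m0.
  suff : complex.Re (0 : R[i]) <= -1 by rewrite /=; lra.
  apply: (@maximum_principle D (fun=> 0) (-1) cD (@cdifferentiable_cst _ _ _) _ z0 Dz0).
  by move=> z Dz; have [h|] := bd z Dz; [left; have := cabs_ge0 (f z); lra|right].
have c0 : 0 < cabs (f z0) by rewrite cabs_gt0.
suff : complex.Re (f z0 * (f z0)^*%C) <= m * cabs (f z0).
  by rewrite mulr_conj /= expr2 ler_pM2r.
apply: (@maximum_principle D (fun z => f z * (f z0)^*%C) _ cD _ _ z0 Dz0).
  by apply: cdifferentiableM => //; exact: cdifferentiable_cst.
move=> z Dz; have [h|] := bd z Dz; last by right.
left; apply: (le_trans (Re_le_cabs _)); rewrite cabsM cabs_conj.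
by rewrite ler_pM2r.
Qed.

Lemma compact_annulus (a : R[i]) (r s : R) :
  compact (plane_set [set z | r ^+ 2 <= cabs (z - a) ^+ 2 /\ cabs (z - a) <= s]).
Proof.
pose q (p : R * R) := (p.1 - complex.Re a) * (p.1 - complex.Re a) +
  (p.2 - complex.Im a) * (p.2 - complex.Im a).
have cq : continuous q.
  have c1 : continuous (fun p : R * R => p.1 - complex.Re a).
    by move=> p; apply: cvgB; [exact: cvg_fst|exact: cvg_cst].
  have c2 : continuous (fun p : R * R => p.2 - complex.Im a).
    by move=> p; apply: cvgB; [exact: cvg_snd|exact: cvg_cst].
  by move=> p; apply: cvgD; apply: cvgM; [exact: c1|exact: c1|exact: c2|exact: c2].
have qE p : q p = cabs (p.1 +i* p.2 - a) ^+ 2.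
  by rewrite sqr_cabs /q !expr2; case: (a).
have [s0|s0] := ltP s 0.
  rewrite (_ : plane_set _ = set0); first exact: compact0.
  apply/seteqP; split => // p [_ /= h]; have := cabs_ge0 (p.1 +i* p.2 - a).
  by move: h s0; clear; lra.
pose B := cabs a + s.
apply: (@subclosed_compact _ _ (`[- B, B] `*` `[- B, B])).
- rewrite (_ : plane_set _ = q @^-1` [set x | r ^+ 2 <= x] `&` q @^-1` [set x | x <= s ^+ 2]).
    by apply: closedI; apply: closed_comp => [p _|]; [exact: cq|exact: closed_ge|exact: cq|exact: closed_le].
  apply/seteqP; split => p; rewrite /plane_set/= qE => -[h1 h2]; split => //.
    by rewrite ler_pXn2r// nnegrE ?cabs_ge0.
  by move: h2; rewrite ler_pXn2r// nnegrE ?cabs_ge0.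
- by apply: compact_setX; exact: segment_compact.
- move=> p [_ h]; have h1 := cabsD (p.1 +i* p.2 - a) a.
  rewrite subrK in h1.
  have h2 := normRe_le_cabs (p.1 +i* p.2); have h3 := normIm_le_cabs (p.1 +i* p.2).
  rewrite /= in h2 h3; rewrite /= !in_itv/= -!ler_norml /B.
  by move: h h1 h2 h3; clear; lra.
Qed.

Lemma interior_annulus a (r s : R) z : r < cabs (z - a) < s ->
  exists2 d : R, 0 < d & forall w, `|complex.Re w - complex.Re z| < d ->
    `|complex.Im w - complex.Im z| < d -> r < cabs (w - a) < s.
Proof.
move=> /andP[h1 h2].
exists (Num.min (cabs (z - a) - r) (s - cabs (z - a)) / 2).
  by rewrite divr_gt0// lt_min !subr_gt0 h1.
move=> w w1 w2.
have := cabs_le_ReIm (w - z); rewrite !ReImE.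
have m1 : Num.min (cabs (z - a) - r) (s - cabs (z - a)) <= cabs (z - a) - r by rewrite ge_min lexx.
have m2 : Num.min (cabs (z - a) - r) (s - cabs (z - a)) <= s - cabs (z - a) by rewrite ge_min lexx orbT.
have := cabsD (w - z) (z - a); have := cabsB (w - a) (w - z).
rewrite (_ : w - a - (w - z) = z - a); last by ring.
rewrite (_ : w - z + (z - a) = w - a); last by ring.
by move: w1 w2 m1 m2; clear; lra.
Qed.

(** The origin is excluded because [- z^-1] is singular there; the half-axes belong to the set
    because nonnegativity of [- z Q(z)] is known on them. *)
Definition second_quadrant : set R[i] :=
  [set z | complex.Re z <= 0 /\ 0 <= complex.Im z /\ z != 0].

Lemma phragmen_lindelof f (m M : R) :
  cdifferentiable second_quadrant f ->
  (forall z, second_quadrant z -> complex.Re (f z) <= M) ->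
  (forall z, second_quadrant z -> complex.Re z = 0 \/ complex.Im z = 0 ->
     complex.Re (f z) <= m) ->
  forall z, second_quadrant z -> complex.Re (f z) <= m.
Proof.
move=> df fM fm z0 Qz0.
(* The barrier: on the quadrant, [Re (b z) = - (Im z - Re z) (1 + 1 / |z|^2)]
   is at most [- (|z| + 1 / |z|)]. *)
pose b z : R[i] := (1 +i* 1) * z + (1 -i* 1) * z^-1.
have bRe z : complex.Re (b z) =
    - ((complex.Im z - complex.Re z) * (1 + (cabs z ^+ 2)^-1)).
  by rewrite /b !ReImE ReV ImV /=; ring.
have bd z : second_quadrant z -> complex.Re (b z) <= - (cabs z + (cabs z)^-1).
  move=> [h1 [h2 h3]]; rewrite bRe lerN2.
  have c0 : 0 < cabs z by rewrite cabs_gt0.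
  have -> : cabs z + (cabs z)^-1 = cabs z * (1 + (cabs z ^+ 2)^-1).
    by field; rewrite gt_eqF.
  apply: ler_wpM2r; first by rewrite addr_ge0// invr_ge0 sqr_ge0.
  have := cabs_le_ReIm z; rewrite (ger0_norm h2) ler0_norm//; clear; lra.
have db : cdifferentiable second_quadrant b.
  apply: cdifferentiableD; apply: cdifferentiableM; try exact: cdifferentiable_cst.
    exact: cdifferentiable_id.
  apply: cdifferentiableV; last exact: cdifferentiable_id.
  by move=> z [_ []].
clearbody b; clear bRe.
suff H (e : R) : 0 < e -> complex.Re (f z0) <= m - e * complex.Re (b z0).
  rewrite leNgt; apply/negP => mz.
  pose c := 1 + `|complex.Re (b z0)|; have c0 : 0 < c by rewrite ltr_pwDl.
  have := H ((complex.Re (f z0) - m) / (2 * c)).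
  rewrite divr_gt0 ?subr_gt0 ?mulr_gt0// => /(_ isT).
  have h1 : - complex.Re (b z0) <= c by rewrite /c; have := ler_norm (- complex.Re (b z0)); rewrite normrN; clear; lra.
  have h2 : (complex.Re (f z0) - m) / (2 * c) * (- complex.Re (b z0)) <=
    (complex.Re (f z0) - m) / (2 * c) * c.
    by rewrite ler_wpM2l// divr_ge0 ?subr_ge0 ?(ltW mz)// mulr_ge0// ltW.
  have h3 : (complex.Re (f z0) - m) / (2 * c) * c = (complex.Re (f z0) - m) / 2.
    by field; rewrite gt_eqF.
  by move: mz h2 h3; clear; lra.
move=> e0.
have z00 : 0 < cabs z0 by rewrite cabs_gt0; case: Qz0 => _ [].
(* The quadrant is truncated to [r <= |z| <= 1 / r]. The first two terms put [z0] inside; the third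
   gives [M - m < e / r], so that on both arcs [e * Re (b z) <= - e / r] makes up for the weaker
   bound [M]. *)
pose r := Num.min (Num.min (cabs z0) (cabs z0)^-1) (e / (1 + `|M - m|)) / 2.
have M0 : 0 < 1 + `|M - m| by rewrite ltr_pwDl.
have [r0 r1 r2 r3] : [/\ 0 < r, r < cabs z0, r < (cabs z0)^-1 & r * (1 + `|M - m|) < e].
  have : 0 < Num.min (Num.min (cabs z0) (cabs z0)^-1) (e / (1 + `|M - m|)).
    by rewrite !lt_min z00 invr_gt0 z00 divr_gt0.
  have : Num.min (Num.min (cabs z0) (cabs z0)^-1) (e / (1 + `|M - m|)) <= cabs z0.
    by rewrite !ge_min lexx.
  have : Num.min (Num.min (cabs z0) (cabs z0)^-1) (e / (1 + `|M - m|)) <= (cabs z0)^-1.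
    by rewrite !ge_min lexx orbT.
  have : Num.min (Num.min (cabs z0) (cabs z0)^-1) (e / (1 + `|M - m|)) <= e / (1 + `|M - m|).
    by rewrite !ge_min lexx orbT.
  rewrite /r; move: (Num.min _ _) => t; rewrite -(ltr_pdivlMr _ _ M0).
  by move: (e / _) (cabs z0) (cabs z0)^-1; clear; move=> *; split; lra.
pose D : set R[i] := [set z | complex.Re z <= 0 /\ 0 <= complex.Im z] `&`
   [set z | r ^+ 2 <= cabs (z - 0) ^+ 2 /\ cabs (z - 0) <= r^-1].
have DQ : D `<=` second_quadrant.
  move=> z [[h1 h2] [h3 _]]; split => //; split => //; apply/eqP => z0E.
  by move: h3; rewrite z0E subrr cabs0 expr0n/=; have := exprn_gt0 2 r0; clear; lra.
have := @maximum_principle D (fun z => f z + e%:C * b z) m.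
have Dz0 : D z0.
  case: Qz0 => h1 [h2 _]; split => //; rewrite /= subr0; split.
    by rewrite ler_pXn2r ?nnegrE ?cabs_ge0// ltW.
  by rewrite -[leLHS]invrK lef_pV2 ?posrE ?invr_gt0// ltW.
move=> /(_ _ _ _ z0 Dz0); rewrite !ReImE/= mul0r subr0 => H.
rewrite lerBrDr; apply: H.
- rewrite /D (_ : plane_set _ =
     plane_set [set z | complex.Re z <= 0 /\ 0 <= complex.Im z] `&`
     plane_set [set z | r ^+ 2 <= cabs (z - 0) ^+ 2 /\ cabs (z - 0) <= r^-1])//.
  rewrite setIC; apply: compact_closedI; first exact: compact_annulus.
  rewrite (_ : plane_set _ = fst @^-1` [set x | x <= 0] `&` snd @^-1` [set x | 0 <= x])//.
  by apply: closedI; apply: closed_comp => [p _|];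
    [exact: cvg_fst|exact: closed_le|exact: cvg_snd|exact: closed_ge].
- apply: cdifferentiableD; first exact: cdifferentiable_sub DQ _.
  apply: cdifferentiableM; first exact: cdifferentiable_cst.
  exact: cdifferentiable_sub DQ _.
- move=> z Dz; have Qz := DQ _ Dz; have [[h1 h2] [h3 h4]] := Dz.
  rewrite subr0 in h3 h4.
  have c0 : 0 < cabs z by rewrite cabs_gt0; case: Qz => _ [].
  have ci : 0 < (cabs z)^-1 by rewrite invr_gt0.
  have {}h3 : r <= cabs z by move: h3; rewrite ler_pXn2r ?nnegrE ?cabs_ge0// ltW.
  have hb := bd z Qz; rewrite !ReImE/= mul0r subr0.
  have eb : e * complex.Re (b z) <= - (e * (cabs z + (cabs z)^-1)).
    by rewrite -mulrN ler_pM2l.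
  have [|ne0] := pselect (complex.Re z = 0 \/ complex.Im z = 0).
    move=> /(fm z Qz) hm; left.
    have : 0 <= e * (cabs z + (cabs z)^-1) by rewrite mulr_ge0 ?addr_ge0// ltW.
    by move: hm eb; clear; lra.
  have large : e / r <= e * (cabs z + (cabs z)^-1) ->
      complex.Re (f z) + e * complex.Re (b z) <= m.
    have : M - m < e / r.
      rewrite ltr_pdivlMr// mulrC; apply: le_lt_trans r3.
      by rewrite ler_pM2l//; have := ler_norm (M - m); clear; lra.
    by have := fM z Qz; move: eb; clear; lra.
  have [e1|ne1] := eqVneq (cabs z) r.
    by left; apply: large; rewrite ler_pM2l// e1 lerDr ltW.
  have [e2|ne2] := eqVneq (cabs z) r^-1.
    by left; apply: large; rewrite ler_pM2l// e2 lerDl invrK ltW.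
  right.
  have hr : r < cabs (z - 0) < r^-1.
    by rewrite subr0 !lt_neqAle h3 h4 ne2 eq_sym ne1.
  have [d d0 Hd] := interior_annulus hr.
  have x0 : complex.Re z < 0.
    by rewrite lt_neqAle h1 andbT; apply/eqP => ?; apply: ne0; left.
  have y0 : 0 < complex.Im z.
    by rewrite lt_neqAle h2 andbT; apply/eqP => ?; apply: ne0; right.
  exists (Num.min d (Num.min (- complex.Re z) (complex.Im z))).
    by rewrite !lt_min d0 oppr_gt0 x0.
  move=> w; rewrite !lt_min => /andP[w1 /andP[w2 _]] /andP[w3 /andP[_ w4]].
  have /andP[w5 w6] := Hd w w1 w3; split => /=.
    by move: w2 w4; rewrite !ltr_norml; clear; lra.
  split; last exact: ltW.
  by rewrite ler_pXn2r ?nnegrE ?cabs_ge0// ltW.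
Qed.

End HolomorphicFunctions.

Section IdentityTheorem.
Context {R : realType}.
Implicit Types (D : set R[i]) (f : R[i] -> R[i]) (z w : R[i]).

(* Hadamard's trick: [f] vanishes on the inner circle, so the maximum principle for
   [f / (z - a)^n] bounds [f z] by [M (|z - a| / s)^n]. *)
Lemma annulus_vanish f (a : R[i]) (r s : R) : 0 < r ->
  let D : set R[i] := [set z | r ^+ 2 <= cabs (z - a) ^+ 2 /\ cabs (z - a) <= s] in
  cdifferentiable D f -> (forall z, D z -> cabs (z - a) = r -> f z = 0) ->
  forall z, D z -> cabs (z - a) < s -> f z = 0.
Proof.
move=> r0 D df f0 z Dz zs.
have za0 w : D w -> 0 < cabs (w - a).
  move=> [h _]; rewrite lt_def cabs_ge0 andbT; apply/eqP => h0.
  by move: h; rewrite h0 expr0n/=; have := exprn_gt0 2 r0; lra.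
have s0 : 0 < s by apply: lt_trans zs; exact: za0.
have [b Db bM] : exists2 b, D b & forall w, D w -> cabs (f w) <= cabs (f b).
  have [|[x y] h1 e e0|[x y] Db h] := @compact_max2 _ _ (fun p => cabs (f (p.1 +i* p.2)))
      (@compact_annulus R a r s).
  - by exists (complex.Re z, complex.Im z); rewrite /plane_set/=; case: z Dz {zs}.
  - have [l hl] := df _ h1; have [d d0 H] := cderiv_cont hl e0.
    exists (d / 2); first by rewrite divr_gt0.
    move=> [x' y'] /= K h3 h4; apply: le_trans (H _ K _).
      rewrite ler_norml; have := cabsD (f (x' +i* y') - f (x +i* y)) (f (x +i* y)).
      have := cabsD (f (x +i* y) - f (x' +i* y')) (f (x' +i* y')).
      by rewrite !subrK cabs_distC; clear; lra.
    by apply: (le_lt_trans (cabs_le_ReIm _)) => /=; move: h3 h4; clear; lra.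
  - exists (x +i* y) => // -[x' y'] Dw; exact: (h (x', y')).
have bound n : cabs (f z * (z - a) ^- n) <= cabs (f b) * s ^- n.
  apply: (@maximum_modulus R D (fun w => f w * (w - a) ^- n)) => //.
  - exact: compact_annulus.
  - apply: cdifferentiableM => //.
    apply: (cdifferentiable_ext (f := fun w => (w - a)^-1 ^+ n)) => [w _|].
      by rewrite exprVn.
    apply: cdifferentiableX; apply: cdifferentiableV.
      by move=> w /za0; rewrite cabs_gt0.
    by apply: cdifferentiableD; [exact: cdifferentiable_id|exact: cdifferentiable_cst].
  - move=> w Dw; have [h1 h2] := Dw; have c0 := za0 w Dw.
    have {}h1 : r <= cabs (w - a) by move: h1; rewrite ler_pXn2r ?nnegrE ?cabs_ge0// ltW.
    have [e1|ne1] := eqVneq (cabs (w - a)) r.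
      left; rewrite f0// mul0r cabs0; apply: mulr_ge0; first exact: cabs_ge0.
      by rewrite invr_ge0 exprn_ge0// ltW.
    have [e1|ne2] := eqVneq (cabs (w - a)) s.
      left; rewrite cabsM cabsV cabsX e1; apply: ler_wpM2r; last exact: bM.
      by rewrite invr_ge0 exprn_ge0// ltW.
    right; have hr : r < cabs (w - a) < s by rewrite !lt_neqAle h1 h2 ne2 eq_sym ne1.
    have [d d0 Hd] := interior_annulus hr.
    exists d => // w' w1 w2; have /andP[w3 w4] := Hd w' w1 w2; split; last exact: ltW.
    by rewrite ler_pXn2r ?nnegrE ?cabs_ge0// ltW.
apply/eqP; rewrite -cabs_eq0 eq_le cabs_ge0 andbT leNgt; apply/negP => fz0.
have c0 := za0 z Dz.
have q01 : 0 <= cabs (z - a) / s < 1.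
  by rewrite divr_ge0 ?cabs_ge0 ?(ltW s0)//= ltr_pdivrMr// mul1r.
have [n] := pow_small (cabs (f b)) q01 fz0; rewrite ltNge => /negP; apply.
have := bound n; rewrite cabsM cabsV cabsX ler_pdivrMr ?exprn_gt0//.
by rewrite expr_div_n mulrA mulrAC.
Qed.

(** A disc tangent to the real axis and centred on the line [Re = -1] contains [x + iy] once its
    radius [Y] exceeds half of [((x + 1)^2 + y^2) / y]. As [Y >= 1], [f] vanishes on the disc of
    radius [1/2] about the centre, so a single annulus suffices instead of a chain of discs. *)
Lemma identity_upper_half_plane f :
  cdifferentiable [set z | 0 < complex.Im z] f ->
  (forall z, complex.Re z < 0 -> 0 < complex.Im z -> f z = 0) ->
  forall z, 0 < complex.Im z -> f z = 0.
Proof.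
move=> df f0 z; case: z => x y /= y0.
pose Y := 1 + ((x + 1) ^+ 2 + y ^+ 2) / y.
pose a : R[i] := (- 1) +i* Y.
have Y1 : 1 <= Y by rewrite lerDl divr_ge0 ?(ltW y0)// addr_ge0// sqr_ge0.
have za : cabs ((x +i* y) - a) < Y.
  rewrite -(ltr_pXn2r (n := 2)) ?nnegrE ?cabs_ge0//; last lra.
  rewrite sqr_cabs /= opprK.
  have E : Y * y = y + (x + 1) ^+ 2 + y ^+ 2.
    by rewrite /Y; field; rewrite gt_eqF.
  have : 0 < Y * y by rewrite mulr_gt0//; lra.
  have : (y - Y) ^+ 2 = y ^+ 2 - 2 * (Y * y) + Y ^+ 2 by ring.
  by move: E; clear -y0; lra.
pose s := (cabs ((x +i* y) - a) + Y) / 2.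
have [c1 c2] : cabs ((x +i* y) - a) < s /\ s < Y by rewrite /s; split; lra.
have up w : cabs (w - a) <= s -> 0 < complex.Im w.
  move=> h; have := normIm_le_cabs (w - a); rewrite !ReImE /= ler_norml.
  by move: h c2; clear; lra.
have inner_zero w : cabs (w - a) <= 2^-1 -> f w = 0.
  move=> h; have := normIm_le_cabs (w - a); have := normRe_le_cabs (w - a).
  rewrite !ReImE /= !ler_norml => h1 h2.
  by apply: f0; move: h h1 h2 Y1; clear; lra.
have [h|h] := leP (cabs ((x +i* y) - a)) 2^-1; first exact: inner_zero.
apply: (@annulus_vanish f a 2^-1 s) => //.
- by apply: cdifferentiable_sub df => w [_ ?]; exact: up.
- by move=> w _ h'; apply: inner_zero; rewrite h'.
- split; last exact: ltW.
  by rewrite ler_pXn2r ?nnegrE ?cabs_ge0// ltW.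
Qed.

(** The clamp [c] onto the unit interval is 1-Lipschitz, so [g (c t)] has derivative 0 on the whole
    line, and the one-sided conditions at the endpoints need no separate treatment. *)
Lemma zero_derivative_const (g : R -> R) :
  (forall t e : R, 0 <= t <= 1 -> 0 < e -> exists2 d : R, 0 < d &
     forall s, 0 <= s <= 1 -> `|s - t| < d -> `|g s - g t| <= e * `|s - t|) ->
  g 1 = g 0.
Proof.
move=> H; pose c (t : R) := Num.max 0 (Num.min t 1).
have c01 t : 0 <= c t <= 1.
  by rewrite le_max lexx /= ge_max ler01 /= ge_min lexx orbT.
have cP t : [\/ t <= 0 /\ c t = 0, 0 <= t <= 1 /\ c t = t | 1 <= t /\ c t = 1].
  rewrite /c; case: (leP t 1) => t1; last by apply: Or33; case: (leP 0 1) => // ?; lra.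
  by case: (leP 0 t) => t0; [apply: Or32|apply: Or31; split => //; exact: ltW].
have cl s t : `|c s - c t| <= `|s - t|.
  have h1 := ler_norm (s - t); have h2 := ler_norm (t - s); rewrite distrC in h2.
  rewrite ler_norml; case: (cP s) => -[? ->]; case: (cP t) => -[? ->]; lra.
have : g (c 1) = g (c 0).
  apply: (@is_derive_0_is_cst R (fun t => g (c t))) => t.
  apply/is_derive_epsP => e e0; have [d d0 {}H] := H (c t) e (c01 t) e0.
  exists d => // s sd; rewrite mul0r subr0.
  apply: le_trans (H _ (c01 s) (le_lt_trans (cl _ _) sd)) _.
  by rewrite ler_pM2l.
by have [[]|[_ ->]|[_ ->]] := cP 1; have [[_ ->]|[_ ->]|[]] := cP 0 => //; lra.
Qed.

(* A point of the quadrant can be approached within it along the directions [-1] and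
   ['i], so a derivative of a real-valued function must vanish. *)
Lemma real_on_second_quadrant f :
  cdifferentiable second_quadrant f ->
  (forall z, second_quadrant z -> complex.Im (f z) = 0) ->
  forall z, second_quadrant z -> f z = f (-1).
Proof.
move=> df fr.
have Qneg z (t : R) : 0 < t -> second_quadrant z -> second_quadrant (z - t%:C).
  move=> t0 [h1 [h2 h3]]; split; [|split]; rewrite ?ReImE /=; try lra.
  apply/eqP => /(congr1 (@complex.Re R)); rewrite !ReImE/=.
  by move: t0 h1; clear; lra.
have Qup z (t : R) : 0 < t -> second_quadrant z -> second_quadrant (z + (0 +i* t)).
  move=> t0 [h1 [h2 h3]]; split; [|split]; rewrite ?ReImE /=; try lra.
  apply/eqP => /(congr1 (@complex.Im R)); rewrite !ReImE/=.
  by move: t0 h2; clear; lra.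
have d0 z : second_quadrant z -> cderiv second_quadrant f z 0.
  move=> Qz; have [l hl] := df z Qz; suff -> : 0 = l by [].
  have small (c : R) : (forall e : R, 0 < e -> `|c| <= e) -> c = 0.
    move=> h; apply/eqP; rewrite -normr_le0 leNgt; apply/negP => c0.
    by have := h (`|c| / 2); rewrite divr_gt0// => /(_ isT); move: c0; clear; lra.
  apply: complex_ext => /=; apply/esym/small => e e0; have [d d0 H] := hl e e0.
  - have t0 : 0 < d / 2 by rewrite divr_gt0.
    have Q' := Qup z _ t0 Qz; have h := H _ Q'.
    rewrite (_ : z + (0 +i* (d / 2)) - z = 0 +i* (d / 2)) in h; last by ring.
    have E : cabs (0 +i* (d / 2)) = d / 2.
      by rewrite /Normc.normc expr0n add0r sqrtr_sqr gtr0_norm.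
    rewrite E in h; have dd : d / 2 < d by lra.
    have {h dd} := le_trans (normIm_le_cabs _) (h dd).
    rewrite [complex.Im _](_ : _ = - (complex.Re l * (d / 2))).
      by rewrite normrN normrM (gtr0_norm t0) ler_pM2r.
    by rewrite !ReImE /= (fr _ Q') (fr _ Qz); ring.
  - have t0 : 0 < d / 2 by rewrite divr_gt0.
    have Q' := Qneg z _ t0 Qz; have h := H _ Q'.
    rewrite (_ : z - (d / 2)%:C - z = - (d / 2)%:C) in h; last by ring.
    rewrite cabsN cabs_real (gtr0_norm t0) in h; have dd : d / 2 < d by lra.
    have {h dd} := le_trans (normIm_le_cabs _) (h dd).
    rewrite [complex.Im _](_ : _ = complex.Im l * (d / 2)).
      by rewrite normrM (gtr0_norm t0) ler_pM2r.
    by rewrite !ReImE /= (fr _ Q') (fr _ Qz); ring.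
move=> z Qz; have Q1 : second_quadrant (-1 : R[i]).
  split => /=; first by rewrite lerN10.
  by rewrite oppr0 lexx oppr_eq0 oner_eq0.
(* The quadrant is a convex cone without opposite rays, so the segment from [-1] to [z] stays in it
   and avoids the origin. *)
pose p (t : R) : R[i] := -1 + t%:C * (z + 1).
have Qp t : 0 <= t <= 1 -> second_quadrant (p t).
  move=> /andP[t0 t1]; have [h1 [h2 h3]] := Qz.
  have a1 : t * complex.Re z <= 0 by rewrite mulr_ge0_le0.
  have a2 : 0 <= t * complex.Im z by rewrite mulr_ge0.
  split; [|split]; rewrite /p ?ReImE /= ?mul0r; try lra.
  apply/eqP => E.
  have e1 : complex.Re (p t) = 0 by rewrite /p E.
  have e2 : complex.Im (p t) = 0 by rewrite /p E.
  rewrite /p !ReImE /= in e1 e2.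
  have tE : t = 1 by move: e1 a1 t1; clear; lra.
  move: h3; rewrite (_ : z = 0) ?eqxx//.
  by move: E; rewrite tE mul1r addrC addrK.
have e0 : complex.Re (f (p 1)) = complex.Re (f (p 0)).
  apply: (zero_derivative_const (g := fun t => complex.Re (f (p t)))) => t e t01 e0.
  pose c := cabs (z + 1) + 1; have c0 : 0 < c by rewrite ltr_wpDl ?cabs_ge0.
  have [|d dd H] := d0 _ (Qp t t01) (e / c); first by rewrite divr_gt0.
  exists (d / c) => [|s s01 st]; first by rewrite divr_gt0.
  have E : cabs (p s - p t) = `|s - t| * cabs (z + 1).
    by rewrite -cabs_real -cabsM; congr cabs; rewrite /p rmorphB /=; ring.
  have le : `|s - t| * cabs (z + 1) <= `|s - t| * c by rewrite ler_wpM2l// lerDl.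
  have -> : complex.Re (f (p s)) - complex.Re (f (p t)) = complex.Re (f (p s) - f (p t)).
    by rewrite !ReImE.
  apply: (le_trans (normRe_le_cabs _)); have := H _ (Qp s s01).
  rewrite mul0r subr0 E => /(_ _)/le_trans; apply.
    by apply: (le_lt_trans le); rewrite -ltr_pdivlMr.
  apply: (@le_trans _ _ (e / c * (`|s - t| * c))).
    by rewrite ler_wpM2l// divr_ge0// ltW.
  by rewrite le_eqVlt; apply/orP; left; apply/eqP; field; rewrite gt_eqF.
rewrite /p mul1r mul0r addr0 addrC addrK in e0.
by apply: complex_ext => //; rewrite !fr.
Qed.

End IdentityTheorem.

(** * Hilbert spaces *)

Lemma posC (R : realType) (e : R[i]) : 0 < e -> e = (complex.Re e)%:C /\ 0 < complex.Re e.
Proof. by case: e => a b; rewrite ltcE /= => /andP[/eqP -> ?]. Qed.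

Section HilbertSpace.
Context {R : realType} {M : hilbertType R}.
Implicit Types (f g h : M) (c : R[i]).

(** The norm of [M] takes its values in [R[i]]; its real part makes it available to real
    arithmetic. *)
Definition nrm f : R := complex.Re `|f|.

Lemma nrmE f : `|f| = (nrm f)%:C.
Proof. by rewrite /nrm RRe_real// ger0_real. Qed.

Lemma nrm_ge0 f : 0 <= nrm f.
Proof. rewrite -lecR -nrmE; exact: normr_ge0. Qed.

Lemma nrm0 : nrm 0 = 0.
Proof. by rewrite /nrm normr0. Qed.

Lemma nrm_eq0 f : nrm f = 0 -> f = 0.
Proof. by move=> h; apply/eqP; rewrite -normr_eq0 nrmE h. Qed.

Lemma nrm_gt0 f : (0 < nrm f) = (f != 0).
Proof.
rewrite lt_def nrm_ge0 andbT; congr negb; apply/eqP/eqP => [/nrm_eq0//|->].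
exact: nrm0.
Qed.

Lemma nrmZ c f : nrm (c *: f) = cabs c * nrm f.
Proof. by apply: complexI; rewrite rmorphM/= -!nrmE normrZ. Qed.

Lemma nrmN f : nrm (- f) = nrm f.
Proof. by rewrite /nrm normrN. Qed.

Lemma nrmD f g : nrm (f + g) <= nrm f + nrm g.
Proof. by rewrite -lecR rmorphD/= -!nrmE ler_normD. Qed.

Lemma nrmB f g : nrm (f - g) <= nrm f + nrm g.
Proof. by rewrite -(nrmN g) nrmD. Qed.

Lemma nrm_distC f g : nrm (f - g) = nrm (g - f).
Proof. by rewrite -nrmN opprB. Qed.

Lemma innerC f g : inner g f = (inner f g)^*%C.
Proof. by rewrite hermC expr0 mul1r. Qed.

Lemma innerDl f g h : inner (f + g) h = inner f h + inner g h.
Proof. exact: linearDl. Qed.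

Lemma innerZl c f h : inner (c *: f) h = c * inner f h.
Proof. by rewrite linearZl_LR. Qed.

Lemma innerDr f g h : inner h (f + g) = inner h f + inner h g.
Proof. by rewrite linearDr. Qed.

Lemma innerZr c f h : inner h (c *: f) = c^*%C * inner h f.
Proof. by rewrite linearZr_LR. Qed.

Lemma innerNl f h : inner (- f) h = - inner f h.
Proof. by rewrite -scaleN1r innerZl mulN1r. Qed.

Lemma innerNr f h : inner h (- f) = - inner h f.
Proof. by rewrite innerC innerNl rmorphN/= -innerC. Qed.

Lemma inner0l h : inner 0 h = 0.
Proof. by rewrite -(scale0r (0 : M)) innerZl mul0r. Qed.

Lemma inner0r h : inner h 0 = 0.
Proof. by rewrite innerC inner0l rmorph0. Qed.

Definition innerE := (innerDl, innerDr, innerNl, innerNr, innerZl, innerZr).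

Lemma inner_nrm f : inner f f = (nrm f ^+ 2)%:C.
Proof. by rewrite inner_norm nrmE rmorphXn. Qed.

Lemma Re_innerC f g : complex.Re (inner g f) = complex.Re (inner f g).
Proof. by rewrite innerC; case: (inner f g). Qed.

Lemma sqr_nrmB f g : nrm (f - g) ^+ 2 = nrm f ^+ 2 + nrm g ^+ 2 - 2 * complex.Re (inner f g).
Proof.
have := congr1 (@complex.Re R) (inner_nrm (f - g)).
rewrite /= !innerE !ReImE opprK !inner_nrm /= (Re_innerC f g) => <-; ring.
Qed.

Lemma sqr_nrmD f g : nrm (f + g) ^+ 2 = nrm f ^+ 2 + nrm g ^+ 2 + 2 * complex.Re (inner f g).
Proof. by rewrite -[g]opprK sqr_nrmB nrmN innerNr ReImE opprK; ring. Qed.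

(* [(inner f g / nrm g ^+ 2) *: g] is the projection of [f] on the line of [g]. *)
Lemma sqr_nrm_reject f g : g != 0 ->
  nrm (f - ((nrm g ^- 2)%:C * inner f g) *: g) ^+ 2 =
  nrm f ^+ 2 - cabs (inner f g) ^+ 2 / nrm g ^+ 2.
Proof.
move=> g0; have n0 : nrm g != 0 by rewrite gt_eqF// nrm_gt0.
rewrite sqr_nrmB nrmZ innerZr cabsM cabs_real ger0_norm ?invr_ge0 ?sqr_ge0//.
have -> : ((nrm g ^- 2)%:C * inner f g)^*%C * inner f g =
    (nrm g ^- 2 * cabs (inner f g) ^+ 2)%:C.
  by rewrite conjcM conjc_real -mulrA [_^*%C * _]mulrC mulr_conj -rmorphM.
by rewrite /=; field.
Qed.

Lemma cauchy_schwarz f g : cabs (inner f g) <= nrm f * nrm g.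
Proof.
have [->|g0] := eqVneq g 0; first by rewrite inner0r cabs0 nrm0 mulr0.
have gp : 0 < nrm g by rewrite nrm_gt0.
have := sqr_ge0 (nrm (f - ((nrm g ^- 2)%:C * inner f g) *: g)).
rewrite sqr_nrm_reject// subr_ge0 ler_pdivrMr ?exprn_gt0// -exprMn.
by rewrite ler_pXn2r ?nnegrE ?cabs_ge0 ?mulr_ge0 ?nrm_ge0.
Qed.

Lemma Re_inner_le f g : complex.Re (inner f g) <= nrm f * nrm g.
Proof. exact: le_trans (Re_le_cabs _) (cauchy_schwarz f g). Qed.

Definition nlim (u : nat -> M) l := forall e : R, 0 < e ->
  exists N, forall n, (N <= n)%N -> nrm (u n - l) < e.

Lemma nrm_complete (u : nat -> M) :
  (forall e : R, 0 < e -> exists N, forall m n, (N <= m)%N -> (N <= n)%N ->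
     nrm (u m - u n) < e) -> exists l, nlim u l.
Proof.
move=> H; have : cvgn u.
  apply/cauchy_cvgP/cauchy_ballP => e /posC[-> e0]; near_simpl.
  have [N HN] := H _ e0.
  exists ([set n | N <= n], [set n | N <= n])%N; first by split; exists N.
  by move=> [m n] [/= Nm Nn]; rewrite -ball_normE /= nrmE ltcR; exact: HN.
move=> /cvg_ex[l /cvgrPdist_lt ul]; exists l => e e0.
have [|N _ HN] := ul e%:C; first by rewrite ltcR.
by exists N => n /HN /=; rewrite nrmE ltcR nrm_distC.
Qed.

Lemma nlim_unique (u : nat -> M) l l' : nlim u l -> nlim u l' -> l = l'.
Proof.
move=> h h'; apply/eqP; rewrite -subr_eq0; apply/eqP/nrm_eq0/eqP.
rewrite eq_le nrm_ge0 andbT leNgt; apply/negP => p0.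
have p2 : 0 < nrm (l - l') / 2 by rewrite divr_gt0.
have [N HN] := h _ p2; have [N' HN'] := h' _ p2.
have := HN (maxn N N') (leq_maxl _ _); have := HN' (maxn N N') (leq_maxr _ _).
set v := u _; have := nrmB (v - l') (v - l).
rewrite (_ : v - l' - (v - l) = l - l'); last by rewrite opprB addrC addrA subrK.
lra.
Qed.

Definition subspace (V : set M) := V 0 /\ forall c f g, V f -> V g -> V (c *: f + g).

Definition nclosed (V : set M) := forall u l, (forall n, V (u n)) -> nlim u l -> V l.

(** The vector is [x - l] with [l] a point of [V] nearest to [x]; the parallelogram law makes a
    minimising sequence Cauchy. *)
Lemma orthogonal_vector (V : set M) (x : M) : subspace V -> nclosed V -> ~ V x ->
  exists2 h, h != 0 & forall v, V v -> inner h v = 0.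
Proof.
move=> [V0 VD] cV nVx.
have VB f g : V f -> V g -> V (f - g).
  by move=> Vf Vg; rewrite addrC -scaleN1r; exact: VD.
pose A : set R := [set nrm (x - v) ^+ 2 | v in V].
have hA : has_inf A.
  split; first by exists (nrm (x - 0) ^+ 2), 0.
  by exists 0 => _ [v _ <-]; exact: sqr_ge0.
pose d := inf A.
have dle v : V v -> d <= nrm (x - v) ^+ 2.
  by move=> Vv; apply: ge_inf; [case: hA|exists v].
have near (n : nat) : exists v, V v /\ nrm (x - v) ^+ 2 < d + n.+1%:R^-1.
  have n0 : 0 < n.+1%:R^-1 :> R by rewrite invr_gt0 ltr0n.
  have [_ [v Vv <-] h] := inf_adherent n0 hA.
  by exists v.
have [v vP] := boolp.choice near.
have half (m n : nat) : nrm (v m - v n) ^+ 2 <= 2 * (m.+1%:R^-1 + n.+1%:R^-1).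
  have [Vm hm] := vP m; have [Vn hn] := vP n.
  pose w := 2^-1 *: (v m) + 2^-1 *: (v n).
  have Vw : V w by apply: (VD) => //; rewrite -[_ *: _]addr0; exact: VD.
  have dw := dle w Vw.
  have e1 : (x - v n) - (x - v m) = v m - v n.
    by rewrite opprB addrC addrA subrK addrC.
  have e2 : (x - v n) + (x - v m) = 2 *: (x - w).
    rewrite /w scalerBr scalerDr !scalerA divff ?pnatr_eq0// !scale1r.
    by rewrite (_ : 2 = 1 + 1)// scalerDl scale1r addrACA -opprD [v n + _]addrC.
  have h1 := sqr_nrmB (x - v n) (x - v m).
  have h2 := sqr_nrmD (x - v n) (x - v m).
  rewrite e1 in h1; rewrite e2 nrmZ in h2.
  have c2 : cabs (2 : R[i]) = 2.
    rewrite (_ : (2 : R[i]) = (2 : R)%:C); first by rewrite cabs_real ger0_norm.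
    by rewrite rmorph_nat.
  rewrite c2 exprMn in h2.
  move: h1 h2 hm hn dw; move: (m.+1%:R^-1) (n.+1%:R^-1) => a b.
  rewrite (expr2 2); clear; move: (complex.Re _) (nrm _ ^+ 2) (nrm _ ^+ 2) (nrm _ ^+ 2) (nrm _ ^+ 2).
  by move=> *; lra.
have [l vl] : exists l, nlim v l.
  apply: nrm_complete => e e0; have e2 : 0 < e ^+ 2 / 8 by rewrite divr_gt0 ?exprn_gt0.
  have [N _ HN] := near_infty_natSinv_lt (PosNum e2).
  exists N => m n Nm Nn; have := half m n.
  have := HN m Nm; have := HN n Nn; rewrite /= => h1 h2 h3.
  rewrite -(ltr_pXn2r (n := 2)) ?nnegrE ?nrm_ge0 ?(ltW e0)//.
  move: h1 h2 h3 (exprn_gt0 2 e0); clear.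
  by move: (m.+1%:R^-1) (n.+1%:R^-1) => a b; lra.
have Vl : V l by apply: cV vl => n; case: (vP n).
have ld : nrm (x - l) ^+ 2 <= d.
  rewrite leNgt; apply/negP => dl.
  pose s := Num.sqrt d; have d0 : 0 <= d by apply: lb_le_inf => [|_ [v' _ <-]]; [case: hA|exact: sqr_ge0].
  have sE : s ^+ 2 = d by rewrite sqr_sqrtr.
  have s0 : 0 <= s by exact: sqrtr_ge0.
  have sl : s < nrm (x - l) by rewrite -(ltr_pXn2r (n := 2)) ?nnegrE ?nrm_ge0 ?sE.
  pose e := (nrm (x - l) - s) / 2; have e0 : 0 < e by rewrite divr_gt0// subr_gt0.
  have e2 : 0 < e ^+ 2 by rewrite exprn_gt0.
  have [N HN] := vl _ e0; have [N' _ HN'] := near_infty_natSinv_lt (PosNum e2).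
  have h1 := HN (maxn N N') (leq_maxl _ _); have h2 := HN' (maxn N N') (leq_maxr _ _).
  have [_ h3] := vP (maxn N N').
  have h4 : nrm (x - v (maxn N N')) < s + e.
    rewrite -(ltr_pXn2r (n := 2)) ?nnegrE ?nrm_ge0 ?addr_ge0 ?(ltW e0)//.
    have := mulr_ge0 s0 (ltW e0); rewrite /= in h2; rewrite sqrrD sE.
    by move: h2 h3; clear; move: (_.+1%:R^-1) => a; lra.
  have := nrmD (x - v (maxn N N')) (v (maxn N N') - l).
  by rewrite addrA subrK; move: h1 h4; rewrite /e; clear; lra.
exists (x - l).
  by apply/eqP => /eqP; rewrite subr_eq0 => /eqP xl; apply: nVx; rewrite xl.
move=> w Vw; have [->|w0] := eqVneq w 0; first exact: inner0r.
(* Moving from [l] by the projection of [x - l] on [w] lowers the squared distance by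
   [|(x - l, w)|^2 / |w|^2]; minimality makes this 0. *)
set t := (nrm w ^- 2)%:C * inner (x - l) w.
have := dle (t *: w + l) (VD _ _ _ Vw Vl).
rewrite (_ : x - (t *: w + l) = (x - l) - t *: w); last by rewrite opprD addrA addrAC.
rewrite sqr_nrm_reject// => h.
have wp : 0 < nrm w ^+ 2 by rewrite exprn_gt0// nrm_gt0.
have : cabs (inner (x - l) w) ^+ 2 / nrm w ^+ 2 <= 0 by move: h ld; clear; lra.
rewrite ler_pdivrMr// mul0r => h'.
apply/eqP; rewrite -cabs_eq0 -sqrf_eq0 eq_le h' sqr_ge0//.
Qed.

End HilbertSpace.

(** * Linear relations and their resolvents *)

Section Relations.
Context {R : realType} {M : hilbertType R}.
Implicit Types (f g h : M) (c mu : R[i]) (H K : set (M * M)).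

Lemma linear_relationZ H c p : linear_relation H -> H p -> H (c *: p).
Proof. by move=> [H0 HD] Hp; rewrite -[_ *: _]addr0; apply: HD. Qed.

Lemma linear_relationB H p q : linear_relation H -> H p -> H q -> H (p - q).
Proof. by move=> [H0 HD] Hp Hq; rewrite addrC -scaleN1r; exact: HD. Qed.

Lemma linear_relationD H p q : linear_relation H -> H p -> H q -> H (p + q).
Proof. by move=> [H0 HD] Hp Hq; rewrite -[p]scale1r; exact: HD. Qed.

Definition relation_closed H := forall (u : nat -> M * M) l, (forall n, H (u n)) ->
  nlim (fst \o u) l.1 -> nlim (snd \o u) l.2 -> H l.

(** The lower bound and the closedness of [H] make the range closed; a vector orthogonal to it is
    zero, so the range is everything. *)
Lemma relation_onto H (C : R) : 0 <= C -> linear_relation H -> relation_closed H ->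
  (forall p, H p -> nrm p.1 <= C * nrm p.2) ->
  (forall h, (forall p, H p -> inner h p.2 = 0) -> h = 0) ->
  forall g, exists f, H (f, g).
Proof.
move=> C0 lH cH HC H0 g; apply: contrapT => ng.
pose V : set M := [set p.2 | p in H].
have [|||h h0 hV] := @orthogonal_vector R M V g.
- split; first by exists 0 => //; case: lH.
  move=> c _ _ [p Hp <-] [q Hq <-]; exists (c *: p + q) => //.
  by case: lH => _; apply.
- move=> u l uV ul.
  have {}uV n : exists p, H p /\ p.2 = u n by have [p] := uV n; exists p.
  have [p pP] := boolp.choice uV.
  have [k pk] : exists k, nlim (fst \o p) k.
    apply: nrm_complete => e e0.
    have C1 : 0 < C + 1 by lra.
    have [|N HN] := ul (e / (2 * (C + 1))); first by rewrite divr_gt0// mulr_gt0.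
    exists N => m n Nm Nn.
    have [Hm Em] := pP m; have [Hn En] := pP n.
    have h1 := HC _ (linear_relationB lH Hm Hn).
    rewrite /= Em En in h1; apply: (le_lt_trans h1).
    have h2 : nrm (u m - u n) < e / (C + 1).
      rewrite (_ : u m - u n = (u m - l) - (u n - l)); last by rewrite opprB addrA subrK.
      apply: (le_lt_trans (nrmB _ _)); rewrite (_ : e / _ = e / (2 * (C + 1)) + e / (2 * (C + 1))).
        by apply: ltrD; exact: HN.
      by field; rewrite gt_eqF.
    have h3 : C * nrm (u m - u n) <= (C + 1) * nrm (u m - u n).
      by apply: ler_wpM2r; [exact: nrm_ge0|lra].
    apply: (le_lt_trans h3); rewrite (_ : e = (C + 1) * (e / (C + 1))); last first.
      by field; rewrite gt_eqF.
    by rewrite ltr_pM2l.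
  exists (k, l) => //; apply: (cH p) => //= [n|]; first by case: (pP n).
  by rewrite (_ : snd \o p = u)//; apply/funext => n /=; case: (pP n).
- by move=> [[f g'] Hp /= E]; apply: ng; exists f; rewrite -E.
- by move/eqP: h0; apply; apply: H0 => p Hp; apply: hV; exists p.
Qed.

Lemma bounded_operatorP (T : {linear M -> M}) :
  bounded_operator T <-> exists C : R, forall f, nrm (T f) <= C * nrm f.
Proof.
rewrite /bounded_operator linear_boundedP; split.
  move=> /pinfty_ex_gt0[r /posC[-> _] H]; exists (complex.Re r) => f.
  by have := H f; rewrite !nrmE -rmorphM lecR.
move=> [C HC]; exists C%:C; split; first by apply/complex_realP; exists C.
move=> r Cr f; rewrite !nrmE; apply: (@le_trans _ _ (C%:C * (nrm f)%:C)).
  by rewrite -rmorphM lecR.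
apply: ler_wpM2r; last exact: ltW.
by rewrite ler0c nrm_ge0.
Qed.

Lemma bounded_operator_ge0 (T : {linear M -> M}) : bounded_operator T ->
  exists2 C : R, 0 <= C & forall f, nrm (T f) <= C * nrm f.
Proof.
move=> /bounded_operatorP[C HC]; exists `|C| => // f.
apply: (le_trans (HC f)); apply: ler_wpM2r; first exact: nrm_ge0.
exact: ler_norm.
Qed.

Lemma operator_of_relation H : linear_relation H -> (forall g, exists f, H (f, g)) ->
  (forall f, H (f, 0) -> f = 0) ->
  exists T : {linear M -> M}, forall f g, H (f, g) <-> T g = f.
Proof.
move=> lH onto inj; have [T TP] := boolp.choice onto.
have uniq f f' g : H (f, g) -> H (f', g) -> f = f'.
  move=> h h'; apply/eqP; rewrite -subr_eq0; apply/eqP/inj.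
  by have : H (f - f', g - g) := linear_relationB lH h h'; rewrite subrr.
have Tlin : linear T.
  move=> c g g'; apply: (uniq _ _ (c *: g + g')); first exact: TP.
  by case: lH => _ /(_ c _ _ (TP g) (TP g')).
pose T' : {linear M -> M} := HB.pack T (GRing.isLinear.Build _ _ _ _ T Tlin).
exists T' => f g; split => [h|<-]; last exact: TP.
exact: uniq (TP g) h.
Qed.

Lemma is_resolventP H mu (T : {linear M -> M}) :
  is_resolvent H mu T <-> (forall g, H (T g, g - mu *: T g)) /\
    (forall p, H p -> T (p.2 + mu *: p.1) = p.1).
Proof.
split => [E|[h1 h2]].
  split => [g|p Hp].
    have : graph T (g, T g) by exists g.
    by rewrite E => -[_ [[f f'] Hp <-] /= [<- <-]]; rewrite addrK.
  have : inv_rel (shift_rel H mu) (p.2 + mu *: p.1, p.1).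
    by exists (p.1, p.2 + mu *: p.1) => //; exists p.
  by rewrite -E => -[f _ [<- <-]].
apply/seteqP; split => [_ [g _ <-]|_ [_ [p Hp <-] <-]] /=.
  exists (T g, g) => //; exists (T g, g - mu *: T g); first exact: h1.
  by rewrite /= subrK.
by exists (p.2 + mu *: p.1) => //; rewrite h2.
Qed.

Lemma scale_relP c H f g : c != 0 -> scale_rel c H (f, g) <-> H (f, c^-1 *: g).
Proof.
move=> c0; split => [[[a b] Hab [<- <-]]|h].
  by rewrite /= scalerA mulVf// scale1r.
by exists (f, c^-1 *: g) => //=; rewrite scalerA divff// scale1r.
Qed.

Lemma scale_relM a c H : scale_rel a (scale_rel c H) = scale_rel (a * c) H.
Proof.
apply/seteqP; split => [_ [_ [p Hp <-] <-]|_ [p Hp <-]] /=.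
  by exists p => //; rewrite scalerA.
by exists (p.1, c *: p.2); [exists p|rewrite /= scalerA].
Qed.

Lemma scale_rel1 H : scale_rel 1 H = H.
Proof.
apply/seteqP; split => [_ [[a b] Hp <-]|[a b] Hp] /=; first by rewrite scale1r.
by exists (a, b) => //=; rewrite scale1r.
Qed.

Lemma linear_scale_rel c H : linear_relation H -> linear_relation (scale_rel c H).
Proof.
move=> [H0 HD]; split; first by exists 0 => //=; rewrite scaler0.
move=> k _ _ [p Hp <-] [q Hq <-]; exists (k *: p + q); first exact: HD.
have E : c *: (k *: p.2 + q.2) = k *: (c *: p.2) + c *: q.2.
  by rewrite scalerDr !scalerA mulrC.
by rewrite /= E.
Qed.

Lemma adjoint_scale_rel c H : c != 0 ->
  adjoint (scale_rel c H) = scale_rel c^*%C (adjoint H).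
Proof.
move=> c0; have cc0 : c^*%C != 0 by rewrite conjc_eq0.
apply/seteqP; split => -[k k'] /=.
  move=> h; apply/scale_relP => // p Hp /=.
  have /= := h (p.1, c *: p.2) (ex_intro2 _ _ p Hp erefl).
  rewrite innerZl => E; rewrite innerZr.
  have -> : ((c^*%C)^-1)^*%C = c^-1 by rewrite conjc_inv conjcK.
  by rewrite -E mulrA mulVf// mul1r.
move=> /scale_relP -/(_ cc0) h _ [p Hp <-] /=.
have /= := h p Hp; rewrite innerZl innerZr => ->.
have -> : ((c^*%C)^-1)^*%C = c^-1 by rewrite conjc_inv conjcK.
by rewrite mulrA divff// mul1r.
Qed.

(** Coercivity bounds [X] from below, and a vector [h] orthogonal to the range satisfies
    [(X h, h) = 0], hence vanishes. This takes the place of Neumann series below. *)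
Lemma lax_milgram (X : {linear M -> M}) (C m : R) : 0 < m ->
  (forall g, nrm (X g) <= C * nrm g) ->
  (forall g, m * nrm g ^+ 2 <= complex.Re (inner (X g) g)) ->
  forall k, exists g, X g = k.
Proof.
move=> m0 XC Xm k.
have low g : nrm g <= m^-1 * nrm (X g).
  have [->|g0] := eqVneq g 0; first by rewrite nrm0 mulr_ge0 ?nrm_ge0// invr_ge0 ltW.
  have gp : 0 < nrm g by rewrite nrm_gt0.
  rewrite mulrC ler_pdivlMr// mulrC -(ler_pM2r gp) -mulrA -expr2.
  exact: le_trans (Xm g) (Re_inner_le _ _).
pose H : set (M * M) := [set p | X p.1 = p.2].
have [|||||f Hf] := @relation_onto H m^-1 _ _ _ _ _ k.
- by rewrite invr_ge0 ltW.
- split => [|c p q]; rewrite /H/=; first by rewrite linear0.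
  by rewrite linearP => -> ->.
- move=> u [l1 l2] uH /= u1 u2; apply: nlim_unique u2 => e e0.
  have C1 : 0 < `|C| + 1 by rewrite ltr_wpDl.
  have [|N HN] := u1 (e / (`|C| + 1)); first by rewrite divr_gt0.
  exists N => n /HN /= h; rewrite -(uH n) -linearB.
  apply: (le_lt_trans (XC _)).
  have h1 : C * nrm ((u n).1 - l1) <= (`|C| + 1) * nrm ((u n).1 - l1).
    by apply: ler_wpM2r; [exact: nrm_ge0|have := ler_norm C; lra].
  apply: (le_lt_trans h1); rewrite mulrC -ltr_pdivlMr//.
- by move=> p <-; exact: low.
- move=> h hH; have /= := hH (h, X h) erefl; have := Xm h.
  rewrite Re_innerC => + E; rewrite E /= => h0.
  apply: nrm_eq0; apply/eqP; rewrite -sqrf_eq0 eq_le sqr_ge0 andbT.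
  by rewrite -(pmulr_rle0 _ m0).
- by exists f.
Qed.

(** Given [{f, f'}] in an extension [K], surjectivity of [H + mu] provides an element of [H] with
    the same [f' + mu f]. The difference has the form [{h, - mu h}], and dissipativity of [K] forces
    [h = 0]. *)
Lemma maximal_dissipative_of_resolvent H mu (T : {linear M -> M}) :
  linear_relation H -> dissipative H -> 0 < complex.Im mu -> is_resolvent H mu T ->
  maximal dissipative H.
Proof.
move=> lH dH m0 /is_resolventP[h1 h2]; split=> // K lK dK HK.
apply/seteqP; split => // -[f f'] Kf.
have Hg := h1 (f' + mu *: f); set g := T _ in Hg.
have := linear_relationB lK Kf (HK _ Hg).
move=> /dK /=; rewrite !opprD !opprK => h.
have fg : f = g.
  apply/eqP; rewrite -subr_eq0; apply/eqP/nrm_eq0/eqP.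
  rewrite -sqrf_eq0 eq_le sqr_ge0 andbT -(pmulr_rle0 _ m0).
  move: h; rewrite (_ : f' + _ = - mu *: (f - g)).
    by rewrite innerZl inner_nrm !ReImE /= mulr0 add0r mulNr oppr_ge0.
  by rewrite addrA addrA subrr add0r scaleNr scalerBr opprB addrC.
by move: Hg; rewrite -fg addrK.
Qed.

Lemma maximal_accumulative_of_resolvent H mu (T : {linear M -> M}) :
  linear_relation H -> accumulative H -> complex.Im mu < 0 -> is_resolvent H mu T ->
  maximal accumulative H.
Proof.
move=> lH dH m0 /is_resolventP[h1 h2]; split=> // K lK dK HK.
apply/seteqP; split => // -[f f'] Kf.
have Hg := h1 (f' + mu *: f); set g := T _ in Hg.
have := linear_relationB lK Kf (HK _ Hg).
move=> /dK /=; rewrite !opprD !opprK => h.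
have fg : f = g.
  apply/eqP; rewrite -subr_eq0; apply/eqP/nrm_eq0/eqP.
  rewrite -sqrf_eq0 eq_le sqr_ge0 andbT -(nmulr_rge0 _ m0).
  move: h; rewrite (_ : f' + _ = - mu *: (f - g)).
    by rewrite innerZl inner_nrm !ReImE /= mulr0 add0r mulNr oppr_le0.
  by rewrite addrA addrA subrr add0r scaleNr scalerBr opprB addrC.
by move: Hg; rewrite -fg addrK.
Qed.

End Relations.

(** * Families generated by a nonnegative selfadjoint relation *)

Section Topology.
Context {R : realType}.

Lemma open_cabsP (V : set R[i]^o) :
  open V <-> forall z, V z -> exists2 d : R, 0 < d & forall w : R[i], cabs (w - z) < d -> V w.
Proof.
rewrite openE; split => [oV z /oV|H z /H[d d0 {}H]].
  move=> /nbhs_ballP[e /= /posC[-> e0] H]; exists (complex.Re e) => // w wz.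
  by apply: H; rewrite -ball_normE /= distrC normE ltcR.
apply/nbhs_ballP; exists d%:C; first by rewrite /= ltcR.
by move=> w; rewrite -ball_normE /= distrC normE ltcR; exact: H.
Qed.

Lemma near_dnbhs_cabsP (z : R[i]^o) (P : set R[i]) :
  (\forall w \near z^', P w) <->
  exists2 d : R, 0 < d & forall w : R[i], w != z -> cabs (w - z) < d -> P w.
Proof.
split.
  move=> /nbhs_ballP[e /= /posC[-> e0] H]; exists (complex.Re e) => // w wz wd.
  by apply: H => //; rewrite -ball_normE /= distrC normE ltcR.
move=> [d d0 H]; apply/nbhs_ballP; exists d%:C; first by rewrite /= ltcR.
by move=> w; rewrite -ball_normE /= distrC normE ltcR => wd wz; exact: H.
Qed.

Lemma off_RplusP (z : R[i]) :
  off_Rplus z <-> complex.Im z != 0 \/ complex.Re z < 0.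
Proof.
split.
  move=> h; case: eqVneq => [z0|_]; last by left.
  right; rewrite ltNge; apply/negP => x0; apply: h.
  by exists (complex.Re z) => //; apply: complex_ext.
by move=> h [x x0 xz]; move: h; rewrite -xz /= eqxx ltNge x0 => -[].
Qed.

End Topology.

Section ResolventOfSelfadjoint.
Context {R : realType} {M : hilbertType R}.
Implicit Types (f g h : M) (z w : R[i]) (B : set (M * M)).

Lemma selfadjoint_closed B : selfadjoint B -> relation_closed B.
Proof.
move=> [lB EB] u [l1 l2] uB /= u1 u2; rewrite EB => -[h h'] Bh /=.
apply/eqP; rewrite -subr_eq0 -cabs_eq0 eq_le cabs_ge0 andbT leNgt; apply/negP => p0.
pose k := nrm h + nrm h' + 1.
have k0 : 0 < k by rewrite ltr_wpDl// addr_ge0 ?nrm_ge0.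
have e0 : 0 < cabs (inner h' l1 - inner h l2) / (2 * k) by rewrite divr_gt0// mulr_gt0.
have [N HN] := u1 _ e0; have [N' HN'] := u2 _ e0.
have h1 := HN (maxn N N') (leq_maxl _ _); have h2 := HN' (maxn N N') (leq_maxr _ _).
set n := maxn N N' in h1 h2; rewrite /= in h1 h2.
have : B (u n) := uB n; rewrite EB => /(_ _ Bh) /= E.
have E2 : inner h' l1 - inner h l2 = inner h ((u n).2 - l2) - inner h' ((u n).1 - l1).
  by rewrite !innerE E; ring.
have := cabsB (inner h ((u n).2 - l2)) (inner h' ((u n).1 - l1)).
rewrite -E2; have := cauchy_schwarz h ((u n).2 - l2).
have := cauchy_schwarz h' ((u n).1 - l1).
set e := _ / _ in h1 h2 e0.
have E3 : cabs (inner h' l1 - inner h l2) = 2 * k * e by rewrite /e; field; rewrite gt_eqF.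
have a1 : nrm h * nrm ((u n).2 - l2) <= nrm h * e by apply: ler_wpM2l; [exact: nrm_ge0|exact: ltW].
have a2 : nrm h' * nrm ((u n).1 - l1) <= nrm h' * e by apply: ler_wpM2l; [exact: nrm_ge0|exact: ltW].
have a3 : 0 <= nrm h * e by rewrite mulr_ge0 ?nrm_ge0// ltW.
have a4 : 0 <= nrm h' * e by rewrite mulr_ge0 ?nrm_ge0// ltW.
rewrite E3; move: a1 a2 a3 a4 e0; rewrite /k; clear; lra.
Qed.

Lemma nonnegative_inner B p : nonnegative B -> B p ->
  inner p.2 p.1 = (complex.Re (inner p.2 p.1))%:C /\ 0 <= complex.Re (inner p.2 p.1).
Proof.
move=> nB /nB; case: (inner _ _) => a b; rewrite lecE /= => /andP[/eqP -> ?].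
by [].
Qed.

(** As [(f', f)] is a nonnegative real, the distance of [z] from the half-line bounds
    [(f' - z f, f)] away from 0; [d] is a simple minorant of that distance. *)
Lemma nonnegative_shift_bound B z : nonnegative B -> off_Rplus z ->
  exists2 d : R, 0 < d & forall p, B p -> d * nrm p.1 <= nrm (p.2 - z *: p.1).
Proof.
move=> nB /off_RplusP hz.
pose d := if complex.Im z == 0 then - complex.Re z else `|complex.Im z|.
exists d => [|p Bp].
  rewrite /d; have [z0|z0] := eqVneq (complex.Im z) 0; last by rewrite normr_gt0.
  by case: hz => [|zn]; [rewrite z0 eqxx|rewrite oppr_gt0].
have [->|p0] := eqVneq p.1 0; first by rewrite nrm0 mulr0 nrm_ge0.
have pp : 0 < nrm p.1 by rewrite nrm_gt0.
rewrite -(ler_pM2r pp) -mulrA -expr2.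
have [E n0] := nonnegative_inner nB Bp.
apply: le_trans (cauchy_schwarz _ _).
have -> : inner (p.2 - z *: p.1) p.1 = (complex.Re (inner p.2 p.1))%:C - z * (nrm p.1 ^+ 2)%:C.
  by rewrite !innerE inner_nrm -E.
rewrite /d; have [z0|z0] := eqVneq (complex.Im z) 0.
  apply: le_trans (Re_le_cabs _); rewrite !ReImE /= z0 mul0r subr0.
  by rewrite mulNr lerDr.
apply: le_trans (normIm_le_cabs _); rewrite !ReImE /= mulr0 !add0r normrN normrM.
by rewrite [`|nrm _ ^+ 2|]ger0_norm ?sqr_ge0.
Qed.

(** [T] is [(B - z)^-1], that is, the resolvent of [B] at [- z] in unfolded form. *)
Definition shifted_inverse B z (T : {linear M -> M}) : Prop :=
  (forall g, B (T g, g + z *: T g)) /\ (forall p, B p -> T (p.2 - z *: p.1) = p.1).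

(** A vector [h] orthogonal to the range of [B - z] yields a pair [{h, w h}] in the adjoint, with
    [w] the conjugate of [z]. The adjoint is [B], so the lower bound at [w] makes [h] vanish. *)
Lemma selfadjoint_shift_inverse B z : selfadjoint B -> nonnegative B -> off_Rplus z ->
  exists T, shifted_inverse B z T.
Proof.
move=> sB nB hz; have [d d0 dB] := nonnegative_shift_bound nB hz.
have [lB EB] := sB.
pose H : set (M * M) := [set p | B (p.1, p.2 + z *: p.1)].
have lH : linear_relation H.
  split; rewrite /H /=; first by rewrite scaler0 addr0; case: lB.
  move=> c p q Bp Bq; case: lB => _ /(_ c _ _ Bp Bq).
  have E : c *: p.2 + q.2 + z *: (c *: p.1 + q.1) =
      c *: (p.2 + z *: p.1) + (q.2 + z *: q.1).
    by rewrite !scalerDr !scalerA [z * c]mulrC addrACA.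
  move=> h; suff : B (c *: p.1 + q.1, c *: p.2 + q.2 + z *: (c *: p.1 + q.1)) by [].
  by rewrite E.
have low p : H p -> d * nrm p.1 <= nrm p.2.
  by move=> /dB /=; rewrite addrK.
have [||T HT] := @operator_of_relation R M H lH.
- apply: (@relation_onto R M H d^-1) => //.
  + by rewrite invr_ge0 ltW.
  + move=> u [l1 l2] uH /= u1 u2; rewrite /H /=.
    apply: (selfadjoint_closed sB (u := fun n => ((u n).1, (u n).2 + z *: (u n).1))) => //= e e0.
    have k0 : 0 < cabs z + 1 by rewrite ltr_wpDl ?cabs_ge0.
    have [|N HN] := u1 (e / (2 * (cabs z + 1))); first by rewrite divr_gt0// mulr_gt0.
    have [|N' HN'] := u2 (e / 2); first by rewrite divr_gt0.
    exists (maxn N N') => n; rewrite geq_max => /andP[/HN /= h1 /HN' /= h2].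
    rewrite (_ : _ - _ = ((u n).2 - l2) + z *: ((u n).1 - l1)); last first.
      by rewrite scalerBr opprD addrACA.
    apply: (le_lt_trans (nrmD _ _)); rewrite nrmZ.
    have h3 : cabs z * nrm ((u n).1 - l1) <= (cabs z + 1) * (e / (2 * (cabs z + 1))).
      by apply: ler_pM; rewrite ?cabs_ge0 ?nrm_ge0 ?(ltW h1)// lerDl.
    have h4 : (cabs z + 1) * (e / (2 * (cabs z + 1))) = e / 2 by field; rewrite gt_eqF.
    by move: h2 h3 h4; clear; lra.
  + by move=> p /low; rewrite mulrC -ler_pdivlMr// mulrC.
  + move=> h hH; have zz : off_Rplus z^*%C.
      by apply/off_RplusP; move/off_RplusP: hz; case: (z) => a b /=; rewrite oppr_eq0.
    have [d' d'0 dB'] := nonnegative_shift_bound nB zz.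
    have Bh : B (h, z^*%C *: h).
      rewrite EB => -[f f'] Bf /=; rewrite innerZr conjcK.
      have /= := hH (f, f' - z *: f); rewrite /H /= subrK => /(_ Bf).
      rewrite !innerE => /eqP; rewrite subr_eq0 => /eqP E.
      by rewrite innerC E conjcM conjcK -innerC.
    have := dB' _ Bh; rewrite /= subrr nrm0 pmulr_rle0// => h0.
    by apply: nrm_eq0; apply/eqP; rewrite eq_le h0 nrm_ge0.
- move=> f /low /=; rewrite nrm0 pmulr_rle0// => h0.
  by apply: nrm_eq0; apply/eqP; rewrite eq_le h0 nrm_ge0.
exists T; split => [g|[f f'] Bf]; first by have /HT : T g = T g by [].
by apply/HT; rewrite /H /= subrK.
Qed.

End ResolventOfSelfadjoint.

Section ScaledSelfadjoint.
Context {R : realType} {M : hilbertType R}.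
Implicit Types (f g h : M) (z w mu : R[i]) (B : set (M * M)).

(** Testing against all vectors moves identities between vectors into [R[i]], where [ring] and
    [field] apply; most uses below have this purpose. *)
Lemma inner_ext (x y : M) : (forall h, inner x h = inner y h) -> x = y.
Proof.
move=> H; apply/eqP; rewrite -subr_eq0; apply/eqP/nrm_eq0/eqP.
rewrite -sqrf_eq0; have := inner_nrm (x - y).
by rewrite innerDl innerNl H subrr => /(congr1 (@complex.Re R)) /= <-.
Qed.

Lemma shifted_inverse_identity B z w (T S : {linear M -> M}) :
  shifted_inverse B z T -> shifted_inverse B w S ->
  forall f, S f = T f + (w - z) *: S (T f).
Proof.
move=> [T1 _] [_ S2] f; have /= := S2 _ (T1 f).
rewrite linearB linearD !linearZ /= => E.
by apply: inner_ext => h; rewrite -[X in _ = inner (X + _) _]E !innerE; ring.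
Qed.

(** [- z T z] is the resolvent of [- z^-1 B] at [mu], because [- z^-1 B + mu = - z^-1 (B - mu z)].
    The resolvent identity shows its derivative to be [- T z - mu z (T z)^2], with a remainder of
    first order in [w - z]. *)
Lemma holomorphic_shifted_inverse B mu (V : set R[i]^o) (T : R[i] -> {linear M -> M}) :
  nonnegative B -> open V -> (forall z, V z -> off_Rplus (mu * z)) ->
  (forall z, V z -> shifted_inverse B (mu * z) (T z)) ->
  holomorphic_on V (fun z => - z \*: T z).
Proof.
move=> nB /open_cabsP oV Vmu TV.
have Tbound z (d : R) : V z -> 0 < d ->
    (forall p, B p -> d * nrm p.1 <= nrm (p.2 - (mu * z) *: p.1)) ->
    forall f, nrm (T z f) <= d^-1 * nrm f.
  move=> Vz d0 H f; have [T1 _] := TV z Vz; have /= := H _ (T1 f).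
  by rewrite addrK mulrC -ler_pdivlMr// mulrC.
split=> z Vz; have [d d0 dB] := nonnegative_shift_bound nB (Vmu z Vz).
  apply/bounded_operatorP; exists (cabs z * d^-1) => f /=.
  by rewrite nrmZ cabsN -mulrA ler_wpM2l ?cabs_ge0//; exact: Tbound.
exists ((- 1 \*: T z) \+ (- (mu * z) \*: (T z \o T z))).
  apply/bounded_operatorP; exists (d^-1 + cabs (mu * z) * (d^-1 * d^-1)) => f /=.
  apply: (le_trans (nrmD _ _)); rewrite !nrmZ !cabsN mulrDl; apply: lerD.
    by rewrite (_ : cabs 1 = 1) ?mul1r; [exact: Tbound|rewrite -[1]/((1:R)%:C) cabs_real normr1].
  rewrite -!mulrA ler_wpM2l ?cabs_ge0//; apply: (le_trans (Tbound _ _ Vz d0 dB _)).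
  by rewrite ler_wpM2l ?invr_ge0 ?(ltW d0)//; exact: Tbound.
move=> eps /posC[-> e0]; apply/near_dnbhs_cabsP.
have [r r0 rV] := oV z Vz.
(* [L] bounds [T z] and also every [T w] with [|mu| |w - z| <= d / 2], since the change of shift
   costs at most half of the lower bound [d]. *)
pose L := 2 / d; have L0 : 0 < L by rewrite divr_gt0.
pose k := cabs mu * (L ^+ 2 + cabs (mu * z) * L ^+ 3) + 1.
have k0 : 0 < k.
  rewrite ltr_wpDl// mulr_ge0 ?cabs_ge0// addr_ge0 ?exprn_ge0 ?(ltW L0)//.
  by rewrite mulr_ge0 ?cabs_ge0 ?exprn_ge0 ?(ltW L0).
have mu0 : 0 < cabs mu + 1 by rewrite ltr_wpDl ?cabs_ge0.
exists (Num.min r (Num.min (d / (2 * (cabs mu + 1))) (complex.Re eps / k))).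
  by rewrite !lt_min r0 !divr_gt0// mulr_gt0.
move=> w wz; rewrite !lt_min => /andP[w1 /andP[w2 w3]] f.
have Vw := rV w w1.
have dwB p : B p -> d / 2 * nrm p.1 <= nrm (p.2 - (mu * w) *: p.1).
  move=> /dB h; have := nrmB (p.2 - (mu * w) *: p.1) ((mu * (z - w)) *: p.1).
  rewrite (_ : _ - _ = p.2 - (mu * z) *: p.1); last first.
    by rewrite mulrBr scalerBl opprB addrA subrK.
  rewrite nrmZ cabsM cabs_distC => h2.
  have h3 : cabs mu * cabs (w - z) <= d / 2.
    have -> : d / 2 = (cabs mu + 1) * (d / (2 * (cabs mu + 1))) by field; rewrite gt_eqF.
    by apply: ler_pM; rewrite ?cabs_ge0 ?(ltW w2)// lerDl.
  have h4 := ler_wpM2r (nrm_ge0 p.1) h3.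
  by move: h h2 h4; clear; lra.
have Tz g : nrm (T z g) <= L * nrm g.
  apply: (le_trans (Tbound _ _ Vz d0 dB g)); apply: ler_wpM2r; first exact: nrm_ge0.
  by rewrite /L ler_peMl ?invr_ge0 ?(ltW d0)// ler1n.
have Tw g : nrm (T w g) <= L * nrm g.
  by have := Tbound _ _ Vw (divr_gt0 d0 (ltr0n _ 2)) dwB g; rewrite invf_div.
have id := shifted_inverse_identity (TV z Vz) (TV w Vw).
rewrite -mulrBr in id.
have wz0 : w - z != 0 by rewrite subr_eq0.
have E : (w - z)^-1 *: ((- w \*: T w) f - (- z \*: T z) f) -
    ((- 1 \*: T z) \+ (- (mu * z) \*: (T z \o T z))) f =
    - (mu * (w - z)) *: (T w (T z f) + (mu * z) *: T w (T z (T z f))).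
  rewrite /= (id f); set c := T w (T z (T z f)).
  have -> : T z (T z f) = T w (T z f) - (mu * (w - z)) *: c.
    by rewrite (id (T z f)) addrK.
  apply: inner_ext => h; by rewrite !innerE; field.
rewrite E !nrmE -rmorphM lecR nrmZ cabsN cabsM.
have Tww : nrm (T w (T z f)) <= L ^+ 2 * nrm f.
  apply: (le_trans (Tw _)); rewrite expr2 -mulrA; apply: ler_wpM2l => //; exact: ltW.
have Twww : nrm (T w (T z (T z f))) <= L ^+ 3 * nrm f.
  apply: (le_trans (Tw _)); rewrite exprS -mulrA; apply: ler_wpM2l; first exact: ltW.
  apply: (le_trans (Tz _)); rewrite expr2 -mulrA; apply: ler_wpM2l => //; exact: ltW.
have h1 : nrm (T w (T z f) + (mu * z) *: T w (T z (T z f))) <=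
    (L ^+ 2 + cabs (mu * z) * L ^+ 3) * nrm f.
  apply: (le_trans (nrmD _ _)); rewrite nrmZ mulrDl; apply: lerD => //.
  by rewrite -mulrA ler_wpM2l ?cabs_ge0.
have h2 : cabs mu * cabs (w - z) * nrm (T w (T z f) + (mu * z) *: T w (T z (T z f))) <=
    cabs mu * cabs (w - z) * ((L ^+ 2 + cabs (mu * z) * L ^+ 3) * nrm f).
  by rewrite ler_wpM2l ?mulr_ge0 ?cabs_ge0.
apply: (le_trans h2).
rewrite (_ : _ * _ * _ = cabs (w - z) * (k - 1) * nrm f); last by rewrite /k; ring.
apply: ler_wpM2r; first exact: nrm_ge0.
apply: (@le_trans _ _ (cabs (w - z) * k)).
  by rewrite ler_wpM2l ?cabs_ge0// lerBlDr lerDl.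
by rewrite -ler_pdivlMr// ltW.
Qed.

End ScaledSelfadjoint.

Section StieltjesConverse.
Context {R : realType} {M : hilbertType R}.
Implicit Types (f g h : M) (z w mu : R[i]) (B : set (M * M)).

Lemma off_Rplus_neq0 z : off_Rplus z -> z != 0.
Proof.
by move=> /off_RplusP h; apply/eqP => z0; move: h; rewrite z0 /= eqxx ltxx => -[].
Qed.

Lemma upper_off_Rplus z : upper_half_plane z -> off_Rplus z.
Proof. by move=> h; apply/off_RplusP; left; rewrite gt_eqF. Qed.

Lemma lower_off_Rplus z : lower_half_plane z -> off_Rplus z.
Proof. by move=> h; apply/off_RplusP; left; rewrite lt_eqF. Qed.

Lemma negative_off_Rplus (x : R) : x < 0 -> off_Rplus x%:C.
Proof. by move=> h; apply/off_RplusP; right. Qed.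

Lemma open_mul_off_Rplus mu : open [set z : R[i]^o | off_Rplus (mu * z)].
Proof.
have muc : 0 < cabs mu + 1 by rewrite ltr_wpDl ?cabs_ge0.
apply/open_cabsP => z /off_RplusP hz.
have [d d0 Hd] : exists2 d : R, 0 < d & forall w, cabs (w - mu * z) < d -> off_Rplus w.
  case: hz => [z0|z0].
    exists `|complex.Im (mu * z)|; first by rewrite normr_gt0.
    move=> w h; apply/off_RplusP; left; apply/eqP => w0.
    have := normIm_le_cabs (w - mu * z); rewrite !ImD !ImN w0 add0r normrN.
    by move: h; clear; lra.
  exists (- complex.Re (mu * z)); first by rewrite oppr_gt0.
  move=> w h; apply/off_RplusP; right.
  have := Re_le_cabs (w - mu * z); rewrite ReD ReN.
  by move: h; clear; lra.
exists (d / (cabs mu + 1)) => [|w wz]; first by rewrite divr_gt0.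
apply: Hd; rewrite -mulrBr cabsM.
have := cabs_ge0 (w - z); move: wz; rewrite ltr_pdivlMr//; lra.
Qed.

Lemma resolvent_scaled_selfadjoint B mu : selfadjoint B -> nonnegative B ->
  exists2 G : R[i]^o -> {linear M -> M},
    holomorphic_on [set z | off_Rplus (mu * z)] G &
    forall z, off_Rplus (mu * z) -> is_resolvent (scale_rel (- z^-1) B) mu (G z).
Proof.
move=> sB nB.
have [T TP] : {T : R[i] -> {linear M -> M} &
    forall z, off_Rplus (mu * z) -> shifted_inverse B (mu * z) (T z)}.
  apply: (boolp.choice (P := fun z T => off_Rplus (mu * z) -> shifted_inverse B (mu * z) T)).
  move=> z; have [hz|nz] := pselect (off_Rplus (mu * z)).
    by have [T HT] := selfadjoint_shift_inverse sB nB hz; exists T.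
  by exists (idfun : {linear M -> M}).
exists (fun z => - z \*: T z).
  exact: (holomorphic_shifted_inverse nB (@open_mul_off_Rplus mu) (fun=> id) TP).
move=> z hz; have z0 : z != 0.
  by have := off_Rplus_neq0 hz; rewrite mulf_eq0 negb_or => /andP[].
have [T1 T2] := TP z hz; apply/is_resolventP; split => [g|_ [[f f'] Bp <-]] /=.
  apply/scale_relP; first by rewrite oppr_eq0 invr_eq0.
  have -> : (- z^-1)^-1 *: (g - mu *: (- z *: T z g)) = - z *: (g + (mu * z) *: T z g).
    by rewrite invrN invrK; apply: inner_ext => k; rewrite !innerE; ring.
  exact: (linear_relationZ (- z) sB.1 (T1 g)).
pose x := f' - (mu * z) *: f; have Ex : T z x = f := T2 _ Bp.
have -> : - z^-1 *: f' + mu *: f = - z^-1 *: x.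
  by apply: inner_ext => k; rewrite !innerE; field.
have -> : T z (- z^-1 *: x) = - z^-1 *: T z x by rewrite linearZ.
by rewrite Ex scalerA mulrNN divff// scale1r.
Qed.

Lemma holomorphic_on_sub (U V : set R[i]^o) (G : R[i]^o -> {linear M -> M}) :
  U `<=` V -> holomorphic_on V G -> holomorphic_on U G.
Proof. by move=> UV [h1 h2]; split => z /UV; [exact: h1|exact: h2]. Qed.

Lemma stieltjes_inner_of_selfadjoint B (Q : R[i] -> set (M * M)) :
  selfadjoint B -> nonnegative B ->
  (forall z, off_Rplus z -> Q z = scale_rel (- z^-1) B) ->
  stieltjes Q /\ inner_family Q.
Proof.
move=> sB nB QB; have [lB EB] := sB.
have Ez p z : B p -> off_Rplus z -> exists2 n : R, 0 <= n &
    inner (- z^-1 *: p.2) p.1 = (- (z^-1)) * n%:C.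
  move=> Bp hz; have [E n0] := nonnegative_inner nB Bp.
  by exists (complex.Re (inner p.2 p.1)) => //; rewrite innerZl -E.
have im z n : complex.Im (- z^-1 * n%:C) = complex.Im z / cabs z ^+ 2 * n.
  by rewrite !ReImE ImV /= mulr0 add0r opprK.
(* For [mu = i] the condition that [mu z] avoid the half-line cuts the plane along the negative
   imaginary half-axis. What is left contains the upper half-plane and the negative axis, and serves
   as the open set of the continuation; [mu = - i] does the same for the lower half-plane. *)
have [Gu Hu Ru] := resolvent_scaled_selfadjoint ('i%C : R[i]) sB nB.
have [Gl Hl Rl] := resolvent_scaled_selfadjoint (- 'i%C : R[i]) sB nB.
have uV z : upper_half_plane z \/ negative_axis z -> off_Rplus ('i%C * z).
  move=> h; apply/off_RplusP; rewrite mulrC ReiNIm ImiRe.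
  case: h => [h|[x x0 <-]]; first by right; rewrite oppr_lt0.
  by left; rewrite /= lt_eqF.
have lV z : lower_half_plane z \/ negative_axis z -> off_Rplus (- 'i%C * z).
  move=> h; apply/off_RplusP; rewrite mulNr mulrC ReN ImN ReiNIm ImiRe opprK.
  case: h => [h|[x x0 <-]]; first by right.
  by left; rewrite /= oppr_eq0 lt_eqF.
have Iup : upper_half_plane ('i%C : R[i]^o) by rewrite /upper_half_plane /= ltr01.
have Ilow : lower_half_plane (- 'i%C : R[i]^o) by rewrite /lower_half_plane /= ltrN10.
split; last first.
  move=> y y0 p; rewrite QB; last by apply/off_RplusP; left.
  move=> [q Bq <-] /=; have [|n n0 ->] := Ez _ (y *i) Bq; first by apply/off_RplusP; left.
  by rewrite !ReImE ReV /= mul0r oppr0 mul0r mulr0 subr0.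
split.
- by move=> z hz; rewrite QB//; exact: linear_scale_rel.
- split.
  + split => z hz.
      have hoff := upper_off_Rplus hz; rewrite QB//.
      apply: (maximal_dissipative_of_resolvent (mu := 'i%C) (T := Gu z)) => //.
      * exact: linear_scale_rel.
      * move=> _ [p Bp <-] /=; have [n n0 ->] := Ez p z Bp hoff.
        by rewrite im mulr_ge0// divr_ge0 ?sqr_ge0// ltW.
      * by apply: Ru; apply: uV; left.
    have hoff := lower_off_Rplus hz; rewrite QB//.
    apply: (maximal_accumulative_of_resolvent (mu := - 'i%C) (T := Gl z)) => //.
    * exact: linear_scale_rel.
    * move=> _ [p Bp <-] /=; have [n n0 ->] := Ez p z Bp hoff.
      by rewrite im mulr_le0_ge0// pmulr_lle0 ?invr_gt0 ?exprn_gt0 ?cabs_gt0 ?off_Rplus_neq0// ltW.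
    * by apply: Rl; apply: lV; left.
  + move=> z z0.
    have h1 : off_Rplus z by apply/off_RplusP; left.
    have h2 : off_Rplus z^*%C by apply/off_RplusP; left; case: (z) z0 => a b /=; rewrite oppr_eq0.
    rewrite !QB// adjoint_scale_rel; last by rewrite oppr_eq0 invr_eq0 off_Rplus_neq0.
    by rewrite -EB conjcN conjc_inv.
  + split.
      exists 'i%C => //; exists Gu; first by apply: holomorphic_on_sub Hu => z hz; apply: uV; left.
      by move=> z hz; rewrite QB; [exact: Ru z (uV z (or_introl hz))|exact: upper_off_Rplus].
    exists (- 'i%C) => //; exists Gl; first by apply: holomorphic_on_sub Hl => z hz; apply: lV; left.
    by move=> z hz; rewrite QB; [exact: Rl z (lV z (or_introl hz))|exact: lower_off_Rplus].
- move=> x x0; rewrite QB; last exact: negative_off_Rplus.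
  move=> _ [p Bp <-] /=.
  rewrite innerZl mulr_ge0//; last exact: nB.
  by rewrite -fmorphV -rmorphN ler0c oppr_ge0 invr_le0 ltW.
- have neg z : negative_axis z -> off_Rplus z by move=> [x x0 <-]; exact: negative_off_Rplus.
  split.
    exists 'i%C => //; exists [set z | off_Rplus ('i%C * z)]; split.
    + exact: (@open_mul_off_Rplus _).
    + by move=> z hz; exact: uV.
    + exists Gu => // z hz; rewrite QB; first exact: Ru z (uV z hz).
      by case: hz => [/upper_off_Rplus|/neg].
  exists (- 'i%C) => //; exists [set z | off_Rplus (- 'i%C * z)]; split.
  + exact: (@open_mul_off_Rplus _).
  + by move=> z hz; exact: lV.
  + exists Gl => // z hz; rewrite QB; first exact: Rl z (lV z hz).
    by case: hz => [/lower_off_Rplus|/neg].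
Qed.

End StieltjesConverse.

(** * Resolvents of a family of relations *)

Section Resolvents.
Context {R : realType} {M : hilbertType R}.
Implicit Types (f g h k : M) (z w mu nu : R[i]) (H N : set (M * M)).

Lemma resolvent_unique N N' mu (T : {linear M -> M}) :
  is_resolvent N mu T -> is_resolvent N' mu T -> N = N'.
Proof.
have sub (K K' : set (M * M)) : is_resolvent K mu T -> is_resolvent K' mu T -> K `<=` K'.
  move=> /is_resolventP[_ h2] /is_resolventP[h1' _] [f f'] Kf.
  by have := h1' (f' + mu *: f); rewrite (h2 _ Kf) /= addrK.
by move=> h h'; apply/seteqP; split; apply: sub.
Qed.

Lemma resolvent_scale c N mu (T : {linear M -> M}) : c != 0 -> is_resolvent N mu T ->
  exists T' : {linear M -> M}, is_resolvent (scale_rel c N) (c * mu) T'.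
Proof.
move=> c0 /is_resolventP[h1 h2].
exists (c^-1 \*: T); apply/is_resolventP; split => [g|_ [[f f'] Nf <-]].
  apply/scale_relP => //=.
  have -> : c^-1 *: (g - (c * mu) *: (c^-1 *: T g)) = c^-1 *: g - mu *: (c^-1 *: T g).
    by apply: inner_ext => k; rewrite !innerE; field.
  have <- : T (c^-1 *: g) = c^-1 *: T g by rewrite linearZ.
  exact: h1.
rewrite /=; have Ef := h2 _ Nf.
have -> : c *: f' + (c * mu) *: f = c *: (f' + mu *: f) by rewrite scalerDr scalerA.
have -> : T (c *: (f' + mu *: f)) = c *: T (f' + mu *: f) by rewrite linearZ.
by rewrite Ef scalerA mulVf// scale1r.
Qed.

(** Derivative within [D] of an orbit such as [w |-> H w k]; this strong sense suffices for the
    scalar functions [inner (H w k) h]. *)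
Definition vderiv (D : set R[i]) (v : R[i] -> M) z l : Prop :=
  forall e : R, 0 < e -> exists2 d : R, 0 < d & forall w, D w -> cabs (w - z) < d ->
    nrm (v w - v z - (w - z) *: l) <= e * cabs (w - z).

Lemma cderiv_inner D (v : R[i] -> M) z l h :
  vderiv D v z l -> cderiv D (fun w => inner (v w) h) z (inner l h).
Proof.
move=> H e e0; have h0 : 0 < nrm h + 1 by rewrite ltr_wpDl ?nrm_ge0.
have [|d d0 {}H] := H (e / (nrm h + 1)); first by rewrite divr_gt0.
exists d => // w Dw wz; have := H w Dw wz.
have -> : inner (v w) h - inner (v z) h - inner l h * (w - z) =
  inner (v w - v z - (w - z) *: l) h by rewrite !innerE mulrC.
move=> hn; apply: (le_trans (cauchy_schwarz _ _)).
apply: (@le_trans _ _ ((e / (nrm h + 1) * cabs (w - z)) * (nrm h + 1))).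
  by apply: ler_pM; rewrite ?nrm_ge0// lerDl.
by rewrite le_eqVlt; apply/orP; left; apply/eqP; field; rewrite gt_eqF.
Qed.

Lemma vderiv_of_holomorphic (V : set R[i]^o) (G : R[i]^o -> {linear M -> M}) z :
  holomorphic_on V G -> V z -> exists l : M -> M, forall f, vderiv setT (fun w => G w f) z (l f).
Proof.
move=> [_ HG] Vz; have [D _ HD] := HG z Vz; exists D => f e e0.
have f0 : 0 < nrm f + 1 by rewrite ltr_wpDl ?nrm_ge0.
have e1 : 0 < (e / (nrm f + 1))%:C by rewrite ltcR divr_gt0.
have /near_dnbhs_cabsP[d d0 H] := HD _ e1.
exists d => // w _ wz; have [->|nwz] := eqVneq w z.
  by rewrite !subrr scale0r subr0 nrm0 mulr_ge0 ?cabs_ge0// ltW.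
have := H w nwz wz f; rewrite !nrmE -rmorphM lecR => h.
have wz0 : w - z != 0 by rewrite subr_eq0.
have -> : G w f - G z f - (w - z) *: D f = (w - z) *: ((w - z)^-1 *: (G w f - G z f) - D f).
  by rewrite scalerBr scalerA divff// scale1r.
rewrite nrmZ mulrC; apply: ler_wpM2r; first exact: cabs_ge0.
apply: (le_trans h); apply: (@le_trans _ _ (e / (nrm f + 1) * (nrm f + 1))).
  by rewrite ler_wpM2l ?lerDl// divr_ge0// ltW.
by rewrite divfK// gt_eqF.
Qed.

Section Family.
Variables (D : set R[i]) (Q : R[i] -> set (M * M)) (G H : R[i] -> {linear M -> M}).
Variables (mu0 mu : R[i]) (C : R).
Hypothesis C0 : 0 <= C.
Hypothesis Dn0 : forall z, D z -> z != 0.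
Hypothesis GQ : forall z, D z -> is_resolvent (Q z) mu0 (G z).
Hypothesis HQ : forall z, D z -> is_resolvent (scale_rel (- z) (Q z)) mu (H z).
Hypothesis HC : forall z, D z -> forall k, nrm (H z k) <= C * nrm k.
Hypothesis dG : forall z, D z -> exists l : M -> M, forall f, vderiv D (fun w => G w f) z (l f).

(** Put [f = H z k], so that [k = - z f' + mu f] with [{f, f'}] in [Q z], and [g = f' + mu0 f], so
    that [G z g = f]. The element of [Q w] over [G w g], fed into [H w], expresses the increment of
    [H] through that of [G], whose differentiability is known. *)
Let increment z k : D z -> exists g f', forall w, D w ->
  H w k - H z k = (G w g - G z g) + H w ((w - z) *: f' - (w * mu0 + mu) *: (G w g - G z g)).
Proof.
move=> Dz; have z0 : - z != 0 by rewrite oppr_eq0 Dn0.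
have /is_resolventP[H1 _] := HQ Dz.
have Qf := H1 k; move/scale_relP : Qf => /(_ z0) Qf.
set f := H z k in Qf *; pose f' := (- z)^-1 *: (k - mu *: f).
have /is_resolventP[_ G2] := GQ Dz; have Ef := G2 _ Qf; rewrite /= -/f' in Ef.
exists (f' + mu0 *: f), f' => w Dw; rewrite Ef.
have /is_resolventP[G1 _] := GQ Dw; have Qw := G1 (f' + mu0 *: f).
have /is_resolventP[_ H2] := HQ Dw.
set fw := G w _ in Qw *.
have /= := H2 (fw, - w *: (f' + mu0 *: f - mu0 *: fw)) (ex_intro2 _ _ _ Qw erefl).
have -> : - w *: (f' + mu0 *: f - mu0 *: fw) + mu *: fw =
  k - ((w - z) *: f' - (w * mu0 + mu) *: (fw - f)).
  have -> : k = - z *: f' + mu *: f by rewrite /f' scalerA divff// scale1r subrK.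
  by apply: inner_ext => h; rewrite !innerE; ring.
rewrite linearB => E; apply: inner_ext => h.
by have := congr1 (fun x => inner x h) E; rewrite !innerE => <-; ring.
Qed.

(** A first, cruder use of [increment]: it allows [H w u] to be replaced by [H z u] in the main term
    of the derivative. *)
Let lipschitz z u : D z -> exists2 K : R, 0 <= K & exists2 d : R, 0 < d &
  forall w, D w -> cabs (w - z) < d -> nrm (H w u - H z u) <= K * cabs (w - z).
Proof.
move=> Dz; have [g [f' inc]] := increment u Dz.
have [dg /(_ g) hl] := dG Dz; set l := dg g in hl.
pose A := (cabs z + 1) * cabs mu0 + cabs mu.
have A0 : 0 <= A by rewrite addr_ge0 ?mulr_ge0 ?addr_ge0 ?cabs_ge0.
have [d1 d10 rho] := hl 1 ltr01.
have l0 : 0 <= nrm l + 1 by rewrite addr_ge0 ?nrm_ge0.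
exists ((nrm l + 1) + C * (nrm f' + A * (nrm l + 1))).
  by rewrite addr_ge0// mulr_ge0// addr_ge0 ?nrm_ge0// mulr_ge0.
exists (Num.min d1 1); first by rewrite lt_min d10 ltr01.
move=> w Dw; rewrite lt_min => /andP[w1 w2]; rewrite inc//.
have c0 := cabs_ge0 (w - z).
set r := G w g - G z g.
have rb : nrm r <= (nrm l + 1) * cabs (w - z).
  have := nrmD (r - (w - z) *: l) ((w - z) *: l); rewrite subrK nrmZ.
  by have := rho w Dw w1; rewrite -/r; lra.
have b1 : cabs (w * mu0 + mu) <= A.
  apply: (le_trans (cabsD _ _)); rewrite cabsM lerD2r ler_wpM2r ?cabs_ge0//.
  by have := cabsD (w - z) z; rewrite subrK; move: w2; lra.
apply: (le_trans (nrmD _ _)); rewrite mulrDl; apply: lerD => //.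
apply: (le_trans (HC Dw _)); rewrite -mulrA ler_wpM2l//.
apply: (le_trans (nrmB _ _)); rewrite !nrmZ mulrDl; apply: lerD; first by rewrite mulrC.
by rewrite -mulrA; apply: ler_pM; rewrite ?cabs_ge0 ?nrm_ge0.
Qed.

Lemma resolvent_vderiv z k : D z -> exists l, vderiv D (fun w => H w k) z l.
Proof.
move=> Dz; have [g [f' inc]] := increment k Dz.
have [dg /(_ g) hl] := dG Dz; set l := dg g in hl.
(* When [G w g - G z g] is replaced by [(w - z) l], the increment formula becomes
   [(w - z) (l + H w u)] to first order. *)
pose u := f' - (z * mu0 + mu) *: l.
have [K K0 [d1 d10 lip]] := lipschitz u Dz.
exists (l + H z u) => e e0.
pose A := (cabs z + 1) * cabs mu0 + cabs mu.
have A0 : 0 <= A by rewrite addr_ge0 ?mulr_ge0 ?addr_ge0 ?cabs_ge0.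
have AC : 0 < 1 + A * C by rewrite ltr_pwDl// mulr_ge0.
have [|d2 d20 rho] := hl (e / (2 * (1 + A * C))); first by rewrite divr_gt0// mulr_gt0.
pose K' := K + cabs mu0 * (C * nrm l) + 1.
have K'0 : 0 < K'.
  by rewrite ltr_wpDl// addr_ge0// mulr_ge0 ?cabs_ge0// mulr_ge0 ?nrm_ge0.
exists (Num.min (Num.min d1 1) (Num.min d2 (e / (2 * K')))).
  by rewrite !lt_min d10 ltr01 d20 divr_gt0// mulr_gt0.
move=> w Dw; rewrite !lt_min => /andP[/andP[w1 w2] /andP[w3 w4]].
have c0 := cabs_ge0 (w - z).
have {}rho := rho w Dw w3; have {}lip := lip w Dw w1.
set r := G w g - G z g - (w - z) *: l in rho.
have E : H w k - H z k - (w - z) *: (l + H z u) =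
   (r + (w - z) *: (H w u - H z u)) - ((w - z) ^+ 2 *: (mu0 *: H w l) + (w * mu0 + mu) *: H w r).
  rewrite inc//.
  have -> : (w - z) *: f' - (w * mu0 + mu) *: (G w g - G z g) =
    (w - z) *: u - (w - z) ^+ 2 *: (mu0 *: l) - (w * mu0 + mu) *: r.
    by apply: inner_ext => h; rewrite /r /u !innerE; ring.
  have HwB a b c : H w (a - b - c) = H w a - H w b - H w c by rewrite !linearB.
  have HwZ c a : H w (c *: a) = c *: H w a by rewrite linearZ.
  rewrite HwB !HwZ.
  by apply: inner_ext => h; rewrite {1}/r !innerE; ring.
rewrite E; apply: (le_trans (nrmB _ _)).
have n1 := nrmD r ((w - z) *: (H w u - H z u)).
have n2 := nrmD ((w - z) ^+ 2 *: (mu0 *: H w l)) ((w * mu0 + mu) *: H w r).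
rewrite !nrmZ in n1 n2; rewrite cabsX in n2.
have b1 : cabs (w * mu0 + mu) <= A.
  apply: (le_trans (cabsD _ _)); rewrite cabsM lerD2r ler_wpM2r ?cabs_ge0//.
  by have := cabsD (w - z) z; rewrite subrK; move: w2; lra.
have b2 : cabs (w * mu0 + mu) * nrm (H w r) <= A * (C * nrm r).
  by apply: ler_pM; rewrite ?cabs_ge0 ?nrm_ge0//; exact: HC.
have b3 : cabs (w - z) * nrm (H w u - H z u) <= cabs (w - z) * (K * cabs (w - z)).
  by rewrite ler_wpM2l.
have b4 : cabs (w - z) ^+ 2 * (cabs mu0 * nrm (H w l)) <= cabs (w - z) ^+ 2 * (cabs mu0 * (C * nrm l)).
  by rewrite ler_wpM2l ?sqr_ge0// ler_wpM2l ?cabs_ge0//; exact: HC.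
have b5 : (1 + A * C) * nrm r <= e / 2 * cabs (w - z).
  have := ler_wpM2l (ltW AC) rho.
  by rewrite (_ : (1 + A * C) * (_ * _) = e / 2 * cabs (w - z))//; field; rewrite gt_eqF.
have b6 : cabs (w - z) * (K' * cabs (w - z)) <= e / 2 * cabs (w - z).
  rewrite mulrC; apply: ler_wpM2r => //.
  have -> : e / 2 = K' * (e / (2 * K')) by field; rewrite gt_eqF.
  by rewrite ler_pM2l// ltW.
have b7 : 0 <= cabs (w - z) ^+ 2 by exact: sqr_ge0.
move: n1 n2 b2 b3 b4 b5 b6 b7; rewrite /K'.
lra.
Qed.

End Family.

End Resolvents.

(** * Moving a resolvent from one point to another *)

Section ResolventExistence.
Context {R : realType} {M : hilbertType R}.
Implicit Types (f g h k : M) (z w mu nu : R[i]) (H N : set (M * M)).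

Lemma resolvent_exists H nu : linear_relation H ->
  (forall k, exists f, H (f, k - nu *: f)) -> (forall f, H (f, - nu *: f) -> f = 0) ->
  exists T : {linear M -> M}, is_resolvent H nu T.
Proof.
move=> lH onto inj.
pose K : set (M * M) := [set p | H (p.1, p.2 - nu *: p.1)].
have [|||T HT] := @operator_of_relation R M K.
- split; first by rewrite /K/= scaler0 subr0; case: lH.
  move=> c p q Hp Hq; case: lH => _ /(_ c _ _ Hp Hq) h.
  have E : c *: p.2 + q.2 - nu *: (c *: p.1 + q.1) =
      c *: (p.2 - nu *: p.1) + (q.2 - nu *: q.1).
    by rewrite scalerDr scalerBr !scalerA [nu * c]mulrC opprD addrACA.
  suff : H (c *: p.1 + q.1, c *: p.2 + q.2 - nu *: (c *: p.1 + q.1)) by [].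
  by rewrite E.
- by move=> k; have [f] := onto k; exists f.
- by move=> f; rewrite /K /= sub0r -scaleNr; exact: inj.
exists T; apply/is_resolventP; split=> [g|[f f'] Hf].
  by have /HT : T g = T g by [].
by apply/HT; rewrite /K /= addrK.
Qed.

(** With [g = f' + mu f] one has [f' + nu f = (1 + (nu - mu) T) g], and this perturbation of the
    identity has norm less than 1. *)
Lemma resolvent_shift N mu nu (T : {linear M -> M}) (C : R) : linear_relation N ->
  is_resolvent N mu T -> (forall k, nrm (T k) <= C * nrm k) -> cabs (nu - mu) * C < 1 ->
  exists T' : {linear M -> M}, is_resolvent N nu T'.
Proof.
move=> lN /is_resolventP[h1 h2] TC small.
pose q := cabs (nu - mu) * C; have q1 : 0 < 1 - q by rewrite subr_gt0.
have qT k : nrm ((nu - mu) *: T k) <= q * nrm k.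
  by rewrite nrmZ /q -mulrA ler_wpM2l ?cabs_ge0.
apply: resolvent_exists => // [k|f Nf].
  pose Z : {linear M -> M} := @idfun M \+ ((nu - mu) \*: T).
  have [||g Zg] := @lax_milgram R M Z (1 + q) (1 - q) q1 _ _ k.
  - by move=> g /=; apply: (le_trans (nrmD _ _)); rewrite mulrDl mul1r lerD2l.
  - move=> g /=; rewrite innerDl ReD inner_nrm /= mulrBl mul1r lerD2l.
    have := Re_inner_le (- ((nu - mu) *: T g)) g; rewrite innerNl ReN nrmN.
    have := ler_wpM2r (nrm_ge0 g) (qT g).
    by rewrite expr2 mulrA; lra.
  exists (T g); rewrite -Zg /=.
  have -> : g + (nu - mu) *: T g - nu *: T g = g - mu *: T g.
    by apply: inner_ext => h; rewrite !innerE; ring.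
  exact: h1.
have := h2 _ Nf; rewrite /= -scalerDl => E.
have : nrm f <= q * nrm f.
  rewrite -{1}E (_ : T _ = - ((nu - mu) *: T f)).
    by rewrite nrmN.
  by rewrite linearZ /= -scaleNr; congr (_ *: _); ring.
move=> h; apply: nrm_eq0; apply/eqP; rewrite eq_le nrm_ge0 andbT -(pmulr_rle0 _ q1).
by rewrite mulrBl mul1r; lra.
Qed.

(* The Cayley transform [W g = f' + mu^* f], where [g = f' + mu f], is a contraction,
   and [f' + nu f] is a multiple of [g - kappa W g] with [|kappa| < 1]. *)
Lemma resolvent_dissipative H mu nu (T : {linear M -> M}) : linear_relation H ->
  dissipative H -> is_resolvent H mu T -> 0 < complex.Im mu -> 0 < complex.Im nu ->
  exists T' : {linear M -> M}, is_resolvent H nu T'.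
Proof.
move=> lH dH /is_resolventP[h1 h2] b0 y0.
have nb0 : nu - mu^*%C != 0.
  apply/eqP => /(congr1 (@complex.Im R)).
  by case: (mu) (nu) b0 y0 => [a b] [x y] /=; rewrite opprK; lra.
have mb0 : mu - mu^*%C != 0.
  apply/eqP => /(congr1 (@complex.Im R)).
  by case: (mu) b0 => [a b] /=; rewrite opprK; lra.
pose kappa := (nu - mu) / (nu - mu^*%C).
have kappa1 : cabs kappa < 1.
  rewrite /kappa cabsM cabsV ltr_pdivrMr ?cabs_gt0// mul1r.
  rewrite -(ltr_pXn2r (n := 2)) ?nnegrE ?cabs_ge0// !sqr_cabs.
  case: (mu) (nu) b0 y0 => [a b] [x y] /= b0 y0; rewrite opprK.
  have : 0 < y * b by rewrite mulr_gt0.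
  by rewrite !sqrrD sqrrN; lra.
have Wle g : nrm (g - (mu - mu^*%C) *: T g) <= nrm g.
  rewrite -(ler_pXn2r (n := 2)) ?nnegrE ?nrm_ge0//.
  have := dH _ (h1 g); rewrite /=; set f := T g; set f' := g - mu *: f => hi.
  have -> : g - (mu - mu^*%C) *: f = f' + mu^*%C *: f.
    by rewrite /f' scalerBl opprB addrA addrAC.
  have -> : nrm g ^+ 2 = nrm (f' + mu *: f) ^+ 2 by rewrite /f' subrK.
  rewrite !sqr_nrmD !nrmZ cabs_conj lerD2l ler_pM2l// !innerZr conjcK !ReM.
  have hb : 0 <= complex.Im mu * complex.Im (inner f' f) by rewrite mulr_ge0// ltW.
  by case: (mu) hb => a b /=; lra.
apply: resolvent_exists => // [k|f Hf].
  pose Z : {linear M -> M} := @idfun M \- (kappa \*: (@idfun M \- ((mu - mu^*%C) \*: T))).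
  pose c := (mu - mu^*%C) / (nu - mu^*%C).
  have c0 : c != 0 by rewrite mulf_neq0// invr_neq0.
  have k1 : 0 < 1 - cabs kappa by rewrite subr_gt0.
  have [||g Zg] := @lax_milgram R M Z (1 + cabs kappa) (1 - cabs kappa) k1 _ _ (c *: k).
  - move=> g /=; apply: (le_trans (nrmB _ _)); rewrite mulrDl mul1r lerD2l nrmZ.
    by rewrite ler_wpM2l ?cabs_ge0.
  - move=> g /=; rewrite innerDl innerNl ReD ReN inner_nrm /= mulrBl mul1r lerD2l lerN2.
    apply: (le_trans (Re_inner_le _ _)); rewrite nrmZ expr2 mulrA.
    by apply: ler_wpM2r; [exact: nrm_ge0|rewrite ler_wpM2l ?cabs_ge0].
  exists (T g).
  have -> : k - nu *: T g = g - mu *: T g.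
    have -> : k = c^-1 *: Z g by rewrite Zg scalerA mulVf// scale1r.
    apply: inner_ext => h; rewrite /= !innerE /c /kappa; field.
    by rewrite nb0 mb0.
  exact: h1.
apply: nrm_eq0; apply/eqP; rewrite -sqrf_eq0 eq_le sqr_ge0 andbT.
have := dH _ Hf; rewrite /= innerZl inner_nrm ImM ImN /= mulr0 add0r mulNr oppr_ge0.
by rewrite pmulr_rle0.
Qed.

End ResolventExistence.

(** * Constancy of [- z Q(z)] on the second quadrant *)

Section QuadrantConstancy.
Context {R : realType} {M : hilbertType R}.
Implicit Types (f g k : M) (z w mu nu : R[i]) (N : set (M * M)).

Lemma resolvent_bound N mu (T : {linear M -> M}) (c : R) : 0 < c -> is_resolvent N mu T ->
  (forall p, N p -> c * nrm p.1 <= nrm (p.2 + mu *: p.1)) ->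
  forall k, nrm (T k) <= c^-1 * nrm k.
Proof.
move=> c0 /is_resolventP[h1 _] H k; have := H _ (h1 k).
by rewrite /= subrK mulrC -ler_pdivlMr// mulrC.
Qed.

Lemma numerical_range_bound mu (p : M * M) (c : R) :
  c * nrm p.1 ^+ 2 <= cabs (inner p.2 p.1 + mu * (nrm p.1 ^+ 2)%:C) ->
  c * nrm p.1 <= nrm (p.2 + mu *: p.1).
Proof.
have [->|p0] := eqVneq p.1 0; first by rewrite nrm0 mulr0 nrm_ge0.
have pp : 0 < nrm p.1 by rewrite nrm_gt0.
move=> h; rewrite -(ler_pM2r pp) -mulrA -expr2; apply: (le_trans h).
apply: le_trans (cauchy_schwarz _ _).
by rewrite innerDl innerZl inner_nrm.
Qed.

(** Multiplication by the conjugate of [- z] undoes the rotation. With [q = (f', f)] and [n = |f|^2]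
    the imaginary part becomes [|z|^2 Im q + n (Re mu Im z - Im mu Re z)]; both terms are
    nonnegative, and the second is at least [n |z|] times the minimum. *)
Lemma quadrant_bound z mu (p : M * M) : second_quadrant z ->
  0 < complex.Re mu -> 0 < complex.Im mu -> 0 <= complex.Im (inner p.2 p.1) ->
  Num.min (complex.Re mu) (complex.Im mu) * nrm p.1 <= nrm (- z *: p.2 + mu *: p.1).
Proof.
move=> [x0 [y0 z0]] s0 r0 q0.
apply: (@numerical_range_bound mu (p.1, - z *: p.2)); rewrite /= innerZl.
set n := nrm p.1 ^+ 2; have n0 : 0 <= n by exact: sqr_ge0.
set q := inner p.2 p.1 in q0 *; set m := Num.min _ _.
have m1 : m <= complex.Re mu by rewrite ge_min lexx.
have m2 : m <= complex.Im mu by rewrite ge_min lexx orbT.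
have m0 : 0 < m by rewrite lt_min s0.
have zc : 0 < cabs z by rewrite cabs_gt0.
rewrite -(ler_pM2r zc).
have <- : cabs (- z^*%C) = cabs z by rewrite cabsN cabs_conj.
rewrite -cabsM; apply: le_trans (normIm_le_cabs _); apply: le_trans (ler_norm _).
rewrite cabsN cabs_conj.
have -> : complex.Im ((- z * q + mu * n%:C) * - z^*%C) =
    cabs z ^+ 2 * complex.Im q + n * (complex.Re mu * complex.Im z - complex.Im mu * complex.Re z).
  rewrite sqr_cabs; case: (z) => x y; rewrite !ReImE /=; ring.
have h1 : 0 <= cabs z ^+ 2 * complex.Im q by rewrite mulr_ge0 ?sqr_ge0.
have h2 : m * cabs z <= complex.Re mu * complex.Im z - complex.Im mu * complex.Re z.
  have a1 := ler_wpM2l (ltW m0) (cabs_le_ReIm z).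
  rewrite (ger0_norm y0) ler0_norm// in a1.
  have a2 := ler_wpM2r y0 m1.
  have a3 : m * - complex.Re z <= complex.Im mu * - complex.Re z.
    by rewrite ler_wpM2r// oppr_ge0.
  by move: a1 a2 a3; clear; lra.
have h3 := ler_wpM2l n0 h2.
by move: h1 h3; clear; lra.
Qed.

Lemma quadrant_boundary_bound mu (p : M * M) : 0 <= complex.Re mu ->
  0 <= inner p.2 p.1 -> cabs mu * nrm p.1 <= nrm (p.2 + mu *: p.1).
Proof.
move=> s0 q0; apply: numerical_range_bound.
set n := nrm p.1 ^+ 2; have n0 : 0 <= n by exact: sqr_ge0.
have [a0 aE] : 0 <= complex.Re (inner p.2 p.1) /\ complex.Im (inner p.2 p.1) = 0.
  by move: q0; case: (inner _ _) => a b; rewrite lecE /= => /andP[/eqP -> ?].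
have cn : 0 <= cabs mu * n by apply: mulr_ge0; first exact: cabs_ge0.
rewrite -(ler_pXn2r (n := 2)) ?nnegrE ?cabs_ge0//.
rewrite exprMn !sqr_cabs !ReImE /= aE.
have : 0 <= complex.Re (inner p.2 p.1) * (complex.Re mu * n) by rewrite mulr_ge0// mulr_ge0.
have := sqr_ge0 (complex.Re (inner p.2 p.1)).
by clear; lra.
Qed.

Lemma nonneg_of_linear_bound (a b c : R) :
  (forall s r : R, 0 < s -> 0 < r -> 0 <= c + s * a + r * b) -> 0 <= a /\ 0 <= b.
Proof.
have aux a' b' c' : (forall s r : R, 0 < s -> 0 < r -> 0 <= c' + s * a' + r * b') -> 0 <= a'.
  move=> H; rewrite leNgt; apply/negP => a0.
  have hs : 0 < (`|c'| + `|b'| + 1) / - a'.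
    by rewrite divr_gt0 ?oppr_gt0// ltr_wpDl// addr_ge0.
  have := H _ 1 hs ltr01.
  have -> : (`|c'| + `|b'| + 1) / - a' * a' = - (`|c'| + `|b'| + 1).
    by field; rewrite lt_eqF.
  by have := ler_norm c'; have := ler_norm b'; lra.
move=> H; split; first exact: aux H.
by apply: (aux b a c) => s r s0 r0; have := H r s r0 s0; rewrite addrAC.
Qed.

(** Polarization with [k + h] and [k + i h]: over the complex numbers the quadratic form determines
    the operator. *)
Lemma hermitian_form_unique (T S : {linear M -> M}) :
  (forall k, inner (T k) k = inner (S k) k) -> forall k, T k = S k.
Proof.
move=> H k; apply: inner_ext => h.
have e1 := H (k + h); have e2 := H (k + 'i%C *: h).
have lin (X : {linear M -> M}) : X (k + 'i%C *: h) = X k + 'i%C *: X h by rewrite linearD linearZ.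
have linD (X : {linear M -> M}) : X (k + h) = X k + X h by rewrite linearD.
rewrite !linD !innerE !H in e1; rewrite !lin !innerE !H in e2.
have i2 : ('i%C : R[i])^*%C = - 'i%C by apply: complex_ext; rewrite //= oppr0.
rewrite i2 in e2.
have ii : ('i%C : R[i]) * 'i%C = -1 by rewrite -expr2 sqr_i.
have a1 : inner (T k) h + inner (T h) k = inner (S k) h + inner (S h) k.
  apply: (addrI (inner (S k) k + inner (S h) h)).
  by transitivity (inner (S k) k + inner (T h) k + (inner (T k) h + inner (S h) h));
    [ring|rewrite e1; ring].
have a2 : 'i%C * (inner (T h) k - inner (T k) h) = 'i%C * (inner (S h) k - inner (S k) h).
  apply: (addrI (inner (S k) k + 'i%C * (- 'i%C * inner (S h) h))).
  transitivity (inner (S k) k + 'i%C * inner (T h) k +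
    (- 'i%C * inner (T k) h + 'i%C * (- 'i%C * inner (S h) h))); first by ring.
  by rewrite e2; ring.
have i0 : ('i%C : R[i]) != 0 by rewrite eq_complex /= oner_eq0 andbF.
have {}a2 := mulfI i0 a2.
have : 2 * inner (T k) h = 2 * inner (S k) h.
  transitivity ((inner (T k) h + inner (T h) k) - (inner (T h) k - inner (T k) h)); first by ring.
  by rewrite a1 a2; ring.
by apply: mulfI; rewrite pnatr_eq0.
Qed.

End QuadrantConstancy.

Section FamilyOnQuadrant.
Context {R : realType} {M : hilbertType R}.
Variables (Q : R[i] -> set (M * M)) (mu0 : R[i]) (G : R[i] -> {linear M -> M}).
Notation SQ := (@second_quadrant R).
Hypothesis linQ : forall z, SQ z -> linear_relation (Q z).
Hypothesis dissQ : forall z, SQ z -> dissipative (Q z).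
Hypothesis boundaryQ : forall z, SQ z -> complex.Re z = 0 \/ complex.Im z = 0 ->
  forall p, Q z p -> 0 <= - z * inner p.2 p.1.
Hypothesis mu0_gt0 : 0 < complex.Im mu0.
Hypothesis GQ : forall z, SQ z -> is_resolvent (Q z) mu0 (G z).
Hypothesis dG : forall z, SQ z -> exists l : M -> M,
  forall f, vderiv SQ (fun w => G w f) z (l f).

Let N z := scale_rel (- z) (Q z).

Let SQ_neq0 z : SQ z -> z != 0. Proof. by case=> _ []. Qed.

Let cabs_inner_le (T : {linear M -> M}) (C : R) k h : (forall k, nrm (T k) <= C * nrm k) ->
  cabs (inner (T k) h) <= C * nrm k * nrm h.
Proof.
move=> TC; apply: (le_trans (cauchy_schwarz _ _)).
by apply: ler_wpM2r; [exact: nrm_ge0|exact: TC].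
Qed.

(** [- z Q(z) + mu = - z (Q(z) + nu)] with [nu = - mu / z], which lies in the upper half-plane for
    [z] in the second and [mu] in the open first quadrant. So a resolvent of the dissipative
    relation [Q z] at [nu] provides the one sought. *)
Let resolvent_family mu : 0 < complex.Re mu -> 0 < complex.Im mu ->
  {H : R[i] -> {linear M -> M} & forall z, SQ z -> is_resolvent (N z) mu (H z)}.
Proof.
move=> s0 r0.
apply: (boolp.choice (P := fun z T => SQ z -> is_resolvent (N z) mu T)) => z.
have [Sz|nS] := pselect (SQ z); last by exists (@idfun M : {linear M -> M}).
have nz : - z != 0 by rewrite oppr_eq0 SQ_neq0.
pose nu := (- z)^-1 * mu.
have nu0 : 0 < complex.Im nu.
  have [x0 [y0 z0]] := Sz; have c0 : 0 < cabs z by rewrite cabs_gt0.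
  have -> : complex.Im nu =
      (complex.Re mu * complex.Im z + complex.Im mu * - complex.Re z) / cabs z ^+ 2.
    by rewrite /nu invrN !ReImE ReV ImV; field; rewrite gt_eqF.
  rewrite divr_gt0 ?exprn_gt0//.
  have a1 : 0 <= complex.Re mu * complex.Im z by rewrite mulr_ge0// ltW.
  have a2 : 0 <= complex.Im mu * - complex.Re z by rewrite mulr_ge0 ?oppr_ge0// ltW.
  rewrite lt_def addr_ge0// andbT paddr_eq0// !mulf_eq0 oppr_eq0 (gt_eqF s0) (gt_eqF r0) /=.
  by apply: contra z0 => /andP[/eqP hy /eqP hx]; apply/eqP/complex_ext.
have [T HT] := resolvent_dissipative (linQ Sz) (dissQ Sz) (GQ Sz) mu0_gt0 nu0.
have [T' HT'] := resolvent_scale nz HT.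
by exists T' => _; move: HT'; rewrite /nu mulrA divff// mul1r.
Qed.

Let N_quadrant_bound mu z : SQ z -> 0 < complex.Re mu -> 0 < complex.Im mu ->
  forall p, N z p -> cabs mu * nrm p.1 <= nrm (p.2 + mu *: p.1).
Proof.
move=> Sz s0 r0 p Np.
have [H HN] := resolvent_family s0 r0.
pose m := Num.min (complex.Re mu) (complex.Im mu).
have m0 : 0 < m by rewrite lt_min s0.
have mu_gt0 : 0 < cabs mu.
  by rewrite cabs_gt0; apply/eqP => mu0E; move: s0; rewrite mu0E /= ltxx.
have HC w : SQ w -> forall k, nrm (H w k) <= m^-1 * nrm k.
  move=> Sw; apply: (resolvent_bound m0 (HN w Sw)) => _ [q Qq <-] /=.
  by apply: quadrant_bound => //; exact: dissQ Qq.
have HB w : SQ w -> complex.Re w = 0 \/ complex.Im w = 0 ->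
    forall k, nrm (H w k) <= (cabs mu)^-1 * nrm k.
  move=> Sw bw; apply: (resolvent_bound mu_gt0 (HN w Sw)) => _ [q Qq <-].
  apply: quadrant_boundary_bound; first exact: ltW.
  by rewrite /= innerZl; exact: boundaryQ.
pose k := p.2 + mu *: p.1.
have Hp : H z k = p.1 by have /is_resolventP[_ h2] := HN z Sz; exact: h2.
have iC : 0 <= m^-1 by rewrite invr_ge0 ltW.
(* The operator bound is reduced to a scalar one by pairing with the fixed vector [H z k]: at
   [w = z] the value is [|H z k|^2], which is real, so a bound for real parts is enough. *)
have := @phragmen_lindelof R (fun w => inner (H w k) (H z k))
  ((cabs mu)^-1 * nrm k * nrm (H z k)) (m^-1 * nrm k * nrm (H z k)) _ _ _ z Sz.
rewrite inner_nrm /= Hp => PL.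
have [->|p0] := eqVneq p.1 0; first by rewrite nrm0 mulr0 nrm_ge0.
have pp : 0 < nrm p.1 by rewrite nrm_gt0.
rewrite -(ler_pM2r pp) -mulrA -ler_pdivlMl// mulrA -expr2; apply: PL.
- move=> w Sw.
  have [l hl] := resolvent_vderiv iC SQ_neq0 GQ HN HC dG k Sw.
  by exists (inner l p.1); exact: cderiv_inner.
- by move=> w Sw; apply: (le_trans (Re_le_cabs _)); apply: cabs_inner_le; exact: HC.
- by move=> w Sw bw; apply: (le_trans (Re_le_cabs _)); apply: cabs_inner_le; exact: HB.
Qed.

(** Squaring the bound cancels [|mu|^2 |f|^2]. For [mu = s + i r] and [q = (f', f)] there remains
    [|f'|^2 / 2 + s Re q + r Im q >= 0] for all positive [s] and [r]; letting either grow gives a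
    sign. *)
Let N_numerical_range z p : SQ z -> N z p ->
  0 <= complex.Re (inner p.2 p.1) /\ 0 <= complex.Im (inner p.2 p.1).
Proof.
move=> Sz Np; apply: (@nonneg_of_linear_bound _ _ _ (nrm p.2 ^+ 2 / 2)) => s r s0 r0.
have := @N_quadrant_bound (s +i* r) z Sz s0 r0 p Np.
rewrite -(ler_pXn2r (n := 2)) ?nnegrE ?mulr_ge0 ?cabs_ge0 ?nrm_ge0//.
rewrite sqr_nrmD nrmZ innerZr ReM /= exprMn mulNr opprK.
by lra.
Qed.

Let unit_resolvent :
  {H : R[i] -> {linear M -> M} & forall z, SQ z -> is_resolvent (N z) 1 (H z)}.
Proof.
(* A point of the open quadrant with [|1 - mu| < 1 <= |mu|]: the resolvent there has norm at most 1,
   so it can be shifted to 1, on the edge of the quadrant. *)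
pose mu : R[i] := 1 +i* (2^-1).
have [||H HN] := @resolvent_family mu; rewrite ?ltr01 ?invr_gt0//.
apply: (boolp.choice (P := fun z T => SQ z -> is_resolvent (N z) 1 T)) => z.
have [Sz|nS] := pselect (SQ z); last by exists (@idfun M : {linear M -> M}).
have mu1 : 1 <= cabs mu by have := Re_le_cabs mu.
have HC k : nrm (H z k) <= 1 * nrm k.
  rewrite -[1]invr1; apply: (resolvent_bound ltr01 (HN z Sz)) => p Np.
  apply: le_trans (N_quadrant_bound Sz _ _ Np); rewrite ?ltr01 ?invr_gt0//.
  by apply: ler_wpM2r => //; exact: nrm_ge0.
have [|T HT] := resolvent_shift (nu := 1) (linear_scale_rel (- z) (linQ Sz)) (HN z Sz) HC.
  rewrite mulr1; apply: (le_lt_trans (cabs_le_ReIm _)); rewrite !ReImE /= subrr normr0 !add0r.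
  by rewrite normrN ger0_norm ?invr_ge0// invf_lt1 ?ltr1n.
by exists T.
Qed.

Lemma quadrant_family_const :
  exists2 T : {linear M -> M}, is_resolvent (Q (-1)) 1 T &
    forall z, SQ z -> scale_rel (- z) (Q z) = Q (-1).
Proof.
have [H HN] := unit_resolvent.
have HC z : SQ z -> forall k, nrm (H z k) <= 1 * nrm k.
  move=> Sz; rewrite -[1]invr1; apply: (resolvent_bound ltr01 (HN z Sz)) => p Np.
  apply: numerical_range_bound; rewrite !mul1r.
  apply: le_trans (Re_le_cabs _); rewrite ReD /= lerDr.
  by case: (N_numerical_range Sz Np).
(* With [f = H z k] and [k = f' + f], the form [(H z k, k)] is [|f|^2] plus the conjugate of
   [(f', f)], so the numerical range decides the sign of its imaginary part. *)
have herm z k : SQ z -> 0 <= - complex.Im (inner (H z k) k).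
  move=> Sz; have /is_resolventP[h1 _] := HN z Sz.
  have [_] := N_numerical_range Sz (h1 k); rewrite /= scale1r.
  rewrite innerDl innerNl inner_nrm ImD ImN /= subr0 innerC.
  by case: (inner _ _).
have hermB z k : SQ z -> complex.Re z = 0 \/ complex.Im z = 0 ->
    complex.Im (inner (H z k) k) = 0.
  move=> Sz bz; have /is_resolventP[h1 _] := HN z Sz.
  have [q Qq Eq] := h1 k; have := boundaryQ Sz bz Qq.
  rewrite -innerZl; move: Eq => [-> ->].
  rewrite scale1r innerDl innerNl inner_nrm innerC; case: (inner _ _) => a b.
  by rewrite lecE /= subr0 => /andP[/eqP]; lra.
have diff k : cdifferentiable SQ (fun w => inner (H w k) k).
  move=> w Sw; have [l hl] := resolvent_vderiv (ler01 : 0 <= (1 : R)) SQ_neq0 GQ HN HC dG k Sw.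
  by exists (inner l k); exact: cderiv_inner.
have ReI (x : R[i]) : complex.Re ('i%C * x) = - complex.Im x by rewrite mulrC ReiNIm.
have hermI k z : SQ z -> complex.Im (inner (H z k) k) = 0.
  move=> Sz; apply/eqP; rewrite eq_le; apply/andP; split.
    by have := herm z k Sz; rewrite oppr_ge0.
  (* The opposite sign comes from Phragmen-Lindelof for [i (H w k, k)], whose real part vanishes on
     the sides. *)
  have := @phragmen_lindelof R (fun w => 'i%C * inner (H w k) k) 0 (1 * nrm k * nrm k) _ _ _ z Sz.
  rewrite ReI oppr_le0; apply.
  - by apply: cdifferentiableM => //; exact: cdifferentiable_cst.
  - move=> w Sw; apply: (le_trans (Re_le_cabs _)).
    have -> : cabs ('i%C * inner (H w k) k) = cabs (inner (H w k) k).
      rewrite cabsM (_ : cabs 'i%C = 1) ?mul1r//.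
      by rewrite /Normc.normc expr0n add0r expr1n sqrtr1.
    by apply: cabs_inner_le; exact: HC.
  - by move=> w Sw bw; rewrite ReI hermB// oppr0.
have Q1 : SQ (-1).
  split => /=; first by rewrite lerN10.
  by rewrite oppr0 lexx oppr_eq0 oner_eq0.
have N1 : N (-1) = Q (-1) by rewrite /N opprK scale_rel1.
exists (H (-1)); first by rewrite -N1; exact: HN.
move=> z Sz; rewrite -N1; apply: (resolvent_unique (mu := 1) (T := H z)); first exact: HN.
have E : forall k, H z k = H (-1) k.
  apply: hermitian_form_unique => k.
  exact: (real_on_second_quadrant (diff k) (fun w => hermI k w)).
have /is_resolventP[h1 h2] := HN _ Q1; apply/is_resolventP; split => [g|p Np].
  by rewrite E.
by rewrite E; exact: h2.
Qed.

End FamilyOnQuadrant.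

(** * From the second quadrant to the whole cut plane *)

Section StieltjesInnerForm.
Context {R : realType} {M : hilbertType R}.
Implicit Types (f g k : M) (z w mu nu : R[i]) (B : set (M * M)).

Lemma vderiv_sub (D D' : set R[i]) (v : R[i] -> M) z l :
  D' `<=` D -> vderiv D v z l -> vderiv D' v z l.
Proof.
by move=> DD H e e0; have [d d0 {}H] := H e e0; exists d => // w /DD; exact: H.
Qed.

Lemma second_quadrant_cases z : second_quadrant z ->
  upper_half_plane z \/ negative_axis z.
Proof.
move=> [x0 [y0 z0]]; have [y0'|y1] := eqVneq (complex.Im z) 0.
  right; exists (complex.Re z) => /=; last exact: complex_ext.
  rewrite lt_neqAle x0 andbT; apply: contra z0 => /eqP x0'.
  by apply/eqP/complex_ext.
by left; rewrite /upper_half_plane /= lt_neqAle y0 eq_sym y1.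
Qed.

(** Nonnegativity gives symmetry by polarization. For [{k, k'}] in the adjoint, choose [{f, f'}] in
    [B] with [f' + f = k' + k]; then [k - f] is orthogonal to the range of [B + 1], which is the
    whole space. *)
Lemma selfadjoint_of_resolvent B (T : {linear M -> M}) : linear_relation B -> nonnegative B ->
  is_resolvent B 1 T -> selfadjoint B.
Proof.
move=> lB nB /is_resolventP[h1 h2]; split => //.
have sub : B `<=` adjoint B.
  move=> [k k'] Bk [f f'] Bf /=.
  have form_real p : B p -> complex.Im (inner p.2 p.1) = 0.
    by move=> Bp; have [-> _] := nonnegative_inner nB Bp.
  have e1 := form_real _ (linear_relationD lB Bf Bk).
  have e2 := form_real _ (linear_relationD lB Bf (linear_relationZ 'i%C lB Bk)).
  have e3 := form_real _ Bf; have e4 := form_real _ Bk.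
  rewrite /= !innerE !ImD in e1 e3 e4.
  have i2 : ('i%C : R[i])^*%C = - 'i%C by apply: complex_ext; rewrite //= oppr0.
  have {}e2 : complex.Im (inner (f' + 'i%C *: k') (f + 'i%C *: k)) = 0 := e2.
  rewrite !innerE i2 !ImD in e2.
  rewrite [inner f k']innerC.
  move: e1 e2 e3 e4; case: (inner f' f) => a1 b1; case: (inner k' k) => a2 b2.
  case: (inner f' k) => a3 b3; case: (inner k' f) => a4 b4 /= e1 e2 e3 e4.
  apply: complex_ext => /=; move: e1 e2 e3 e4; clear; lra.
apply/seteqP; split => // -[k k'] Bk.
have Bf := h1 (k' + k); set f := T _ in Bf; rewrite scale1r in Bf.
suff kf : k = f by rewrite -kf addrK in Bf.
apply/eqP; rewrite -subr_eq0; apply/eqP/nrm_eq0/eqP; rewrite -sqrf_eq0.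
have Bg := h1 (k - f); set g := T _ in Bg; rewrite scale1r in Bg.
have := Bk _ Bg; have := sub _ Bf _ Bg; rewrite /= => E1 E2.
have : inner (k - f) (k - f) = 0.
  rewrite -{1}(subrK g (k - f)) innerDl innerDr innerNr E1 E2.
  by rewrite !innerE; ring.
by rewrite inner_nrm => /(congr1 (@complex.Re R)) /= ->.
Qed.

Lemma stieltjes_inner_form (Q : R[i] -> set (M * M)) :
  stieltjes Q -> inner_family Q ->
  exists B, [/\ selfadjoint B, nonnegative B &
    forall z, off_Rplus z -> Q z = scale_rel (- z^-1) B].
Proof.
move=> [linQ [[maxu maxl] adjQ _] nnQ [[mu0 mu0_gt0 [V [oV UV [G hG GQ]]]] _]] innerQ.
have SQD z : second_quadrant z -> (upper_half_plane `|` negative_axis) z.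
  exact: second_quadrant_cases.
have SQoff z : second_quadrant z -> off_Rplus z.
  by move=> /second_quadrant_cases[/upper_off_Rplus//|[x x0 <-]]; exact: negative_off_Rplus.
have [] := @quadrant_family_const R M Q mu0 G _ _ _ mu0_gt0.
- by move=> z /SQoff; exact: linQ.
- move=> z /second_quadrant_cases[hz|[x x0 <-]]; first by have [] := maxu z hz.
  by move=> p /(nnQ x x0); case: (inner _ _) => a b; rewrite lecE /= => /andP[/eqP ->].
- move=> z Sz bz p Qp; have [x0 [y0 z0]] := Sz.
  have [/maxu[_ dz _]|[x x0' xE]] := second_quadrant_cases Sz; last first.
    rewrite -xE in Qp *; rewrite mulr_ge0//; last exact: nnQ x0' _ Qp.
    by rewrite -rmorphN ler0c oppr_ge0 ltW.
  have [re0|im0] := bz; last first.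
    have : second_quadrant z := Sz.
    have xE : z = (complex.Re z)%:C by apply: complex_ext.
    have x0' : complex.Re z < 0.
      rewrite lt_neqAle x0 andbT; apply: contra z0 => /eqP x00.
      by rewrite xE x00.
    rewrite xE in Qp *; rewrite mulr_ge0//; last exact: nnQ x0' _ Qp.
    by rewrite -rmorphN ler0c oppr_ge0.
  have zE : z = (complex.Im z) *i by apply: complex_ext.
  have y0' : complex.Im z != 0.
    by apply: contra z0 => /eqP y00; rewrite zE y00.
  have := innerQ _ y0' p; rewrite -zE => /(_ Qp).
  have := dz p Qp; case: (inner _ _) => a b /= b0 a0.
  rewrite lecE !ReImE /= a0 re0; apply/andP; split; first by apply/eqP; ring.
  by have : 0 <= complex.Im z * b; [rewrite mulr_ge0|lra].
- by move=> z Sz; apply: GQ; exact: SQD.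
- move=> z /SQD/UV Vz; have [l hl] := vderiv_of_holomorphic hG Vz.
  by exists l => f; exact: vderiv_sub (hl f).
move=> T HT QB; set B := Q (-1) in HT QB.
have lt_neg1 : (-1 : R) < 0 by rewrite oppr_lt0 ltr01.
have m1 : -1 = (-1 : R)%:C :> R[i] by rewrite rmorphN1.
have nB : nonnegative B by rewrite /B m1; exact: nnQ.
have lB : linear_relation B by apply: linQ; rewrite m1; exact: negative_off_Rplus.
have sB : selfadjoint B by exact: selfadjoint_of_resolvent HT.
have QSQ z : second_quadrant z -> Q z = scale_rel (- z^-1) B.
  move=> Sz; rewrite -(QB z Sz) scale_relM mulrNN mulVf ?scale_rel1//.
  by case: Sz => _ [].
have Qup z : upper_half_plane z -> Q z = scale_rel (- z^-1) B.
  move=> hz; have zoff := upper_off_Rplus hz; have z0 := off_Rplus_neq0 zoff.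
  have nz0 : - z^-1 != 0 by rewrite oppr_eq0 invr_eq0.
  (* [- z^-1 B] is maximal dissipative by the converse direction, so its inclusion in [Q z] is
     enough. *)
  have [[_ [[mB _] _ _] _ _] _] :=
    @stieltjes_inner_of_selfadjoint R M B (fun z => scale_rel (- z^-1) B) sB nB (fun _ _ => erefl).
  have [_ _ mBz] := mB z hz; apply: mBz.
  + exact: linQ.
  + by have [] := maxu z hz.
  move=> _ [[f b] Bb <-] /=.
  (* The equation [G w (- w^-1 b + mu0 f) = f] places [{f, - w^-1 b}] in [Q w]. Multiplied by [- w]
     and paired with [h], it becomes the vanishing of a holomorphic function, already known on the
     second quadrant. *)
  have vanish h w : 0 < complex.Im w ->
      inner (G w b) h + (- mu0) * (w * inner (G w f) h) + w * inner f h = 0.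
    apply: (@identity_upper_half_plane R (fun w =>
      inner (G w b) h + (- mu0) * (w * inner (G w f) h) + w * inner f h)).
      have diffG k : cdifferentiable [set w | 0 < complex.Im w] (fun w => inner (G w k) h).
        move=> v hv; have Vv : V v by apply: UV; left.
        have [l hl] := vderiv_of_holomorphic hG Vv.
        by exists (inner (l k) h); apply: cderiv_inner; exact: vderiv_sub (hl k).
      have did := @cdifferentiable_id R [set w | 0 < complex.Im w].
      apply: cdifferentiableD; [apply: cdifferentiableD => //|].
        apply: cdifferentiableM; first exact: cdifferentiable_cst.
        exact: cdifferentiableM.
      by apply: cdifferentiableM => //; exact: cdifferentiable_cst.
    move=> v x0 y0; have Sv : second_quadrant v.
      split; [exact: ltW|split; [exact: ltW|]].
      by apply/eqP => v0; move: x0; rewrite v0 /= ltxx.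
    have v0 : v != 0 by case: Sv => _ [].
    have Qv : Q v (f, - v^-1 *: b) by rewrite (QSQ v Sv); exists (f, b).
    have /is_resolventP[_ h2] := GQ v (SQD v Sv).
    have := h2 _ Qv; rewrite /= linearD !linearZ /= => E.
    transitivity (- v * (inner (- v^-1 *: G v b + mu0 *: G v f) h - inner f h)).
      by rewrite !innerE; field.
    by rewrite E subrr mulr0.
  have /is_resolventP[h1 _] := GQ z (or_introl hz).
  have := h1 (- z^-1 *: b + mu0 *: f).
  have -> : G z (- z^-1 *: b + mu0 *: f) = f.
    rewrite linearD !linearZ /=; apply: inner_ext => h.
    apply/eqP; rewrite -subr_eq0; apply/eqP.
    transitivity (- z^-1 * (inner (G z b) h + (- mu0) * (z * inner (G z f) h) + z * inner f h)).
      by rewrite !innerE; field.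
    by rewrite vanish// mulr0.
  by rewrite addrK.
exists B; split => // z /off_RplusP hz.
have [im0|im1] := eqVneq (complex.Im z) 0.
  apply: QSQ; have x0 : complex.Re z < 0 by case: hz => [|//]; rewrite im0 eqxx.
  split; first exact: ltW.
  split; first by rewrite im0.
  by apply/eqP => z0; move: x0; rewrite z0 /= ltxx.
have [hz'|hz'] := ltP 0 (complex.Im z); first exact: Qup.
have z0 : z != 0 by apply: contra im1 => /eqP ->.
have up : upper_half_plane z^*%C.
  rewrite /upper_half_plane /=; case: (z) im1 hz' => a b /= b0 b1.
  by rewrite oppr_gt0 lt_neqAle b0.
have := adjQ z^*%C; rewrite conjcK => <-; last by rewrite gt_eqF.
rewrite (Qup _ up) adjoint_scale_rel; last first.
  by rewrite oppr_eq0 invr_eq0 conjc_eq0.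
by rewrite -sB.2 conjcN conjc_inv conjcK.
Qed.

End StieltjesInnerForm.

(** * Inverse Stieltjes families *)

Section NegativeInverse.
Context {R : realType} {M : hilbertType R}.
Implicit Types (f g k : M) (z w mu nu : R[i]) (B H K : set (M * M)).

(* The relation [- H^-1]; the map [H |-> - H^-1] exchanges the classes of Stieltjes
   and inverse Stieltjes families. *)
Definition neg_inv H : set (M * M) := [set p | H (- p.2, p.1)].

Lemma linear_neg_inv H : linear_relation H -> linear_relation (neg_inv H).
Proof.
move=> lH; split; first by rewrite /neg_inv /= oppr0; case: lH.
move=> c p q Hp Hq; rewrite /neg_inv /= opprD -scalerN.
by case: lH => _ /(_ c _ _ Hp Hq).
Qed.

Lemma neg_invK H : linear_relation H -> neg_inv (neg_inv H) = H.
Proof.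
move=> lH; have opp p : H p -> H (- p) by rewrite -scaleN1r; exact: linear_relationZ.
apply/seteqP; split => -[f f'] /opp; rewrite /neg_inv /=; last by [].
by rewrite -{2}[f]opprK -{2}[f']opprK.
Qed.

Lemma adjoint_neg_inv H : adjoint (neg_inv H) = neg_inv (adjoint H).
Proof.
apply/seteqP; split => -[k k'] /= hk [f f'] Hf /=.
  have /= := hk (f', - f); rewrite /neg_inv /= opprK => /(_ Hf).
  by rewrite !innerE => <-; rewrite opprK.
have /= := hk _ Hf; rewrite !innerE => /eqP; rewrite eqr_opp => /eqP ->.
by [].
Qed.

Lemma maximal_neg_inv (P : set (M * M) -> Prop) H :
  (forall K, P K -> P (neg_inv K)) -> maximal P H -> maximal P (neg_inv H).
Proof.
move=> PN [lH PH maxH]; split; [exact: linear_neg_inv|exact: PN|].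
move=> K lK PK HK; rewrite -(neg_invK lK); congr neg_inv.
apply: maxH; [exact: linear_neg_inv|exact: PN|].
by move=> p; rewrite -{1}(neg_invK lH) => Hp; exact: HK.
Qed.

Lemma Im_inner_neg_inv (p : M * M) :
  complex.Im (inner p.2 p.1) = complex.Im (inner p.1 (- p.2)).
Proof. by rewrite innerNr innerC ImN; case: (inner _ _). Qed.

Lemma dissipative_neg_inv H : dissipative H -> dissipative (neg_inv H).
Proof. by move=> dH p /dH h; rewrite Im_inner_neg_inv. Qed.

Lemma accumulative_neg_inv H : accumulative H -> accumulative (neg_inv H).
Proof. by move=> dH p /dH h; rewrite Im_inner_neg_inv. Qed.

(** This is the identity [(- H^-1 - nu^-1)^-1 = nu^2 (H + nu)^-1 - nu]. The point [- nu^-1] lies in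
    the same half-plane as [nu], as the classes require. *)
Lemma is_resolvent_neg_inv H nu (T : {linear M -> M}) : nu != 0 -> is_resolvent H nu T ->
  is_resolvent (neg_inv H) (- nu^-1) ((nu ^+ 2 \*: T) \- (nu \*: @idfun M)).
Proof.
move=> n0 /is_resolventP[h1 h2]; apply/is_resolventP; split => [g|[f f'] Hf] /=.
  have := h1 (- nu *: g); rewrite /neg_inv /=.
  have -> : T (- nu *: g) = - nu *: T g by rewrite linearZ.
  have -> : - (g - - nu^-1 *: (nu ^+ 2 *: T g - nu *: g)) = - nu *: T g.
    by apply: inner_ext => h; rewrite !innerE; field.
  suff -> : nu ^+ 2 *: T g - nu *: g = - nu *: g - nu *: (- nu *: T g) by [].
  by apply: inner_ext => h; rewrite !innerE; ring.
have := h2 _ Hf; rewrite /= => E.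
have -> : T (f' + - nu^-1 *: f) = - nu^-1 *: T (f + nu *: - f').
  rewrite -linearZ; congr (T _).
  by apply: inner_ext => h; rewrite !innerE; field.
by rewrite E; apply: inner_ext => h; rewrite !innerE; field.
Qed.

Lemma holomorphic_neg_inv nu (U : set R[i]^o) (G : R[i]^o -> {linear M -> M}) :
  holomorphic_on U G -> holomorphic_on U (fun z => (nu ^+ 2 \*: G z) \- (nu \*: @idfun M)).
Proof.
move=> [bG dG]; split => z Uz.
  have [C C0 HC] := bounded_operator_ge0 (bG z Uz).
  apply/bounded_operatorP; exists (cabs (nu ^+ 2) * C + cabs nu) => f /=.
  apply: (le_trans (nrmB _ _)); rewrite !nrmZ mulrDl lerD2r -mulrA.
  by rewrite ler_wpM2l ?cabs_ge0.
have [D bD HD] := dG z Uz; exists (nu ^+ 2 \*: D).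
  have [C C0 HC] := bounded_operator_ge0 bD.
  apply/bounded_operatorP; exists (cabs (nu ^+ 2) * C) => f /=.
  by rewrite nrmZ -mulrA ler_wpM2l ?cabs_ge0.
move=> eps /posC[-> e0]; set e := complex.Re eps in e0 *.
have n0 : 0 < cabs (nu ^+ 2) + 1 by rewrite ltr_wpDl ?cabs_ge0.
have e1 : 0 < (e / (cabs (nu ^+ 2) + 1))%:C by rewrite ltcR divr_gt0.
have /near_dnbhs_cabsP[d d0 H] := HD _ e1; apply/near_dnbhs_cabsP.
exists d => // w wz wd f; have := H w wz wd f; rewrite !nrmE -!rmorphM !lecR => h.
rewrite (_ : _ - _ = nu ^+ 2 *: ((w - z)^-1 *: (G w f - G z f) - D f)); last first.
  by rewrite /=; apply: inner_ext => k; rewrite !innerE; ring.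
rewrite nrmZ; apply: (@le_trans _ _ (cabs (nu ^+ 2) * (e / (cabs (nu ^+ 2) + 1) * nrm f))).
  by rewrite ler_wpM2l ?cabs_ge0.
rewrite mulrA; apply: ler_wpM2r; first exact: nrm_ge0.
rewrite mulrA ler_pdivrMr// mulrC ler_wpM2l ?(ltW e0)// lerDl//.
Qed.

Lemma upper_opp_inv nu : upper_half_plane nu -> upper_half_plane (- nu^-1).
Proof.
move=> h; rewrite /upper_half_plane /= ImN ImV opprK divr_gt0// exprn_gt0// cabs_gt0.
exact: off_Rplus_neq0 (upper_off_Rplus h).
Qed.

Lemma lower_opp_inv nu : lower_half_plane nu -> lower_half_plane (- nu^-1).
Proof.
move=> h; rewrite /lower_half_plane /= ImN ImV opprK pmulr_llt0// invr_gt0 exprn_gt0// cabs_gt0.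
exact: off_Rplus_neq0 (lower_off_Rplus h).
Qed.

Section Transfer.
Variables Q S : R[i] -> set (M * M).
Hypothesis SQ : forall z, off_Rplus z -> S z = neg_inv (Q z).

Lemma nevanlinna_neg_inv : nevanlinna Q -> nevanlinna S.
Proof.
move=> [[mu ml] adjQ [[nu1 n1 [G1 hG1 RG1]] [nu2 n2 [G2 hG2 RG2]]]].
split.
- split => z hz.
    rewrite SQ; last exact: upper_off_Rplus.
    by apply: maximal_neg_inv (mu z hz); exact: dissipative_neg_inv.
  rewrite SQ; last exact: lower_off_Rplus.
  by apply: maximal_neg_inv (ml z hz); exact: accumulative_neg_inv.
- move=> z z0; rewrite !SQ ?adjoint_neg_inv ?adjQ//.
    by apply/off_RplusP; left; case: (z) z0 => a b /=; rewrite oppr_eq0.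
  by apply/off_RplusP; left.
- split.
    exists (- nu1^-1); first exact: upper_opp_inv.
    exists (fun z => (nu1 ^+ 2 \*: G1 z) \- (nu1 \*: @idfun M)); first exact: holomorphic_neg_inv.
    move=> z hz; rewrite SQ; last exact: upper_off_Rplus.
    exact: is_resolvent_neg_inv (off_Rplus_neq0 (upper_off_Rplus n1)) (RG1 z hz).
  exists (- nu2^-1); first exact: lower_opp_inv.
  exists (fun z => (nu2 ^+ 2 \*: G2 z) \- (nu2 \*: @idfun M)); first exact: holomorphic_neg_inv.
  move=> z hz; rewrite SQ; last exact: lower_off_Rplus.
  exact: is_resolvent_neg_inv (off_Rplus_neq0 (lower_off_Rplus n2)) (RG2 z hz).
Qed.

Lemma continued_neg_inv : continued Q -> continued S.
Proof.
move=> [[nu1 n1 [V1 [oV1 UV1 [G1 hG1 RG1]]]] [nu2 n2 [V2 [oV2 UV2 [G2 hG2 RG2]]]]].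
split.
  exists (- nu1^-1); first exact: upper_opp_inv.
  exists V1; split => //.
  exists (fun z => (nu1 ^+ 2 \*: G1 z) \- (nu1 \*: @idfun M)); first exact: holomorphic_neg_inv.
  move=> z hz; rewrite SQ.
    exact: is_resolvent_neg_inv (off_Rplus_neq0 (upper_off_Rplus n1)) (RG1 z hz).
  by case: hz => [/upper_off_Rplus|[x x0 <-]] //; exact: negative_off_Rplus.
exists (- nu2^-1); first exact: lower_opp_inv.
exists V2; split => //.
exists (fun z => (nu2 ^+ 2 \*: G2 z) \- (nu2 \*: @idfun M)); first exact: holomorphic_neg_inv.
move=> z hz; rewrite SQ.
  exact: is_resolvent_neg_inv (off_Rplus_neq0 (lower_off_Rplus n2)) (RG2 z hz).
by case: hz => [/lower_off_Rplus|[x x0 <-]] //; exact: negative_off_Rplus.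
Qed.

Lemma inner_family_neg_inv : inner_family Q -> inner_family S.
Proof.
move=> iQ y y0 p; rewrite SQ; last by apply/off_RplusP; left.
by move=> /(iQ y y0) /=; rewrite innerNr innerC ReN; case: (inner _ _) => a b /= /eqP; rewrite oppr_eq0 => /eqP.
Qed.

Lemma inverse_stieltjes_neg_inv : stieltjes Q -> inverse_stieltjes S.
Proof.
move=> [lQ nQ posQ cQ]; split.
- by move=> z hz; rewrite SQ//; apply: linear_neg_inv; exact: lQ.
- exact: nevanlinna_neg_inv.
- move=> x x0; rewrite SQ; last exact: negative_off_Rplus.
  move=> _ [p Qp <-] /=; have := posQ x x0 _ Qp.
  by rewrite /= innerC conj_ge0 scaleN1r.
- exact: continued_neg_inv.
Qed.

Lemma stieltjes_neg_inv : inverse_stieltjes Q -> stieltjes S.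
Proof.
move=> [lQ nQ posQ cQ]; split.
- by move=> z hz; rewrite SQ//; apply: linear_neg_inv; exact: lQ.
- exact: nevanlinna_neg_inv.
- move=> x x0; rewrite SQ; last exact: negative_off_Rplus.
  move=> p Qp; have /= := posQ x x0 (- p.2, -1 *: p.1) (ex_intro2 (Q x%:C) _ (- p.2, p.1) Qp erefl).
  by rewrite scaleN1r innerNl innerNr opprK innerC conj_ge0.
- exact: continued_neg_inv.
Qed.

End Transfer.

Lemma inv_relP B f g : inv_rel B (f, g) <-> B (g, f).
Proof. by split => [[[a b] Bab [<- <-]]|h] //; exists (g, f). Qed.

Lemma linear_inv_rel B : linear_relation B -> linear_relation (inv_rel B).
Proof.
move=> [B0 BD]; split; first by exists 0.
by move=> c [a b] [a' b'] /inv_relP h /inv_relP h'; apply/inv_relP; exact: BD c _ _ h h'.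
Qed.

Lemma selfadjoint_inv_rel B : selfadjoint B -> selfadjoint (inv_rel B).
Proof.
move=> [lB EB]; split; first exact: linear_inv_rel.
apply/seteqP; split => -[k k'].
  move=> /inv_relP Bk [f f'] /inv_relP Bf.
  have hk : adjoint B (k', k) by rewrite -EB.
  by have /= <- := hk _ Bf.
move=> hk; apply/inv_relP; rewrite EB => -[f f'] Bf.
by have /= <- := hk (f', f) (proj2 (inv_relP B f' f) Bf).
Qed.

Lemma nonnegative_inv_rel B : nonnegative B -> nonnegative (inv_rel B).
Proof. by move=> nB [k k'] /inv_relP /nB /=; rewrite innerC conj_ge0. Qed.

Lemma neg_inv_scale z B : linear_relation B -> z != 0 ->
  neg_inv (scale_rel (- z^-1) B) = scale_rel z (inv_rel B).
Proof.
move=> lB z0; have nz0 : - z^-1 != 0 by rewrite oppr_eq0 invr_eq0.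
have iz0 : - z != 0 by rewrite oppr_eq0.
apply/seteqP; split => -[f f'] h.
  apply/scale_relP => //; apply/inv_relP.
  have /scale_relP -/(_ nz0) h' : scale_rel (- z^-1) B (- f', f) := h.
  have := linear_relationZ (- z^-1) lB h'.
  suff -> : - z^-1 *: (- f', (- z^-1)^-1 *: f) = (z^-1 *: f', f) by [].
  rewrite /GRing.scale/=; congr pair; first by rewrite scalerN scaleNr opprK.
  by rewrite scalerA divff// scale1r.
have : scale_rel (- z^-1) B (- f', f).
  apply/scale_relP => //; rewrite invrN invrK.
  move: h => /scale_relP -/(_ z0) /inv_relP h.
  have := linear_relationZ (- z) lB h.
  suff -> : - z *: (z^-1 *: f', f) = (- f', - z *: f) by [].
  by rewrite /GRing.scale/=; congr pair; rewrite scalerA mulNr divff// scaleN1r.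
by [].
Qed.

Lemma inv_relK B : inv_rel (inv_rel B) = B.
Proof. by apply/seteqP; split => -[f f'] h; [move/inv_relP/inv_relP: h|apply/inv_relP/inv_relP]. Qed.

Lemma neg_inv_scaleV z B : linear_relation B -> z != 0 ->
  neg_inv (scale_rel z B) = scale_rel (- z^-1) (inv_rel B).
Proof.
move=> lB z0; have lI := linear_inv_rel lB.
rewrite -{1}[B]inv_relK -neg_inv_scale// neg_invK//.
exact: linear_scale_rel.
Qed.

End NegativeInverse.

Theorem theorem4p2 (R : realType) (M : hilbertType R) (sepM : separable M) :
  (forall Q : R[i] -> set (M * M),
     stieltjes Q /\ inner_family Q <->
     exists B : set (M * M),
       [/\ selfadjoint B, nonnegative B &
           forall z : R[i], off_Rplus z -> Q z = scale_rel (- z^-1) B]) /\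
  (forall S : R[i] -> set (M * M),
     inverse_stieltjes S /\ inner_family S <->
     exists C : set (M * M),
       [/\ selfadjoint C, nonnegative C &
           forall z : R[i], off_Rplus z -> S z = scale_rel z C]).
Proof.
split=> [Q|S]; split.
- by move=> [sQ iQ]; exact: stieltjes_inner_form.
- by move=> [B [sB nB QB]]; exact: stieltjes_inner_of_selfadjoint QB.
- move=> [sS iS]; have [lS _ _ _] := sS.
  pose Q z := neg_inv (S z).
  have [|B [sB nB QB]] := @stieltjes_inner_form R M Q (stieltjes_neg_inv (fun _ _ => erefl) sS).
    exact: inner_family_neg_inv iS.
  (* Inverting back, [- (- z^-1 B)^-1 = z B^-1], so [C] is [B^-1]. *)
  exists (inv_rel B); split; [exact: selfadjoint_inv_rel|exact: nonnegative_inv_rel|].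
  move=> z hz; rewrite -neg_inv_scale ?off_Rplus_neq0//; last by case: sB.
  by rewrite -QB// neg_invK//; exact: lS.
- move=> [C [sC nC SC]].
  have [lC _] := sC.
  pose Q z := neg_inv (S z).
  have QB z : off_Rplus z -> Q z = scale_rel (- z^-1) (inv_rel C).
    by move=> hz; rewrite /Q SC// neg_inv_scaleV// off_Rplus_neq0.
  have SQ z : off_Rplus z -> S z = neg_inv (Q z).
    by move=> hz; rewrite /Q neg_invK// SC//; exact: linear_scale_rel.
  have [sQ iQ] := stieltjes_inner_of_selfadjoint (selfadjoint_inv_rel sC) (nonnegative_inv_rel nC) QB.
  by split; [exact: inverse_stieltjes_neg_inv SQ sQ|exact: inner_family_neg_inv SQ iQ].
Qed.
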